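(* Let $k\ge1$, $\mathbf d\in(\mathbb Z_{\ge0})^k$, $d=\sum_i\mathbf d_i$. The set $\mathcal B_I=\{T_{Y_b}\}$ ($b$ running over all lower crossingless matches) acting on $\mathcal T_s(\mathbf d)\cong V_{\mathbf d_1}\otimes\cdots\otimes V_{\mathbf d_k}$ spans the space of intertwiners $\bigoplus_\mu\operatorname{Hom}_{\mathbf U_q}(V_{\mathbf d_1}\otimes\cdots\otimes V_{\mathbf d_k},V_\mu)$; here, for $b$ with $r$ arcs and $\mu=d-2r$ unmatched vertices, $T_{Y_b}$ is regarded as a map $\mathcal T_s(\mathbf d)\to\mathcal M^r(d)\cong V_\mu$. In particular, for each lower crossingless match $b$, with $r$ the number of its arcs, there is a non-zero constant $c_b\in\mathbb C(q)$ such that for all $\mathbf a$ with $0\le\mathbf a_i\le\mathbf d_i$ $$T_{Y_b}\mathbf 1_{Y_{\mathbf a}}=\begin{cases}c_b\,\mathbf 1_{\mathfrak M^r(|\mathbf a|,d)}\in\mathcal M^r(d)\cong V_{d-2r}=V_\mu&\text{if }\bar{\mathbf a}=b,\\0&\text{if }\bar{\mathbf a}\ne b.\end{cases}$$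
   Context: **Counting convention.** $\mathbb F$ is a finite field whose cardinality is written $q^2$; vector spaces are finite-dimensional over $\mathbb F$. Functions take values in $\mathbb C(q)$, $q$ an indeterminate, and spans are $\mathbb C(q)$-spans. $\mathbf 1_Y$ is the indicator function of $Y$. Numbers of points are viewed in $\mathbb C(q)$: the sets counted are given by the same linear-algebra conditions over every finite field and have $P_Y(|\mathbb F|)$ points for a polynomial $P_Y$, and $\chi_q(Y):=P_Y(q^2)$. Sums of function values over points are understood accordingly; for a map $p$, $p_!(f)(x)=\sum_{y\in p^{-1}(x)}f(y)$, so $p_!(\mathbf 1_Y)(x)=\chi_q(p^{-1}(x)\cap Y)$. **Quantum group.** $\mathbf U_q=U_q(\mathfrak{sl}_2)$ is the $\mathbb C(q)$-algebra generated by $E,F,K^{\pm1}$ with $KK^{-1}=K^{-1}K=1$, $KE=q^2EK$, $KF=q^{-2}FK$, $EF-FE=(K-K^{-1})/(q-q^{-1})$, with coproduct $\Delta K^{\pm1}=K^{\pm1}\otimes K^{\pm1}$, $\Delta E=E\otimes1+K\otimes E$, $\Delta F=F\otimes K^{-1}+1\otimes F$; tensor products are modules via iterated $\Delta$. $[n]=(q^n-q^{-n})/(q-q^{-1})$. $V_n$ has basis $v_n,v_{n-2},\dots,v_{-n}$ with $K^{\pm1}v_m=q^{\pm m}v_m$, $Ev_m=[\frac{n+m}2+1]v_{m+2}$, $Fv_m=[\frac{n-m}2+1]v_{m-2}$. **Varieties.** Let $D$ be a $d$-dimensional space. $\mathfrak M(d)=\{(W,t):W\subset D,\ t\in\mathrm{End}\,D,\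 \operatorname{im}t\subset W\subset\ker t\}$; $\mathfrak M^r(w,d)$ is the subset with $\dim W=w$, $\operatorname{rank}t=r$; $\mathcal M^r(d)=\bigoplus_w\mathbb C(q)\mathbf 1_{\mathfrak M^r(w,d)}$, $\mathcal M(d)=\bigoplus_r\mathcal M^r(d)$. $\mathfrak T(\mathbf d)$ is the set of triples $(\mathbf D,W,t)$ with $(W,t)\in\mathfrak M(d)$ and $\mathbf D=(0=\mathbf D_0\subset\cdots\subset\mathbf D_k=D)$ a flag with $\dim\mathbf D_i/\mathbf D_{i-1}=\mathbf d_i$ and $t(\mathbf D_i)\subset\mathbf D_{i-1}$. For a subspace $X\subset D$, $\alpha(X,\mathbf D)_i=\dim(X\cap\mathbf D_i)/(X\cap\mathbf D_{i-1})$, and $\alpha(t,\mathbf D):=\alpha(\ker t,\mathbf D)$. $\mathcal T(\mathbf d)$ is the span of the indicator functions of the sets $A_{\mathbf w,\mathbf r,\mathbf n}=\{(\mathbf D,W,t):\alpha(W,\mathbf D)=\mathbf w,\ \alpha(\operatorname{im}t,\mathbf D)=\mathbf r,\ \alpha(\ker t,\mathbf D)=\mathbf n\}$. $\mathcal T_s(\mathbf d)$ is the space of $f\in\mathcal T(\mathbf d)$ whose value at $(\mathbf D,W,t)$ depends only on $\dim W$ and $\alpha(t,\mathbf D)$. On functions on $\mathfrak T(\mathbf d)$, $\mathbf U_q$ acts by $(Ef)(\mathbf D,W,t)=q^{-(\dim\ker t-\dim W-1)}\sum_{W\subset U\subset\ker t,\ \dim U=\dim W+1}f(\mathbf D,U,t)$,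 $(Ff)(\mathbf D,W,t)=q^{-(\dim W-\operatorname{rank}t-1)}\sum_{\operatorname{im}t\subset U\subset W,\ \dim U=\dim W-1}f(\mathbf D,U,t)$, $(K^{\pm1}f)(\mathbf D,W,t)=q^{\pm(d-2\dim W)}f(\mathbf D,W,t)$, and on functions on $\mathfrak M(d)$ by the same formulas with $\mathbf D$ omitted. With these actions $\mathcal M^r(d)\cong V_{d-2r}$ via $\mathbf 1_{\mathfrak M^r(w,d)}\mapsto v_{d-2w}$, and $\mathcal T_s(\mathbf d)\cong V_{\mathbf d_1}\otimes\cdots\otimes V_{\mathbf d_k}$ as $\mathbf U_q$-modules. **Lower crossingless matches.** Place $k$ boxes from left to right, box $i$ having $\mathbf d_i$ vertices. A lower crossingless match is a set of pairwise non-crossing arcs drawn above the line, each joining two vertices of different boxes, each vertex on at most one arc, and no unmatched vertex lying under an arc. For $\mathbf a$ with $0\le\mathbf a_i\le\mathbf d_i$, $\bar{\mathbf a}$ is the lower crossingless match obtained by marking the rightmost $\mathbf a_i$ vertices of box $i$ down and the others up, and then, going from right to left, joining each down vertex to the first unmatched up vertex to its right, if any. For a match $b$, $\mathbf n^b_i$ is $\mathbf d_i$ minus the number of right endpoints of arcs of $b$ in box $i$. $|\mathbf a|=\sum_i\mathbf a_i$. Set $Y_{\mathbf a}=\{(\mathbf D,W,t)\in\mathfrak T(\mathbf d):\alpha(t,\mathbf D)=\mathbf n^{\bar{\mathbf a}},\ \dim W=|\mathbf a|\}$ and $Y_b=\{(\mathbf D,W,t)\in\mathfrak T(\mathbf d):\alpha(t,\mathbf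 D)=\mathbf n^b\}$. **The maps $T_Y$.** With $p:\mathfrak T(\mathbf d)\to\mathfrak M(d)$, $p(\mathbf D,W,t)=(W,t)$, set $T_Y(f)=p_!(\mathbf 1_Yf)$ for $f\in\mathcal T(\mathbf d)$. *)

(* Defs.v *)
From HB Require Import structures.
From mathcomp Require Import all_boot all_order all_algebra all_field ring.
From mathcomp Require Import boolp classical_sets functions reals.
From mathcomp Require Import complex mxtens.

Set Implicit Arguments.
Unset Strict Implicit.
Unset Printing Implicit Defensive.

Import Order.TTheory GRing.Theory Num.Theory.
Local Open Scope ring_scope.

(* Everything is written over the classical real numbers R : realType, with
   R[i] the complex numbers and Cq R = C(q). *)
Definition Cq (R : realType) : fieldType := {fraction {poly R[i]}}.

Definition qv (R : realType) : Cq R := (@tofrac {poly R[i]} 'X).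

Definition qint (K : fieldType) (q : K) (n : nat) : K :=
  (q ^+ n - q ^- n) / (q - q^-1).

Lemma qv_neq0 (R : realType) : qv R != 0.
Proof. by rewrite /qv tofrac_eq0 polyX_eq0. Qed.

Lemma qv_sub_neq0 (R : realType) : qv R - (qv R)^-1 != 0.
Proof.
apply/negP; rewrite subr_eq0 => /eqP h.
have h2 : qv R * qv R = 1 by rewrite {2}h mulfV ?qv_neq0.
have : (@tofrac {poly R[i]} ('X * 'X)) == tofrac 1.
  by rewrite rmorphM rmorph1; apply/eqP.
rewrite tofrac_eq -expr2 => /eqP h3.
have := congr1 (fun p : {poly R[i]} => size p) h3.
by rewrite size_polyXn size_poly1.
Qed.

Section Span.
Variables (K : fieldType) (V : lmodType K).

Definition linspan (S : set V) : set V :=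
  [set v | exists n (c : 'I_n -> K) (u : 'I_n -> V),
     (forall i, S (u i)) /\ v = \sum_i c i *: u i].

End Span.

(* A finite-dimensional U_q(sl_2)-module with a chosen basis: U_q being given
   by generators and relations, this is a quadruple of matrices, acting on
   column vectors from the left, that satisfy the relations. *)
Section UqRep.
Variables (K : fieldType) (q : K).

Record Uq_rep := UqRep {
  udim : nat;
  uE : 'M[K]_udim;
  uF : 'M[K]_udim;
  uK : 'M[K]_udim;
  uKV : 'M[K]_udim;
  uKKV : uK *m uKV = 1%:M;
  uKVK : uKV *m uK = 1%:M;
  uKE : uK *m uE = q ^+ 2 *: (uE *m uK);
  uKF : uK *m uF = q ^- 2 *: (uF *m uK);
  uEF : uE *m uF - uF *m uE = (q - q^-1)^-1 *: (uK - uKV) }.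

Definition Uq_Hom (A B : Uq_rep) : set 'M[K]_(udim B, udim A) :=
  [set g | [/\ g *m uE A = uE B *m g, g *m uF A = uF B *m g,
               g *m uK A = uK B *m g & g *m uKV A = uKV B *m g]].

Record Uq_ops (V : Type) := UqOps {
  opE : V -> V; opF : V -> V; opK : V -> V; opKV : V -> V }.

Definition Uq_iso (A : Uq_rep) (V : lmodType K) (o : Uq_ops V) (S : set V)
    (phi : {linear 'cV[K]_(udim A) -> V}) : Prop :=
  [/\ injective phi, range phi = S,
      forall v, phi (uE A *m v) = opE o (phi v) /\
                phi (uF A *m v) = opF o (phi v)
    & forall v, phi (uK A *m v) = opK o (phi v) /\
                phi (uKV A *m v) = opKV o (phi v)].

Hypotheses (q0 : q != 0) (q1 : q - q^-1 != 0).

(* Index j : 'I_n.+1 stands for the basis vector v_m of V_n with m = n - 2j;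
   thus (n + m)/2 + 1 = n - j + 1 and (n - m)/2 + 1 = j + 1. *)
Definition VE n : 'M[K]_n.+1 :=
  \matrix_(i, j) (qint q (n - j).+1 *+ (i.+1 == j)).
Definition VF n : 'M[K]_n.+1 :=
  \matrix_(i, j) (qint q j.+1 *+ (i == j.+1 :> nat)).
Definition VK n : 'M[K]_n.+1 :=
  diag_mx (\row_j q ^ (n%:Z - j%:Z *+ 2)).
Definition VKV n : 'M[K]_n.+1 :=
  diag_mx (\row_j q ^ (- (n%:Z - j%:Z *+ 2))).

Lemma VKE n (i j : 'I_n.+1) (M : 'M[K]_n.+1) :
  (VK n *m M) i j = q ^ (n%:Z - i%:Z *+ 2) * M i j.
Proof. by rewrite mul_diag_mx !mxE. Qed.

Lemma VEK n (i j : 'I_n.+1) (M : 'M[K]_n.+1) :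
  (M *m VK n) i j = q ^ (n%:Z - j%:Z *+ 2) * M i j.
Proof. by rewrite mul_mx_diag !mxE mulrC. Qed.

Lemma V_KKV n : VK n *m VKV n = 1%:M.
Proof.
apply/matrixP => i j; rewrite VKE !mxE.
by case: eqP => [->|_]; rewrite ?mulr0 //= !mulr1n -expfzDr // subrr expr0z.
Qed.

Lemma V_KVK n : VKV n *m VK n = 1%:M.
Proof.
apply/matrixP => i j; rewrite VEK !mxE.
by case: eqP => [->|_]; rewrite ?mulr0 //= !mulr1n -expfzDr // subrr expr0z.
Qed.

Lemma V_KE n : VK n *m VE n = q ^+ 2 *: (VE n *m VK n).
Proof.
apply/matrixP => i j; rewrite [RHS]mxE VKE VEK !mxE mulrA.
case: eqP => [<-|_]; last by rewrite !mulr0.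
congr (_ * _); rewrite exprnP -expfzDr //; congr (q ^ _).
by rewrite -(addn1 (nat_of_ord _)) PoszD; ring.
Qed.

Lemma V_KF n : VK n *m VF n = q ^- 2 *: (VF n *m VK n).
Proof.
apply/matrixP => i j; rewrite [RHS]mxE VKE VEK !mxE mulrA.
case: eqP => [->|_]; last by rewrite !mulr0.
congr (_ * _); rewrite -[q ^- 2]/(q ^ (- 2%:Z)) -expfzDr //; congr (q ^ _).
by rewrite -(addn1 (nat_of_ord _)) PoszD; ring.
Qed.

Lemma qint0 : qint q 0 = 0.
Proof. by rewrite /qint expr0 invr1 subrr mul0r. Qed.

Lemma V_EFij n (i j : 'I_n.+1) :
  (VE n *m VF n) i j = qint q (n - j) * qint q j.+1 *+ (i == j).
Proof.
rewrite mxE; have [jn|jn] := ltnP j n.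
  rewrite (bigD1 (Ordinal (jn : (j.+1 < n.+1)%N))) //= !mxE /= eqSS eqxx subnSK //.
  rewrite big1 ?addr0 => [|l /eqP lj]; last first.
    rewrite !mxE; case: (l =P j.+1 :> nat) => [e|_]; last by rewrite mulr0.
    by case: lj; apply/val_inj.
  by rewrite -val_eqE; case: eqP => _; rewrite ?mulr1n ?mulr0n ?mul0r.
have -> : (n - j = 0)%N by apply/eqP; rewrite subn_eq0.
rewrite qint0 mul0r mul0rn big1 // => l _; rewrite !mxE.
case: (l =P j.+1 :> nat) => [e|_]; last by rewrite mulr0.
by have := ltn_ord l; rewrite e ltnS ltnNge jn.
Qed.

Lemma V_FEij n (i j : 'I_n.+1) :
  (VF n *m VE n) i j = qint q j * qint q (n - j).+1 *+ (i == j).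
Proof.
rewrite mxE; case: j => -[|j] jn /=.
  rewrite qint0 mul0r mul0rn big1 // => l _; rewrite !mxE.
  by rewrite mulr0.
rewrite (bigD1 (Ordinal (ltnW jn))) //= !mxE /= eqxx.
rewrite big1 ?addr0 => [|l /eqP lj]; last first.
  rewrite !mxE; case: (l.+1 =P j.+1 :> nat) => [[e]|_]; last by rewrite mulr0.
  by case: lj; apply/val_inj.
by rewrite -val_eqE /=; case: eqP => _; rewrite ?mulr1n ?mulr0n ?mul0r.
Qed.

Lemma V_EF n :
  VE n *m VF n - VF n *m VE n = (q - q^-1)^-1 *: (VK n - VKV n).
Proof.
apply/matrixP => i j.
rewrite [LHS]mxE V_EFij [X in _ + X]mxE V_FEij !mxE.
have [<-|_] := eqVneq; last by rewrite subrr mulr0.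
rewrite !mulr1n; have le_in : (i <= n)%N by rewrite -ltnS.
have e : n%:Z - i%:Z *+ 2 = (n - i)%N%:Z - i%:Z.
  by rewrite -subzn //; ring.
rewrite e opprB !expfzDr // -!invr_expz -!exprnP /qint.
move: (n - i)%N => b; move: (nat_of_ord i) => a.
rewrite !exprS.
have qa : q ^+ a != 0 by rewrite expf_neq0.
have qb : q ^+ b != 0 by rewrite expf_neq0.
have q2 : q ^+ 2 - 1 != 0.
  by apply: contra q1 => /eqP h; rewrite -(mulKf q0 (q - q^-1)) mulrBr mulfV // -expr2 h mulr0.
by move: qa qb; move: (q ^+ a) (q ^+ b) => x y x0 y0; field; rewrite x0 y0 q0 -expr2.
Qed.

Definition Vrep (n : nat) : Uq_rep :=
  UqRep (V_KKV n) (V_KVK n) (V_KE n) (V_KF n) (V_EF n).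

Section Tensor.
Variables A B : Uq_rep.

(* Delta E = E (x) 1 + K (x) E and Delta F = F (x) K^-1 + 1 (x) F *)
Definition tE := uE A *t (1%:M : 'M[K]_(udim B)) + uK A *t uE B.
Definition tF := uF A *t uKV B + (1%:M : 'M[K]_(udim A)) *t uF B.
Definition tK := uK A *t uK B.
Definition tKV := uKV A *t uKV B.

Lemma tens1 m n : (1%:M : 'M[K]_m) *t (1%:M : 'M[K]_n) = 1%:M.
Proof.
apply/matrixP => i j; rewrite !mxE -[in RHS](mxtens_unindexK i) -[in RHS](mxtens_unindexK j).
rewrite (can_eq (@mxtens_indexK _ _)) xpair_eqE.
by do 2!case: eqP => _; rewrite /= ?mulr1n ?mulr0n ?mul0r ?mulr0 ?mulr1.
Qed.

Lemma tensZl a m n p r (M : 'M[K]_(m, n)) (N : 'M[K]_(p, r)) :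
  (a *: M) *t N = a *: (M *t N).
Proof. by apply/matrixP => i j; rewrite !mxE mulrA. Qed.

Lemma tensZr a m n p r (M : 'M[K]_(m, n)) (N : 'M[K]_(p, r)) :
  M *t (a *: N) = a *: (M *t N).
Proof. by apply/matrixP => i j; rewrite !mxE mulrCA. Qed.

Lemma tensBl m n p r (M M' : 'M[K]_(m, n)) (N : 'M[K]_(p, r)) :
  (M - M') *t N = M *t N - M' *t N.
Proof. by apply/matrixP => i j; rewrite !mxE mulrBl. Qed.

Lemma tensBr m n p r (M : 'M[K]_(m, n)) (N N' : 'M[K]_(p, r)) :
  M *t (N - N') = M *t N - M *t N'.
Proof. by apply/matrixP => i j; rewrite !mxE mulrBr. Qed.

Lemma t_KKV : tK *m tKV = 1%:M.
Proof. by rewrite tensmx_mul !uKKV tens1. Qed.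

Lemma t_KVK : tKV *m tK = 1%:M.
Proof. by rewrite tensmx_mul !uKVK tens1. Qed.

Lemma t_KE : tK *m tE = q ^+ 2 *: (tE *m tK).
Proof.
rewrite mulmxDr mulmxDl !tensmx_mul !uKE tensZl tensZr scalerDr.
by rewrite mulmx1 mul1mx.
Qed.

Lemma t_KF : tK *m tF = q ^- 2 *: (tF *m tK).
Proof.
rewrite mulmxDr mulmxDl !tensmx_mul !uKF tensZl tensZr scalerDr.
by rewrite mulmx1 mul1mx uKKV uKVK.
Qed.

Lemma t_EF : tE *m tF - tF *m tE = (q - q^-1)^-1 *: (tK - tKV).
Proof.
have uKVE : uE B *m uKV B = q ^+ 2 *: (uKV B *m uE B).
  rewrite -[LHS]mul1mx -(uKVK B) -mulmxA [uK B *m _]mulmxA uKE -scalemxAl.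
  by rewrite -scalemxAr -[uE B *m _ *m _]mulmxA uKKV mulmx1.
rewrite !mulmxDr !mulmxDl !tensmx_mul !mulmx1 !mul1mx.
rewrite uKF uKVE tensZl tensZr scalerA mulVf ?expf_neq0 // scale1r.
set x := (uF A *m uK A) *t _; set c := uE A *t uF B.
set a1 := _ *t uKV B; set a2 := _ *t uKV B.
set e1 := uK A *t _; set e2 := uK A *t _.
have -> : a1 + x + (c + e1) - (a2 + c + (x + e2)) = (a1 - a2) + (e1 - e2).
  by apply/matrixP => ? ?; rewrite !mxE; ring.
rewrite -tensBl -tensBr !uEF tensZl tensZr -scalerDr tensBl tensBr.
by congr (_ *: _); rewrite addrC addrA subrK.
Qed.

Definition Uq_tens : Uq_rep := UqRep t_KKV t_KVK t_KE t_KF t_EF.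

End Tensor.

End UqRep.

Arguments Uq_Hom {K q} A B _.

Definition Vn (R : realType) (n : nat) : Uq_rep (qv R) :=
  Vrep (qv_neq0 R) (qv_sub_neq0 R) n.

(* (..(V_(d_1) (x) V_(d_2)) (x) ..) (x) V_(d_k), for a nonempty list d *)
Definition Vtens (R : realType) (dd : seq nat) : Uq_rep (qv R) :=
  foldl (Uq_tens (qv_neq0 R)) (Vn R (head 0 dd)) [seq Vn R n | n <- behead dd].

Import VectorInternalTheory.

HB.instance Definition _ (F : finFieldType) (vT : vectType F) :=
  [Finite of {vspace vT} by <:].
HB.instance Definition _ (F : finFieldType) (aT rT : vectType F) :=
  [Finite of 'Hom(aT, rT) by <:].

Section Points.
Variable F : finFieldType.

(* The d-dimensional space is D = F^d. *)
Definition inM d (x : {vspace 'rV[F]_d} * 'End('rV[F]_d)) : bool :=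
  (limg x.2 <= x.1)%VS && (x.1 <= lker x.2)%VS.

Definition Mpt d := {x : {vspace 'rV[F]_d} * 'End('rV[F]_d) | inM x}.
Definition MW d (x : Mpt d) : {vspace 'rV[F]_d} := (val x).1.
Definition Mt d (x : Mpt d) : 'End('rV[F]_d) := (val x).2.

Definition vflag k d := {ffun 'I_k.+1 -> {vspace 'rV[F]_d}}.

(* For i : 'I_k these are the (i+1)-st and the i-th step of D_0, ..., D_k. *)
Definition vfhi k d (D : vflag k d) (i : 'I_k) := D (lift ord0 i).
Definition vflo k d (D : vflag k d) (i : 'I_k) := D (widen_ord (leqnSn k) i).

Definition inT k (dd : k.-tuple nat)
    (x : vflag k (sumn dd) * Mpt (sumn dd)) : bool :=
  [&& x.1 ord0 == 0%VS, x.1 ord_max == fullv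
    & [forall i : 'I_k, [&& (vflo x.1 i <= vfhi x.1 i)%VS,
         (\dim (vfhi x.1 i) == \dim (vflo x.1 i) + tnth dd i)%N
       & (Mt x.2 @: vfhi x.1 i <= vflo x.1 i)%VS]]].

Definition Tpt k (dd : k.-tuple nat) :=
  {x : vflag k (sumn dd) * Mpt (sumn dd) | inT x}.
Definition Tflag k (dd : k.-tuple nat) (x : Tpt dd) := (val x).1.
Definition Tproj k (dd : k.-tuple nat) (x : Tpt dd) : Mpt (sumn dd) :=
  (val x).2.

Definition alpha k d (X : {vspace 'rV[F]_d}) (D : vflag k d) : k.-tuple nat :=
  [tuple (\dim (X :&: vfhi D i) - \dim (X :&: vflo D i))%N | i < k].

End Points.

(* The finite fields, one of each prime power order; every finite field is
   isomorphic to exactly one of them.  (The disjoint unions below have to be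
   small types, which rules out indexing them by finFieldType itself.) *)
Record fforder := FFOrder {
  ffchar : nat;
  ffdeg : nat;
  ffchar_prime : prime ffchar;
  ffdeg_gt0 : (0 < ffdeg)%N }.

Definition GF (s : fforder) : finFieldType :=
  s2val (PrimePowerField (ffchar_prime s) (ffdeg_gt0 s)).

(* The varieties: disjoint unions, over all finite fields, of the sets of
   rational points.  A function on such a type is a uniform family of
   functions, one for each finite field. *)
Definition Mvar d := {s : fforder & Mpt (GF s) d}.
Definition Tvar k (dd : k.-tuple nat) := {s : fforder & Tpt (GF s) dd}.

Section Invariants.

Definition Mcard d (x : Mvar d) : nat := #|GF (tag x)|.
Definition MdimW d (x : Mvar d) : nat := \dim (MW (tagged x)).
Definition Mrank d (x : Mvar d) : nat := \dim (limg (Mt (tagged x))).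
Definition Mker d (x : Mvar d) : nat := \dim (lker (Mt (tagged x))).
Definition Mtype d (x : Mvar d) : nat * nat := (MdimW x, Mrank x).

Variables (k : nat) (dd : k.-tuple nat).

Definition pvar (x : Tvar dd) : Mvar (sumn dd) :=
  Tagged (fun s => Mpt (GF s) (sumn dd)) (Tproj (tagged x)).
Definition Tcard (x : Tvar dd) : nat := #|GF (tag x)|.
Definition alphaW (x : Tvar dd) : k.-tuple nat :=
  alpha (MW (Tproj (tagged x))) (Tflag (tagged x)).
Definition alpha_im (x : Tvar dd) : k.-tuple nat :=
  alpha (limg (Mt (Tproj (tagged x)))) (Tflag (tagged x)).
Definition alpha_ker (x : Tvar dd) : k.-tuple nat :=
  alpha (lker (Mt (Tproj (tagged x)))) (Tflag (tagged x)).
Definition Ttype (x : Tvar dd) := (alphaW x, alpha_im x, alpha_ker x).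

End Invariants.

Section Functions.
Variable R : realType.
Local Notation K := (Cq R).

Definition ind (X : Type) (Y : pred X) : X -> K^o := fun x => (Y x)%:R.

(* Sums over points, viewed in C(q).  Here s x is the sum, computed naively in
   C(q), of the values of a function over a finite set of points attached to x;
   type x lists the discrete data defining the piece of X in which x lies; and
   card x is the cardinality of the field over which x is defined.  Over the
   piece containing x the naive sum is P(card) for a polynomial P with
   coefficients in C(q), and the value of the sum is P(q^2).  For s counting
   the points of a set Y this is chi_q(Y).  (The polynomial is unique, since
   each nonempty piece has points over every finite field; the value 0 in
   the absence of such a P is a dummy one.) *)
Definition generic (X I : Type) (card : X -> nat) (type : X -> I)
    (s : X -> K) : X -> K :=
  fun x => (xget 0 [set P : {poly K} |
              forall y, type y = type x -> s y = P.[(card y)%:R]]).[qv R ^+ 2].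

Section OnM.
Variable d : nat.

(* The sums run over the points y = (U, t); being a point of the variety, y
   satisfies im t <= U <= ker t. *)
Definition ME_sum (f : Mvar d -> K^o) (x : Mvar d) : K :=
  \sum_(y : Mpt (GF (tag x)) d | [&& Mt y == Mt (tagged x),
      (MW (tagged x) <= MW y)%VS & \dim (MW y) == (MdimW x).+1])
    f (Tagged (fun s => Mpt (GF s) d) y).
Definition MF_sum (f : Mvar d -> K^o) (x : Mvar d) : K :=
  \sum_(y : Mpt (GF (tag x)) d | [&& Mt y == Mt (tagged x),
      (MW y <= MW (tagged x))%VS & (\dim (MW y)).+1 == MdimW x])
    f (Tagged (fun s => Mpt (GF s) d) y).

Definition ME (f : Mvar d -> K^o) : Mvar d -> K^o := fun x =>
  qv R ^ (- ((Mker x)%:Z - (MdimW x)%:Z - 1)) *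
  generic (@Mcard d) (@Mtype d) (ME_sum f) x.
Definition MF (f : Mvar d -> K^o) : Mvar d -> K^o := fun x =>
  qv R ^ (- ((MdimW x)%:Z - (Mrank x)%:Z - 1)) *
  generic (@Mcard d) (@Mtype d) (MF_sum f) x.
Definition MK (f : Mvar d -> K^o) : Mvar d -> K^o := fun x =>
  qv R ^ (d%:Z - (MdimW x)%:Z *+ 2) * f x.
Definition MKV (f : Mvar d -> K^o) : Mvar d -> K^o := fun x =>
  qv R ^ (- (d%:Z - (MdimW x)%:Z *+ 2)) * f x.
Definition Mops := UqOps ME MF MK MKV.

(* the indicator function of the points with rank t = r and dim W = w *)
Definition indM (r w : nat) : Mvar d -> K^o :=
  ind (fun x : Mvar d => (Mrank x == r) && (MdimW x == w)).
Definition calM (r : nat) : set (Mvar d -> K^o) :=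
  linspan [set f | exists w, f = indM r w].

(* The identification of V_n, n = d - 2r, with calM r: the basis vector with
   index j, of weight n - 2j = d - 2(r + j), goes to indM r (r + j). *)
Definition MV (r n : nat) (u : 'cV[K]_n.+1) : Mvar d -> K^o :=
  \sum_(j < n.+1) u j 0 *: indM r (r + j).

Fact MV_is_linear r n : linear (@MV r n).
Proof.
move=> a u v; rewrite /MV scaler_sumr -big_split /=.
by apply: eq_bigr => j _; rewrite !mxE scalerDl scalerA.
Qed.
HB.instance Definition _ r n :=
  GRing.isLinear.Build K 'cV[K]_n.+1 (Mvar d -> K^o) _ (@MV r n)
    (@MV_is_linear r n).

End OnM.

Section OnT.
Variables (k : nat) (dd : k.-tuple nat).
Local Notation d := (sumn dd).

Definition TE_sum (f : Tvar dd -> K^o) (x : Tvar dd) : K :=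
  \sum_(y : Tpt (GF (tag x)) dd | [&& Tflag y == Tflag (tagged x),
      Mt (Tproj y) == Mt (Tproj (tagged x)),
      (MW (Tproj (tagged x)) <= MW (Tproj y))%VS
    & \dim (MW (Tproj y)) == (MdimW (pvar x)).+1])
    f (Tagged (fun s => Tpt (GF s) dd) y).
Definition TF_sum (f : Tvar dd -> K^o) (x : Tvar dd) : K :=
  \sum_(y : Tpt (GF (tag x)) dd | [&& Tflag y == Tflag (tagged x),
      Mt (Tproj y) == Mt (Tproj (tagged x)),
      (MW (Tproj y) <= MW (Tproj (tagged x)))%VS
    & (\dim (MW (Tproj y))).+1 == MdimW (pvar x)])
    f (Tagged (fun s => Tpt (GF s) dd) y).

Definition TE (f : Tvar dd -> K^o) : Tvar dd -> K^o := fun x =>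
  qv R ^ (- ((Mker (pvar x))%:Z - (MdimW (pvar x))%:Z - 1)) *
  generic (@Tcard k dd) (@Ttype k dd) (TE_sum f) x.
Definition TF (f : Tvar dd -> K^o) : Tvar dd -> K^o := fun x =>
  qv R ^ (- ((MdimW (pvar x))%:Z - (Mrank (pvar x))%:Z - 1)) *
  generic (@Tcard k dd) (@Ttype k dd) (TF_sum f) x.
Definition TK (f : Tvar dd -> K^o) : Tvar dd -> K^o := fun x =>
  qv R ^ (d%:Z - (MdimW (pvar x))%:Z *+ 2) * f x.
Definition TKV (f : Tvar dd -> K^o) : Tvar dd -> K^o := fun x =>
  qv R ^ (- (d%:Z - (MdimW (pvar x))%:Z *+ 2)) * f x.
Definition Tops := UqOps TE TF TK TKV.

Definition A_set (w r n : k.-tuple nat) : pred (Tvar dd) :=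
  fun x => [&& alphaW x == w, alpha_im x == r & alpha_ker x == n].

Definition calT : set (Tvar dd -> K^o) :=
  linspan [set f | exists w r n, f = ind (A_set w r n)].

Definition calTs : set (Tvar dd -> K^o) :=
  [set f | calT f /\ forall x y : Tvar dd,
     MdimW (pvar x) = MdimW (pvar y) -> alpha_ker x = alpha_ker y -> f x = f y].

Definition p_push (f : Tvar dd -> K^o) : Mvar d -> K^o :=
  generic (@Mcard d) (@Mtype d) (fun x =>
    \sum_(y : Tpt (GF (tag x)) dd | Tproj y == tagged x)
      f (Tagged (fun s => Tpt (GF s) dd) y)).

Definition T_ (Y : pred (Tvar dd)) (f : Tvar dd -> K^o) : Mvar d -> K^o :=
  p_push (fun x => ind Y x * f x).

End OnT.
End Functions.
Arguments Mops R d : clear implicits.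
Arguments indM R d r w _ : clear implicits.
Arguments calM R d r _ : clear implicits.
Arguments MV R d r n u _ : clear implicits.
Arguments calTs R [k] dd _.

Section Matches.
Variables (k : nat) (dd : k.-tuple nat).

(* vertex j (from the left) of box i *)
Definition vert := {i : 'I_k & 'I_(tnth dd i)}.

Definition vlt (x y : vert) : bool :=
  (tag x < tag y)%N || (tag x == tag y) && (tagged x < tagged y)%N.

(* An arc is the pair of its left and its right endpoint. *)
Definition matched (b : {set vert * vert}) (v : vert) : bool :=
  [exists e in b, (v == e.1) || (v == e.2)].

Definition lower_match (b : {set vert * vert}) : bool :=
  [&& [forall e in b, (tag e.1 < tag e.2)%N],
      [forall e in b, forall e' in b, (e != e') ==>
         [&& e.1 != e'.1, e.1 != e'.2, e.2 != e'.1 & e.2 != e'.2]],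
      [forall e in b, forall e' in b,
         ~~ [&& vlt e.1 e'.1, vlt e'.1 e.2 & vlt e.2 e'.2]]
    & [forall e in b, forall v, vlt e.1 v && vlt v e.2 ==> matched b v]].

Definition verts : seq vert :=
  [seq Tagged (fun i => 'I_(tnth dd i)) j
    | i <- enum 'I_k, j <- enum 'I_(tnth dd i)].

Definition down (a : k.-tuple nat) (v : vert) : bool :=
  (tnth dd (tag v) - tnth a (tag v) <= tagged v)%N.

Definition bar_step (a : k.-tuple nat) (b : {set vert * vert}) (v : vert) :=
  if down a v then
    if [seq u <- verts | [&& vlt v u, ~~ down a u & ~~ matched b u]] is u :: _
    then (v, u) |: b else b
  else b.

Definition bar (a : k.-tuple nat) : {set vert * vert} :=
  foldl (bar_step a) finset.set0 (rev verts).

Definition nvec (b : {set vert * vert}) : k.-tuple nat :=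
  [tuple (tnth dd i - #|[set e in b | tag e.2 == i]|)%N | i < k].

Definition Yset_a (a : k.-tuple nat) : pred (Tvar dd) :=
  fun x => (alpha_ker x == nvec (bar a)) && (MdimW (pvar x) == sumn a).
Definition Yset_b (b : {set vert * vert}) : pred (Tvar dd) :=
  fun x => alpha_ker x == nvec b.

End Matches.

(* Under an identification phi of V_(d_1) (x) .. (x) V_(d_k) with calTs, the
   matrix g is T_(Y_b), regarded as a map into calM r = V_mu, where r is the
   number of arcs and mu = d - 2r the number of unmatched vertices of b. *)
Definition represents (R : realType) (k : nat) (dd : k.-tuple nat)
    (phi : 'cV[Cq R]_(udim (Vtens R dd)) -> (Tvar dd -> (Cq R)^o))
    (b : {set vert dd * vert dd}) (mu : nat)
    (g : 'M[Cq R]_(udim (Vn R mu), udim (Vtens R dd))) : Prop :=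
  (#|b|.*2 + mu = sumn dd)%N /\
  forall v, MV R (sumn dd) #|b| mu (g *m v) = T_ (Yset_b b) (phi v).

(* Main.v *)
(* A function in T_s(d) is a function of (dim W, alpha(t, D)), and the operators
   leave alpha(t, D) alone.  For fixed alpha(t, D) = n, with |n| = d - r, adding
   a line to W inside ker t, or removing one above im t, is counted by
   1 + q^2 + .. + q^(2(m-1)), so these functions form a copy of V_(d-2r), and
   T_s(d) is the direct sum of these copies over all n that occur.  Building
   flags from the top step downwards shows that the flags with alpha(t, D) = n
   are counted by a polynomial, nonzero exactly when the numbers
   rho_i = d_i - n_i of right endpoints satisfy
     rho_1 + .. + rho_i <= (d_1 - rho_1) + .. + (d_(i-1) - rho_(i-1))
   for all i.  The same inequalities describe the lower crossingless matches,
   each of which is determined by rho, and the summands of the iterated quantum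
   Clebsch-Gordan decomposition of V_(d_1) (x) .. (x) V_(d_k).  Hence T_(Y_b) is,
   up to a nonzero factor, the projection of T_s(d) onto the summand n^b, and
   Schur's lemma shows that these projections span the intertwiners. *)

(* [generic] picks a polynomial by choice and falls back on 0, so the operators are not visibly
   linear and no count evaluates by rewriting alone. Two facts repair this. A type of point that
   occurs over one finite field occurs over all of them, by coordinate models, so the polynomial is
   unique. And each operator sends a function of [alpha_ker] and the dimension of [W] to a closed
   formula, so that linearity is only used for such functions. No semisimplicity theory enters. A
   module is decomposed by a basis of strings, that is, of divided powers of [F] applied to highest
   weight vectors, together with its dual functionals; a count of dimensions shows completeness. The
   strings of [Vtens] and of [calTs] are named by the same sequences [t] ([adm_seq]), and
   [d_i - t_i] is the corresponding kernel vector. The constant [c_b] is the flag polynomial of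
   [nvec b] at [q^2]; it is nonzero because that polynomial is positive at a natural number. As the
   identification [phi] is arbitrary, intertwiners are tested on the preimages under [phi] of
   indicator functions. *)
From HB Require Import structures.
Require Import Defs.
From mathcomp Require Import all_boot all_order all_algebra all_field ring zify.
From mathcomp Require Import complex mxtens.

Set Implicit Arguments.
Unset Strict Implicit.
Unset Printing Implicit Defensive.

(** * Lower crossingless matches *)

Lemma card_ord_lt n m : m <= n -> #|[set x : 'I_n | x < m]| = m.
Proof.
by move=> mn; rewrite -sum1dep_card -(big_ord_widen n (fun=> 1)) // sum1_card card_ord.
Qed.

Lemma card_ord_geq n m : #|[set x : 'I_n | m <= x]| = n - m.
Proof.
case: (leqP m n) => mn; last first.
  rewrite (_ : [set _ | _] = finset.set0) ?cards0; first lia.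
  by apply/setP => x; rewrite !inE; have := ltn_ord x; lia.
have := cardsC [set x : 'I_n | x < m]; rewrite card_ord_lt // card_ord.
rewrite (_ : ~: _ = [set x : 'I_n | m <= x]); first lia.
by apply/setP => x; rewrite !inE -leqNgt.
Qed.

(** If [x] lies in [S], closure puts all [x.+1] indices up to [x] in [S]; if not, it keeps [S]
    strictly below [x]. This turns the number of right endpoints of a box into their positions. *)
Lemma mem_closed_ord n (S : {set 'I_n}) :
  (forall x y : 'I_n, x \in S -> y < x -> y \in S) ->
  forall x : 'I_n, (x \in S) = (x < #|S|).
Proof.
move=> clos x; apply/idP/idP => [xS|].
  rewrite -(card_ord_lt (ltn_ord x)); apply: subset_leq_card; apply/subsetP => y.
  by rewrite inE ltnS leq_eqVlt => /predU1P[/val_inj->//|]; exact: clos.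
apply: contraTT => xS; rewrite -leqNgt -[leqRHS](card_ord_lt (ltnW (ltn_ord x))).
apply: subset_leq_card; apply/subsetP => y yS; rewrite inE ltnNge; apply: contra xS.
by rewrite leq_eqVlt => /predU1P[/val_inj->//|]; exact: clos.
Qed.

Section MatchTheory.
Variables (k : nat) (dd : k.-tuple nat).
Local Notation V := (vert dd).
Implicit Types (b : {set V * V}) (u v w : V) (a : k.-tuple nat).

Definition mkvert i (j : 'I_(tnth dd i)) : V := Tagged (fun i => 'I_(tnth dd i)) j.

(** Positions inside a box stay below the base [(sumn dd).+1], so the lexicographic order [vlt]
    becomes the order of [nat], with its arithmetic. *)
Definition vcode v : nat := tag v * (sumn dd).+1 + tagged v.

Lemma tnth_le_sumn (i : 'I_k) : tnth dd i <= sumn dd.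
Proof. by rewrite sumnE big_tuple (bigD1 i) //= leq_addr. Qed.

Lemma vltE u v : vlt u v = (vcode u < vcode v).
Proof.
case: u v => [i x] [j y]; rewrite /vlt /vcode /= -val_eqE /=.
have := leq_trans (ltn_ord x) (tnth_le_sumn i).
have := leq_trans (ltn_ord y) (tnth_le_sumn j).
move: (nat_of_ord x) (nat_of_ord y) (nat_of_ord i) (nat_of_ord j) (sumn dd).
move=> {}x {}y {}i {}j m ym xm; case: (ltngtP i j) => [ij|ji|->] /=.
- have := leq_mul ij (leqnn m.+1); rewrite mulSn; lia.
- have := leq_mul ji (leqnn m.+1); rewrite mulSn; lia.
- lia.
Qed.

Lemma vcode_inj : injective vcode.
Proof.
move=> u v h.
have: ~~ vlt u v && ~~ vlt v u by rewrite !vltE h ltnn.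
case: u v {h} => [i x] [j y]; rewrite /vlt /= -!val_eqE /=.
case: (ltngtP i j) => //= /val_inj ij; case: j / ij in y *.
by case: (ltngtP x y) => //= /val_inj ->.
Qed.

Lemma mem_verts v : v \in verts dd.
Proof.
by case: v => i j; apply/allpairsPdep; exists i, j; rewrite !mem_enum.
Qed.

Lemma pairwise_enum_ord n : pairwise (fun i j : 'I_n => i < j) (enum 'I_n).
Proof.
rewrite -(pairwise_map val ltn) val_enum_ord -sorted_pairwise ?iota_ltn_sorted //.
exact: ltn_trans.
Qed.

Lemma pairwise_verts : pairwise (@vlt k dd) (verts dd).
Proof.
rewrite /verts; elim: (enum 'I_k) (pairwise_enum_ord k) => //= i s IH /andP[h1 h2].
rewrite pairwise_cat IH // andbT; apply/andP; split.
  apply/allrelP => x y /mapP[j _ ->] /allpairsPdep[i' [j' [i's _ ->]]].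
  by rewrite /vlt /=; move/allP: h1 => /(_ _ i's) ->.
rewrite pairwise_map; apply: sub_pairwise (pairwise_enum_ord _) => x y xy.
by rewrite /vlt /= xy eqxx orbT.
Qed.

Lemma uniq_verts : uniq (verts dd).
Proof.
apply: pairwise_uniq pairwise_verts => x; by rewrite vltE ltnn.
Qed.

(* Invariant of the right-to-left construction of [bar a], [s] being the
   vertices already processed. *)
Record match_inv a (s : seq V) b : Prop := MatchInv {
  mi_arc : forall e, e \in b ->
    [/\ e.1 \in s, down a e.1, ~~ down a e.2 & vcode e.1 < vcode e.2];
  mi_uniq : forall e e', e \in b -> e' \in b -> e != e' ->
    (e.1 != e'.1) && (e.2 != e'.2);
  mi_cross : forall e e', e \in b -> e' \in b ->
    ~ [/\ vcode e.1 < vcode e'.1, vcode e'.1 < vcode e.2 & vcode e.2 < vcode e'.2];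
  mi_cover : forall e v, e \in b -> vcode e.1 < vcode v -> vcode v < vcode e.2 ->
    matched b v;
  mi_down : forall w u, w \in s -> down a w -> ~~ matched b w ->
    vcode w < vcode u -> ~~ down a u -> matched b u }.

Lemma matchedP b v :
  reflect (exists2 e, e \in b & v = e.1 \/ v = e.2) (matched b v).
Proof.
apply: (iffP existsP) => [[e /andP[eb /orP[/eqP->|/eqP->]]]|[e eb [->|->]]].
- by exists e => //; left.
- by exists e => //; right.
- by exists e; rewrite eb eqxx.
- by exists e; rewrite eb eqxx orbT.
Qed.

Lemma matched_sub b b' v : b \subset b' -> matched b v -> matched b' v.
Proof.
move=> /subsetP bb' /matchedP[e /bb' eb' h]; by apply/matchedP; exists e.
Qed.

(** Let [v] be joined to [u]. An old arc cannot cross the new one, for it would pass over the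
    unmatched [u], against [mi_cover]. Nor does an unmatched vertex lie between them: an up vertex
    there contradicts the choice of [u] as the first one, and a down vertex there would by [mi_down]
    have forced [u] to be matched already. *)
Lemma bar_step_inv a s b v :
  match_inv a s b -> (forall w, w \in s -> vcode v < vcode w) ->
  (forall w, vcode v < vcode w -> w \in s) ->
  match_inv a (rcons s v) (bar_step a b v).
Proof.
move=> I vs sv; rewrite /bar_step; case: ifPn => dv; last first.
  split.
  - move=> e /(mi_arc I)[h1 h2 h3 h4]; split=> //.
    by rewrite mem_rcons inE h1 orbT.
  - exact: mi_uniq I.
  - exact: mi_cross I.
  - exact: mi_cover I.
  - move=> w u; rewrite mem_rcons inE => /predU1P[-> dv'|ws]; last exact: (mi_down I ws).
    by rewrite dv' in dv.
set P := fun u => [&& vlt v u, ~~ down a u & ~~ matched b u].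
have vb : ~~ matched b v.
  apply/negP => /matchedP[e eb h]; have [h1 h2 h3 h4] := mi_arc I eb.
  have := vs _ h1; case: h => h; first by rewrite -h ltnn.
  by rewrite -h dv in h3.
case E : [seq u <- verts dd | P u] => [|u s'].
  split.
  - move=> e /(mi_arc I)[h1 h2 h3 h4]; split=> //.
    by rewrite mem_rcons inE h1 orbT.
  - exact: mi_uniq I.
  - exact: mi_cross I.
  - exact: mi_cover I.
  - move=> w u; rewrite mem_rcons inE => /predU1P[->|ws]; last exact: (mi_down I ws).
    move=> _ _ vu du; apply: contraT => mu.
    have : u \in [seq u <- verts dd | P u].
      by rewrite mem_filter mem_verts /P vltE vu du mu.
    by rewrite E.
have uP : P u.
  have : u \in [seq u <- verts dd | P u] by rewrite E inE eqxx.
  by rewrite mem_filter => /andP[].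
(* Filtering keeps the increasing order of [verts], so the head of the list is the leftmost
   candidate. *)
have umin w : P w -> vcode u <= vcode w.
  move=> Pw; have : w \in [seq u <- verts dd | P u] by rewrite mem_filter Pw mem_verts.
  have := subseq_pairwise (filter_subseq P (verts dd)) pairwise_verts.
  rewrite E /= => /andP[/allP h _]; rewrite inE => /predU1P[->//|/h].
  by rewrite vltE => /ltnW.
move: uP; rewrite /P vltE => /and3P[vu du mu].
have fresh e : e \in b -> [/\ e.1 != v, e.2 != v, e.1 != u & e.2 != u].
  move=> eb; split; apply/eqP => h.
  - by move/negP: vb; apply; apply/matchedP; exists e => //; left.
  - by move/negP: vb; apply; apply/matchedP; exists e => //; right.
  - by move/negP: mu; apply; apply/matchedP; exists e => //; left.
  - by move/negP: mu; apply; apply/matchedP; exists e => //; right.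
have sub : b \subset (v, u) |: b by apply: subsetUr.
split.
- move=> e; rewrite !inE => /predU1P[->|/(mi_arc I)[h1 h2 h3 h4]] /=.
    by split=> //; rewrite mem_rcons inE eqxx.
  by split=> //; rewrite mem_rcons inE h1 orbT.
- move=> e e'; rewrite !inE => /predU1P[->|eb] /predU1P[->|e'b] /=; first by rewrite eqxx.
  + by move=> _; have [h1 h2 h3 h4] := fresh _ e'b; rewrite ![_ == _.1]eq_sym ![_ == _.2]eq_sym h1 h4.
  + by move=> _; have [h1 h2 h3 h4] := fresh _ eb; rewrite h1 h4.
  + exact: mi_uniq I _ _ eb e'b.
- move=> e e'; rewrite !inE => /predU1P[->|eb] /predU1P[->|e'b] /=.
  + by rewrite ltnn => -[].
  + move=> [h1 h2 h3]; move/negP: mu; apply; exact: mi_cover I _ _ e'b h2 h3.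
  + move=> [h1 h2 h3]; have [/vs] := mi_arc I eb.
    by rewrite ltnNge ltnW.
  + exact: mi_cross I _ _ eb e'b.
- move=> e w; rewrite !inE => /predU1P[->|eb] /= h1 h2; last first.
    by apply: (matched_sub sub); exact: mi_cover I _ _ eb h1 h2.
  apply: (matched_sub sub); apply: contraT => mw.
  case dw : (down a w); last first.
    have := umin w; rewrite /P vltE h1 dw mw /= => /(_ isT); by rewrite leqNgt h2.
  have := mi_down I (sv _ h1) dw mw h2 du; by rewrite (negPf mu).
- move=> w x; rewrite mem_rcons inE => /predU1P[->|ws].
    move=> _ /negP[]; apply/matchedP; exists (v, u); rewrite ?inE ?eqxx //; by left.
  move=> dw mw wx dx; apply: (matched_sub sub).
  apply: (mi_down I ws dw _ wx dx); apply: contra mw; exact: (matched_sub sub).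
Qed.

Lemma bar_inv a : match_inv a (rev (verts dd)) (bar dd a).
Proof.
(* The processed vertices form a prefix of the reversed list, so [s1] consists exactly of the
   vertices to the right of the next one, as [bar_step_inv] requires. *)
suff H s1 s2 : rev (verts dd) = s1 ++ s2 ->
    match_inv a s1 (foldl (bar_step a) finset.set0 s1).
  by apply: (H _ [::]); rewrite cats0.
elim/last_ind: s1 s2 => [|s1 v IH] s2 h.
  by split=> //= e; rewrite ?inE // => e'; rewrite inE.
rewrite cat_rcons in h; rewrite foldl_rcons.
have hr : pairwise (fun x y => vlt y x) (s1 ++ v :: s2).
  rewrite -h -sorted_pairwise ?rev_sorted; last first.
    by move=> y x z; rewrite !vltE => /[swap]; exact: ltn_trans.
  by rewrite sorted_pairwise ?pairwise_verts // => y x z; rewrite !vltE; exact: ltn_trans.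
move: hr; rewrite pairwise_cat /= allrel_consr => /and4P[/andP[h1 h2] h3 h4 h5].
apply: bar_step_inv (IH _ h) _ _ => [w ws|w vw].
  by move/allP: h1 => /(_ _ ws); rewrite vltE.
have : w \in s1 ++ v :: s2 by rewrite -h mem_rev mem_verts.
rewrite mem_cat inE => /or3P[//|/eqP wv|ws2]; first by rewrite wv ltnn in vw.
by move/allP: h4 => /(_ _ ws2); rewrite vltE ltnNge ltnW.
Qed.

(** Within a box the down vertices are the rightmost ones, so an up vertex to the right of a down
    vertex is in a later box. Hence arcs never stay inside a box. *)
Lemma down_tag a u v : down a u -> ~~ down a v -> vcode u < vcode v ->
  tag u < tag v.
Proof.
rewrite -vltE /vlt => du dv /orP[//|/andP[/eqP e uv]].
have e1 : tnth dd (tag u) = tnth dd (tag v) by rewrite e.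
have e2 : tnth a (tag u) = tnth a (tag v) by rewrite e.
move: uv dv du; rewrite /down -ltnNge.
move: (nat_of_ord (tagged u)) (nat_of_ord (tagged v)) => x y xy yv xu.
by exfalso; move: xy; rewrite ltnNge ltnW // (leq_trans yv) // -e1 -e2.
Qed.

Lemma bar_lower_match a : lower_match (bar dd a).
Proof.
have I := bar_inv a; apply/and4P; split.
- apply/forallP => e; apply/implyP => /(mi_arc I)[h1 h2 h3 h4]; exact: down_tag h2 h3 h4.
- apply/forallP => e; apply/implyP => eb; apply/forallP => e'; apply/implyP => e'b.
  apply/implyP => ee'; have /andP[-> ->] := mi_uniq I eb e'b ee'.
  have [_ d1 u1 _] := mi_arc I eb; have [_ d2 u2 _] := mi_arc I e'b.
  apply/and4P; split=> //; apply/eqP => h.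
    by rewrite h (negPf u2) in d1.
  by rewrite h d2 in u1.
- apply/forallP => e; apply/implyP => eb; apply/forallP => e'; apply/implyP => e'b.
  by apply/negP; rewrite !vltE => /and3P; exact: mi_cross I _ _ eb e'b.
- apply/forallP => e; apply/implyP => eb; apply/forallP => v; apply/implyP.
  by rewrite !vltE => /andP[]; exact: mi_cover I _ _ eb.
Qed.

Section LowerMatch.
Variable b : {set V * V}.
Hypothesis lm : lower_match b.

Lemma lm_tag e : e \in b -> tag e.1 < tag e.2.
Proof. by case/and4P: lm => /forallP/(_ e)/implyP h _ _ _ /h. Qed.

Lemma lm_lt e : e \in b -> vcode e.1 < vcode e.2.
Proof. by move=> /lm_tag h; rewrite -vltE /vlt h. Qed.

Lemma lm_inj1 e e' : e \in b -> e' \in b -> e.1 = e'.1 -> e = e'.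
Proof.
case/and4P: lm => _ h _ _ eb e'b h1; apply/eqP; apply: contraT => ne.
move: h => /forallP/(_ e)/implyP/(_ eb)/forallP/(_ e')/implyP/(_ e'b)/implyP/(_ ne).
by rewrite h1 eqxx.
Qed.

Lemma lm_inj2 e e' : e \in b -> e' \in b -> e.2 = e'.2 -> e = e'.
Proof.
case/and4P: lm => _ h _ _ eb e'b h1; apply/eqP; apply: contraT => ne.
move: h => /forallP/(_ e)/implyP/(_ eb)/forallP/(_ e')/implyP/(_ e'b)/implyP/(_ ne).
by rewrite h1 eqxx !andbF.
Qed.

Lemma lm_neq12 e e' : e \in b -> e' \in b -> e.1 != e'.2.
Proof.
case/and4P: lm => _ h _ _ eb e'b; case: (eqVneq e e') => [->|ne].
  by apply/eqP => h'; have := lm_lt e'b; rewrite h' ltnn.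
move: h => /forallP/(_ e)/implyP/(_ eb)/forallP/(_ e')/implyP/(_ e'b)/implyP/(_ ne).
by case/and4P.
Qed.

Lemma lm_cross e e' : e \in b -> e' \in b -> vcode e.1 < vcode e'.1 ->
  vcode e'.1 < vcode e.2 -> vcode e'.2 < vcode e.2.
Proof.
case/and4P: lm => _ _ h _ eb e'b h1 h2.
move: h => /forallP/(_ e)/implyP/(_ eb)/forallP/(_ e')/implyP/(_ e'b).
rewrite !vltE h1 h2 /= -leqNgt leq_eqVlt => /predU1P[/vcode_inj h|//].
have h' := lm_inj2 eb e'b (esym h); by rewrite h' ltnn in h1.
Qed.

Lemma lm_cover e v : e \in b -> vcode e.1 < vcode v -> vcode v < vcode e.2 -> matched b v.
Proof.
case/and4P: lm => _ _ _ h eb h1 h2.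
by move: h => /forallP/(_ e)/implyP/(_ eb)/forallP/(_ v); rewrite !vltE h1 h2.
Qed.

Definition rho (i : 'I_k) := #|[set e in b | tag e.2 == i]|.

(* In each box the right endpoints come first: an arc ending further right in
   the same box would otherwise cover, or cross the arc of, the vertex. *)
Lemma lm_right_closed e (j : 'I_(tnth dd (tag e.2))) : e \in b -> j < tagged e.2 ->
  exists2 e', e' \in b & e'.2 = mkvert j.
Proof.
set w : V := mkvert j => eb jlt.
have we : vcode w < vcode e.2 by rewrite -vltE /vlt /= eqxx jlt orbT.
have ew : vcode e.1 < vcode w by rewrite -vltE /vlt /= (lm_tag eb).
have /matchedP[e' e'b [wE|wE]] := lm_cover eb ew we; last by exists e'.
have h := lm_cross eb e'b; rewrite -wE in h; have {h} := h ew we.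
move=> h; have := lm_tag e'b; rewrite -wE /= => t2.
move: h; rewrite -vltE /vlt => /orP[|/andP[/eqP h _]].
  by rewrite ltnNge (ltnW t2).
by rewrite h ltnn in t2.
Qed.

Lemma rho_card i : rho i = #|[set x : 'I_(tnth dd i) |
  [exists e in b, e.2 == mkvert x]]|.
Proof.
rewrite /rho -(@card_in_imset _ _ (fun e => e.2)); last first.
  move=> e e'; rewrite !inE => /andP[eb _] /andP[e'b _]; exact: lm_inj2.
rewrite -[RHS](@card_imset _ _ (fun x => mkvert x)); last first.
  by move=> x y /eqP; rewrite eq_Tagged => /eqP.
apply: eq_card => v; apply/imsetP/imsetP => -[].
  move=> e; rewrite inE => /andP[eb /eqP he] hv; case: v hv => i' x hv.
  rewrite -hv /= in he; move: x hv; rewrite he => x hv; exists x => //.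
  by rewrite inE; apply/existsP; exists e; rewrite eb -hv eqxx.
move=> x; rewrite inE => /existsP[e /andP[eb /eqP h]] ->.
by exists e => //; rewrite inE eb h eqxx.
Qed.

Lemma rho_le i : rho i <= tnth dd i.
Proof. by rewrite rho_card -[X in _ <= X]card_ord max_card. Qed.

(** By [lm_right_closed] the right endpoints of a box are an initial segment, which its cardinality
    determines. Thus [rho] alone fixes the set of right endpoints. *)
Lemma right_endpointP v :
  reflect (exists2 e, e \in b & e.2 = v) (tagged v < rho (tag v)).
Proof.
case: v => i j /=; rewrite rho_card -mem_closed_ord.
  rewrite inE; apply: (iffP existsP) => [[e /andP[eb /eqP h]]|[e eb h]]; first by exists e.
  by exists e; rewrite eb h eqxx.
move=> x y; rewrite !inE => /existsP[e /andP[eb /eqP h]] yx.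
move: (@lm_right_closed e); rewrite h /= => /(_ y eb yx)[e' e'b h'].
by apply/existsP; exists e'; rewrite e'b h' eqxx.
Qed.

End LowerMatch.

Lemma tnth_nvec b i : tnth (nvec b) i = tnth dd i - rho b i.
Proof. by rewrite tnth_mktuple. Qed.

Lemma nvec_rho b b' : lower_match b -> lower_match b' ->
  nvec b = nvec b' -> rho b =1 rho b'.
Proof.
move=> lm lm' h i; have := congr1 (fun t => tnth t i) h; rewrite !tnth_nvec.
by have := rho_le lm i; have := rho_le lm' i; lia.
Qed.

(** If [e'] started inside [e], its left end would be covered by [e], hence matched in [b]. It is no
    right endpoint in [b], since it would then be one in [b']. So it starts an arc of [b] which, not
    crossing [e], ends before [u], and therefore belongs to [b'] too; there it shares its left end
    with [e'] but not its right end. *)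
Lemma lower_match_sub b b' u : lower_match b -> lower_match b' ->
    (forall v, (exists2 e, e \in b & e.2 = v) -> exists2 e, e \in b' & e.2 = v) ->
    (forall e, vcode e.2 < vcode u -> (e \in b) = (e \in b')) ->
  forall e e', e \in b -> e' \in b' -> e.2 = u -> e'.2 = u -> vcode e'.1 <= vcode e.1.
Proof.
move=> lm lm' R IH e e' eb eb' eu e'u; rewrite leqNgt; apply/negP => ee'.
have e'lt : vcode e'.1 < vcode e.2 by rewrite eu -e'u; exact: (lm_lt lm').
have /matchedP[e2 e2b [h|h]] := lm_cover lm eb ee' e'lt; last first.
  have [|e3 e3b' h3] := R e'.1; first by exists e2.
  by have := lm_neq12 lm' eb' e3b'; rewrite h3 eqxx.
have c2 : vcode e2.2 < vcode u by rewrite -eu (lm_cross lm eb) -?h.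
have e2b' : e2 \in b' by rewrite -IH.
have e2E : e2 = e' by apply: (lm_inj1 lm').
by rewrite e2E e'u ltnn in c2.
Qed.

Lemma nvec_inj b b' : lower_match b -> lower_match b' -> nvec b = nvec b' -> b = b'.
Proof.
move=> lm lm' h; have hr := nvec_rho lm lm' h.
have R v : (exists2 e, e \in b & e.2 = v) <-> exists2 e, e \in b' & e.2 = v.
  by split=> /right_endpointP => /(_ ltac:(done)) hv; apply/right_endpointP => //; rewrite ?hr // -hr.
(* The right endpoints agree already. Going from left to right through them, [lower_match_sub] used
   in both directions forces the left ends to agree. *)
suff H n e : vcode e.2 < n -> (e \in b) = (e \in b').
  by apply/setP => e; exact: (H (vcode e.2).+1).
elim: n e => // n IH e; rewrite ltnS => en.
have IH' e' : vcode e'.2 < vcode e.2 -> (e' \in b) = (e' \in b').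
  by move=> h'; apply: IH; exact: leq_trans en.
have IH2 e' : vcode e'.2 < vcode e.2 -> (e' \in b') = (e' \in b) by move/IH'.
have R1 v := (R v).1; have R2 v := (R v).2.
have end_eq (e1 e2 : V * V) : e2.2 = e1.2 -> vcode e1.1 <= vcode e2.1 <= vcode e1.1 -> e1 = e2.
  case: e1 e2 => [v u] [v' u'] /= ->; rewrite -eqn_leq => /eqP/vcode_inj ->; by [].
apply/idP/idP => eb.
  have [|e' eb' h'] := R1 e.2; first by exists e.
  rewrite (end_eq e e') //; apply/andP; split.
    exact: (lower_match_sub lm' lm R2 IH2 eb' eb h' erefl).
  exact: (lower_match_sub lm lm' R1 IH' eb eb' erefl h').
have [|e' eb' h'] := R2 e.2; first by exists e.
rewrite (end_eq e e') //; apply/andP; split.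
  exact: (lower_match_sub lm lm' R1 IH' eb' eb h' erefl).
exact: (lower_match_sub lm' lm R2 IH2 eb eb' erefl h').
Qed.

Lemma card_vert (P : pred 'I_k) (Q : forall i, pred 'I_(tnth dd i)) :
  #|[set v : V | P (tag v) && Q (tag v) (tagged v)]| =
  \sum_(i | P i) #|[set x | Q i x]|.
Proof.
rewrite -sum1dep_card -(@sig_big_dep _ _ _ _ _ P Q (fun _ _ => 1)).
by apply: eq_bigr => i _; rewrite sum1dep_card.
Qed.

Lemma sum_rho b (P : pred 'I_k) :
  #|[set e in b | P (tag e.2)]| = \sum_(i | P i) rho b i.
Proof.
rewrite -sum1dep_card (partition_big (fun e => tag e.2) P) /=; last by move=> e /andP[].
apply: eq_bigr => i Pi; rewrite /rho -sum1dep_card; apply: eq_bigl => e.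
by case: eqP => [->|]; rewrite ?Pi ?andbT ?andbF.
Qed.

Lemma card_lower_match b : #|b| = \sum_i rho b i.
Proof. by rewrite -sum_rho; apply: eq_card => e; rewrite inE andbT. Qed.

(** Arcs ending in boxes up to [i] are determined by their left ends, which lie in earlier boxes and
    are not right endpoints. *)
Lemma lower_match_valid b i : lower_match b ->
  \sum_(j < k | j <= i) rho b j <= \sum_(j < k | j < i) (tnth dd j - rho b j).
Proof.
move=> lm; rewrite -(sum_rho b (fun j => j <= i)).
rewrite -(@card_in_imset _ _ (fun e => e.1)); last first.
  move=> e e'; rewrite !inE => /andP[eb _] /andP[e'b _]; exact: (lm_inj1 lm).
under eq_bigr => j _ do rewrite -card_ord_geq.
rewrite -(card_vert (fun j => j < i) (fun j x => rho b j <= x)).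
apply: subset_leq_card; apply/subsetP => v /imsetP[e]; rewrite !inE => /andP[eb ti] ->.
rewrite (leq_trans (lm_tag lm eb) ti) /= leqNgt; apply/negP => /(right_endpointP lm)[e' eb' h].
by have := lm_neq12 lm eb eb'; rewrite h eqxx.
Qed.

(** It suffices that every up vertex gets matched. If [u] did not, then by [mi_down] each down
    vertex of an earlier box would be matched, and by [mi_cover] its arc could not pass over [u]. So
    the set [S] of these vertices would inject into [U] without [u], while the inequality at the box
    of [u] says that [U] has at most as many elements as [S]. *)
Lemma nvec_surj (n : k.-tuple nat) : (forall i, tnth n i <= tnth dd i) ->
  (forall i : 'I_k, \sum_(j < k | j <= i) (tnth dd j - tnth n j) <=
     \sum_(j < k | j < i) tnth n j) ->
  nvec (bar dd n) = n.
Proof.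
move=> nd val; have I := bar_inv n; have lm := bar_lower_match n.
have up u : ~~ down n u -> matched (bar dd n) u.
  move=> du; apply: contraT => mu.
  pose S := [set v : V | (tag v < tag u) && down n v].
  pose U := [set v : V | (tag v <= tag u) && ~~ down n v].
  pose A := [set e in bar dd n | tag e.1 < tag u].
  have cS : #|S| = \sum_(j < k | j < tag u) tnth n j.
    rewrite (card_vert (fun j => j < tag u) (fun j x => tnth dd j - tnth n j <= x)).
    by apply: eq_bigr => j _; rewrite card_ord_geq; have := nd j; lia.
  have cU : #|U| = \sum_(j < k | j <= tag u) (tnth dd j - tnth n j).
    rewrite (card_vert (fun j => j <= tag u) (fun j x => ~~ (tnth dd j - tnth n j <= x))).
    apply: eq_bigr => j _; under eq_finset do rewrite -ltnNge.
    by rewrite card_ord_lt // leq_subr.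
  have SA : #|S| <= #|A|.
    apply: leq_trans (leq_imset_card (fun e => e.1) A); apply: subset_leq_card.
    apply/subsetP => w; rewrite inE => /andP[wu dw].
    have wu' : vcode w < vcode u by rewrite -vltE /vlt wu.
    have mw : matched (bar dd n) w.
      apply: contraT => mw; have := mi_down I _ dw mw wu' du.
      by rewrite mem_rev mem_verts (negPf mu) => /(_ isT).
    have /matchedP[e eb [h|h]] := mw.
      by apply/imsetP; exists e => //; rewrite inE eb -h.
    by have [_ _] := mi_arc I eb; rewrite -h dw.
  have AU : #|A| <= #|U :\ u|.
    rewrite -(@card_in_imset _ _ (fun e => e.2) (mem A)); last first.
      move=> e e'; rewrite !inE => /andP[eb _] /andP[e'b _]; exact: (lm_inj2 lm).
    apply: subset_leq_card; apply/subsetP => w /imsetP[e]; rewrite inE => /andP[eb eu] ->.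
    have [_ _ de elt] := mi_arc I eb; rewrite !inE de andbT.
    have eu' : vcode e.1 < vcode u by rewrite -vltE /vlt eu.
    have ne : e.2 != u.
      by apply: contra mu => /eqP h; apply/matchedP; exists e => //; right.
    rewrite ne /= leqNgt; apply/negP => h; move/negP: mu; apply.
    by apply: (mi_cover I eb eu'); rewrite -vltE /vlt h.
  have uU : u \in U by rewrite inE leqnn.
  by have := val (tag u); rewrite -cU -cS (cardsD1 u U) uU; lia.
have rhoE i : rho (bar dd n) i = tnth dd i - tnth n i.
  rewrite (rho_card lm) -[RHS](card_ord_lt (leq_subr _ _)); apply: eq_card => x.
  rewrite !inE; apply/existsP/idP => [[e /andP[eb /eqP h]]|xi].
    by have [_ _ + _] := mi_arc I eb; rewrite h /down -ltnNge.
  have du : ~~ down n (mkvert x) by rewrite /down -ltnNge.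
  have /matchedP[e eb [h|h]] := up _ du; last by exists e; rewrite eb h eqxx.
  by have [_ + _ _] := mi_arc I eb; rewrite -h (negPf du).
apply: eq_from_tnth => i; rewrite tnth_nvec rhoE; have := nd i; lia.
Qed.

End MatchTheory.

Import Order.TTheory GRing.Theory Num.Theory.
Local Open Scope ring_scope.

(** * Counting subspaces and flags over a finite field *)

(** The Gaussian binomial coefficient, by its Pascal recursion: integrality and positivity at
    natural numbers are then immediate, and [gauss_prod] is the product formula with denominators
    cleared. *)
Fixpoint gauss (n k : nat) : {poly int} :=
  match n, k with
  | _, 0%N => 1
  | 0%N, _.+1 => 0
  | n'.+1, k'.+1 => gauss n' k' + 'X^(k'.+1) * gauss n' k'.+1
  end.

Lemma prod_polyXn_sub_recl a m : \prod_(i < a.+1) ('X^(m.+1) - 'X^i) =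
  ('X^(m.+1) - 1) * ('X^a * \prod_(i < a) ('X^m - 'X^i)) :> {poly int}.
Proof.
rewrite big_ord_recl expr0; congr (_ * _).
rewrite (eq_bigr (fun i : 'I_a => 'X * ('X^m - 'X^i))) => [|i _].
  by rewrite big_split /= prodr_const card_ord.
by rewrite lift0 !exprS mulrBr.
Qed.

Lemma gauss_prod n k : gauss n k * \prod_(i < k) ('X^k - 'X^i) = \prod_(i < k) ('X^n - 'X^i).
Proof.
elim: n k => [|n IH] [|k] /=; rewrite ?big_ord0 ?mulr1 //.
  by rewrite mul0r big_ord_recl expr0 subrr mul0r.
rewrite mulrDl -mulrA (IH k.+1) !prod_polyXn_sub_recl big_ord_recr /= -(IH k) !exprS; ring.
Qed.

Lemma gauss_ge0 n k (Q : nat) : 0 <= (gauss n k).[Q%:Z].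
Proof.
elim: n k => [|n IH] [|k] //=; rewrite !hornerE //.
by rewrite addr_ge0 // mulr_ge0 // exprn_ge0.
Qed.

Lemma gauss_gt0 n k (Q : nat) : (k <= n)%N -> 0 < (gauss n k).[Q%:Z].
Proof.
elim: n k => [|n IH] [|k] //= kn; rewrite !hornerE //.
by rewrite ltr_pwDl ?IH // mulr_ge0 ?exprn_ge0 ?gauss_ge0.
Qed.

Arguments gauss : simpl never.

Lemma gauss1 n : gauss n 1 * ('X - 1) = 'X^n - 1.
Proof. by have := gauss_prod n 1; rewrite !big_ord1 expr1 !expr0. Qed.

Lemma polyXn_sub_neq0 (R : nzRingType) (m n : nat) : m != n -> 'X^m - 'X^n != 0 :> {poly R}.
Proof.
move=> mn; apply/eqP => /(congr1 (fun p : {poly R} => p`_m)).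
by rewrite coefB !coefXn eqxx (negPf mn) subr0 coef0 => /eqP; rewrite oner_eq0.
Qed.

Lemma gauss_pred n : gauss n.+1 n * ('X - 1) = 'X^(n.+1) - 1.
Proof.
have D0 k : \prod_(i < k) ('X^k - 'X^i) != 0 :> {poly int}.
  by apply/prodf_neq0 => i _; rewrite polyXn_sub_neq0 // neq_ltn ltn_ord orbT.
apply: (mulIf (D0 n)); apply: (mulIf (monic_neq0 (monicXn _ n))).
have h := prod_polyXn_sub_recl n n.
rewrite big_ord_recr /= -(gauss_prod n.+1 n) exprS in h; rewrite exprS.
transitivity (('X * 'X^n - 1) * ('X^n * \prod_(i < n) ('X^n - 'X^i)) : {poly int}).
  by rewrite -h; ring.
by ring.
Qed.

Lemma Posz_exp (m n : nat) : (m ^ n)%N%:Z = m%:Z ^+ n.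
Proof. by elim: n => // n IH; rewrite expnS PoszM IH exprS. Qed.

Section Counting.
Variables (F : finFieldType) (d : nat).
Local Notation vT := 'rV[F]_d.
Local Notation Q := #|F|.
Implicit Types (U V W K L H : {vspace vT}) (x : vT).

Lemma dim_addv_line U x : \dim (U + <[x]>) = (\dim U + (x \notin U))%N.
Proof.
case: (boolP (x \in U)) => xU /=; first by rewrite (addv_idPl _) ?addn0 // -memvE.
have /eqP := dimv_sum_cap U <[x]>; suff -> : (U :&: <[x]> = 0)%VS.
  rewrite dimv0 addn0 dim_vline => /eqP ->; case: eqP xU => // ->; by rewrite mem0v.
apply/eqP; rewrite -subv0; apply/subvP => y; rewrite memv_cap memv0 => /andP[yU /vlineP[a ya]].
rewrite ya scaler_eq0; apply/orP; left; apply: contraNT xU => a0.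
by rewrite -(scalerK a0 x) -ya memvZ.
Qed.

Lemma card_vspaceD U V : (U <= V)%VS ->
  #|[set x in V | x \notin U]| = (Q ^ \dim V - Q ^ \dim U)%N.
Proof.
move=> UV; rewrite -!card_vspace -(cardID (mem U) (mem V)).
rewrite (@eq_card _ [predI mem V & mem U] (mem U)) => [|x]; last first.
  by rewrite !inE; case: (boolP (x \in U)) => [/(subvP UV) ->|]; rewrite ?andbF.
by rewrite addKn; apply: eq_card => x; rewrite !inE andbC.
Qed.

Definition indep_ext e K V : {set e.-tuple vT} :=
  [set X : e.-tuple vT | all (mem V) X && (\dim (K + <<X>>) == \dim K + e)%N].

Lemma dim_add_span K (X : seq vT) : (\dim (K + <<X>>) <= \dim K + size X)%N.
Proof.
apply: leq_trans (leq_addr (\dim (K :&: <<X>>)) _) _.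
by rewrite dimv_sum_cap leq_add2l dim_span.
Qed.

Lemma card_indep_ext e K V : (K <= V)%VS ->
  #|indep_ext e K V|%:Z = \prod_(i < e) (Q%:Z ^+ \dim V - Q%:Z ^+ (\dim K + i)).
Proof.
move=> KV; elim: e => [|e IH].
  rewrite big_ord0; suff -> : indep_ext 0 K V = [set [tuple]] by rewrite cards1.
  by apply/setP => X; rewrite tuple0 !inE /= span_nil addv0 addn0 eqxx.
rewrite big_ord_recr /= -IH.
have spanV (Y : e.-tuple vT) : Y \in indep_ext e K V -> (K + <<Y>> <= V)%VS.
  by rewrite inE subv_add KV => /andP[/allP YV _]; apply/span_subvP.
have -> : #|indep_ext e.+1 K V| =
   (\sum_(Y in indep_ext e K V) #|[set x in V | x \notin (K + <<Y>>)%VS]|)%N.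
  rewrite -sum1dep_card.
  rewrite (reindex (fun p : e.-tuple vT * vT => [tuple of p.2 :: p.1])) /=; last first.
    exists (fun X : e.+1.-tuple vT => ([tuple of behead X], thead X)) => [[Y x] _|X _] /=.
      by rewrite theadE; congr pair; apply/val_inj.
    by rewrite -tuple_eta.
  transitivity (\sum_(Y in indep_ext e K V)
      \sum_(x | (x \in V) && (x \notin (K + <<Y>>)%VS)) 1)%N; last first.
    by apply: eq_bigr => Y _; rewrite sum1dep_card.
  rewrite (pair_big_dep (fun Y => Y \in indep_ext e K V)
    (fun Y x => (x \in V) && (x \notin (K + <<Y>>)%VS)) (fun _ _ => 1%N)) /=.
  apply: eq_bigl => -[Y x] /=; rewrite inE span_cons addvA [(K + _)%VS]addvC -addvA.
  rewrite [(<[_]> + _)%VS]addvC dim_addv_line.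
  have := dim_add_span K Y; rewrite size_tuple; case: (x \notin _); rewrite /= ?andbT ?andbF; lia.
rewrite (eq_bigr (fun=> (Q ^ \dim V - Q ^ (\dim K + e))%N)) => [|Y YI].
  rewrite sum_nat_const PoszM.
  (* Without an [e]-tuple both sides vanish. With one, [\dim K + e <= \dim V], so the truncated
     subtraction in [nat] agrees with that of [int]. *)
  case: (posnP #|indep_ext e K V|) => [->|]; first by rewrite !mul0r.
  move=> /card_gt0P[Y YI]; congr (_ * _).
  have /eqP dY : \dim (K + <<Y>>) == (\dim K + e)%N by move: YI; rewrite inE => /andP[].
  rewrite -!Posz_exp subzn // leq_pexp2l ?(ltnW (finRing_gt1 F)) //.
  by rewrite -dY dimvS ?spanV.
have /eqP dY : \dim (K + <<Y>>) == (\dim K + e)%N by move: YI; rewrite inE => /andP[].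
by rewrite -dY card_vspaceD // spanV.
Qed.

(* Both sides count the [e]-tuples in [V] that are linearly independent modulo
   [K], the left-hand side according to the subspace they span with [L]. *)
Lemma card_subspaces_prod e L K V : (L <= K)%VS -> (K <= V)%VS ->
  #|[set H : {vspace vT} | [&& (H <= V)%VS, (H :&: K == L)%VS & \dim H == (\dim L + e)%N]]|%:Z *
    \prod_(i < e) (Q%:Z ^+ (\dim L + e) - Q%:Z ^+ (\dim L + i)) =
  \prod_(i < e) (Q%:Z ^+ \dim V - Q%:Z ^+ (\dim K + i)).
Proof.
move=> LK KV; set S := [set H | _].
have LKX (X : seq vT) : (K + (L + <<X>>) = K + <<X>>)%VS by rewrite addvA (addv_idPl LK).
have idE H (X : e.-tuple vT) : H \in S ->
    (X \in indep_ext e K V) && ((L + <<X>>)%VS == H) = (X \in indep_ext e L H).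
  move=> HS; have := HS; rewrite !inE => /and3P[HV /eqP HK /eqP dH].
  have LH : (L <= H)%VS by rewrite -HK capvSl.
  apply/andP/andP => [[/andP[XV _] /eqP eH]|[/allP XH /eqP dX]].
    split; last by rewrite eH dH.
    by apply/allP => x xX; rewrite -eH; apply: (subvP (addvSr _ _)); exact: memv_span.
  have eH : (L + <<X>>)%VS = H.
    by apply/eqP; rewrite eqEdim subv_add LH dX dH leqnn andbT; apply/span_subvP.
  split; last by rewrite eH.
  apply/andP; split; first by apply/allP => x /XH; exact: (subvP HV).
  rewrite -LKX eH; have := dimv_sum_cap K H; rewrite capvC HK dH; lia.
rewrite -card_indep_ext // -[in RHS]sum1_card.
rewrite (partition_big (fun X : e.-tuple vT => (L + <<X>>)%VS) (fun H => H \in S)) /=; last first.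
  move=> X; rewrite !inE => /andP[/allP XV /eqP dX].
  have HV : (L + <<X>> <= V)%VS.
    by rewrite subv_add (subv_trans LK KV); apply/span_subvP.
  have h1 := dimv_sum_cap K (L + <<X>>); rewrite LKX dX in h1.
  have h2 := dim_add_span L X; rewrite size_tuple in h2.
  have LL : (L <= (L + <<X>>) :&: K)%VS by rewrite subv_cap LK addvSl.
  have h3 := dimvS LL; rewrite capvC in h3.
  have e1 : \dim (L + <<X>>) = (\dim L + e)%N by lia.
  by rewrite HV e1 eqxx andbT /= eq_sym eqEdim LL capvC; lia.
rewrite -[RHS]natz natr_sum [RHS](eq_bigr (fun=>
    \prod_(i < e) (Q%:Z ^+ (\dim L + e) - Q%:Z ^+ (\dim L + i)))) => [|H HS].
  by rewrite sumr_const -[in LHS]natz mulr_natl.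
rewrite (eq_bigl (mem (indep_ext e L H))) => [|X]; last exact: idE.
rewrite sum1_card natz card_indep_ext.
  by move: HS; rewrite inE => /and3P[_ _ /eqP ->].
by move: HS; rewrite inE => /and3P[_ /eqP <- _]; rewrite capvSl.
Qed.

(** Modulo [L], such an [H] maps isomorphically onto an [e]-dimensional subspace of [V/K], counted
    by [gauss]; its lifts form a torsor under the linear maps from that subspace to [K/L], which
    gives the power of [Q]. The computation divides the two products of [card_subspaces_prod]. *)
Lemma card_subspaces_cap e L K V : (L <= K)%VS -> (K <= V)%VS ->
  #|[set H : {vspace vT} | [&& (H <= V)%VS, (H :&: K == L)%VS & \dim H == (\dim L + e)%N]]|%:Z =
  Q%:Z ^+ (e * (\dim K - \dim L)) * (gauss (\dim V - \dim K) e).[Q%:Z].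
Proof.
move=> LK KV; have Q1 : 1 < Q%:Z by rewrite ltz_nat finRing_gt1.
have lk := dimvS LK; have kv := dimvS KV.
have prodE a b : \prod_(i < e) (Q%:Z ^+ (a + b) - Q%:Z ^+ (a + i)) =
    Q%:Z ^+ (a * e) * \prod_(i < e) (Q%:Z ^+ b - Q%:Z ^+ i).
  rewrite (eq_bigr (fun i : 'I_e => Q%:Z ^+ a * (Q%:Z ^+ b - Q%:Z ^+ i))) => [|i _].
    by rewrite big_split /= prodr_const card_ord -exprM.
  by rewrite !exprD mulrBr.
have D0 : \prod_(i < e) (Q%:Z ^+ (\dim L + e) - Q%:Z ^+ (\dim L + i)) != 0.
  apply/prodf_neq0 => i _; rewrite subr_eq0 eq_sym lt_eqF // ltr_eXn2l //.
  by rewrite ltn_add2l.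
apply: (mulIf D0); rewrite card_subspaces_prod // -{1}(subnKC kv) !prodE.
have := congr1 (horner^~ Q%:Z) (gauss_prod (\dim V - \dim K) e).
rewrite /= hornerM !horner_prod.
under eq_bigr do rewrite !hornerE.
under [X in _ = X -> _]eq_bigr do rewrite !hornerE.
move=> <-; rewrite -{1}(subnKC lk) mulnDl exprD [(e * _)%N]mulnC; ring.
Qed.

Lemma card_subspaces_between e L V : (L <= V)%VS ->
  #|[set H : {vspace vT} | [&& (L <= H)%VS, (H <= V)%VS & \dim H == (\dim L + e)%N]]|%:Z =
  (gauss (\dim V - \dim L) e).[Q%:Z].
Proof.
move=> LV; have := card_subspaces_cap e (subvv L) LV; rewrite subnn muln0 mul1r => <-.
congr (_%:Z); apply: eq_card => H; rewrite !inE andbCA; congr (_ && (_ && _)).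
by apply/idP/eqP => [/capv_idPr|<-]; rewrite ?capvSl.
Qed.

Lemma card_subspaces_above L V : (L <= V)%VS ->
  #|[set H : {vspace vT} | [&& (L <= H)%VS, (H <= V)%VS & \dim H == (\dim L).+1]]|%:Z =
  (\sum_(i < \dim V - \dim L) 'X^i : {poly int}).[Q%:Z].
Proof.
move=> LV; have := card_subspaces_between 1 LV; rewrite addn1 => ->; congr (_.[_]).
have X1 : ('X - 1 : {poly int}) != 0 by rewrite -[1]/(1%:P) polyXsubC_eq0.
by apply: (mulIf X1); rewrite gauss1 subrX1 mulrC.
Qed.

Lemma card_subspaces_below L V : (L <= V)%VS ->
  #|[set H : {vspace vT} | [&& (L <= H)%VS, (H <= V)%VS & (\dim H).+1 == \dim V]]|%:Z =
  (\sum_(i < \dim V - \dim L) 'X^i : {poly int}).[Q%:Z].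
Proof.
move=> LV; have lv := dimvS LV.
case En : (\dim V - \dim L)%N => [|n].
  rewrite big_ord0 horner0; apply/eqP; rewrite eqz_nat cards_eq0; apply/eqP/setP => H.
  rewrite !inE; apply/and3P => -[/dimvS LH _ /eqP]; lia.
have := card_subspaces_between n LV; rewrite En => h; transitivity (gauss n.+1 n).[Q%:Z].
  rewrite -h; congr (_%:Z); apply: eq_card => H; rewrite !inE; congr [&& _, _ & _].
  by apply/eqP/eqP; lia.
have X1 : ('X - 1 : {poly int}) != 0 by rewrite -[1]/(1%:P) polyXsubC_eq0.
by congr (_.[_]); apply: (mulIf X1); rewrite gauss_pred subrX1 mulrC.
Qed.

(** Sort the [H] by [L = H :&: K], a subspace of dimension [c] between [A] and [K]; the number of
    [H] with a given [L] depends only on dimensions. *)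
Lemma card_subspaces_meet A K V c h : (A <= K)%VS -> (K <= V)%VS ->
  (\dim A <= c)%N -> (c <= h)%N ->
  #|[set H : {vspace vT} | [&& (A <= H)%VS, (H <= V)%VS, \dim (H :&: K) == c & \dim H == h]]|%:Z =
  (gauss (\dim K - \dim A) (c - \dim A) *
   ('X^((h - c) * (\dim K - c)) * gauss (\dim V - \dim K) (h - c))).[Q%:Z].
Proof.
move=> AK KV Ac ch; rewrite -sum1_card.
pose S := [set L : {vspace vT} | [&& (A <= L)%VS, (L <= K)%VS & \dim L == (\dim A + (c - \dim A))%N]].
rewrite (partition_big (fun H => (H :&: K)%VS) (fun H => H \in S)) /=; last first.
  move=> H; rewrite !inE => /and4P[AH HV /eqP -> _].
  by rewrite subv_cap AH AK capvSr subnKC //=.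
rewrite hornerM -card_subspaces_between // -/S -[LHS]natz natr_sum.
rewrite [LHS](eq_bigr (fun=> ('X^((h - c) * (\dim K - c)) * gauss (\dim V - \dim K) (h - c)).[Q%:Z])).
  by rewrite sumr_const -mulr_natl natz.
move=> L; rewrite inE => /and3P[AL LK /eqP]; rewrite subnKC // => dL.
rewrite hornerM hornerXn; have := card_subspaces_cap (h - c) LK KV; rewrite dL => <-.
rewrite -sum1_card natz; congr (_%:Z); apply: eq_bigl => H; rewrite !inE.
rewrite subnKC //; apply/andP/and3P => [[/and4P[_ HV _ dH] HK]|[HV /eqP HK dH]] //.
by rewrite HV dH HK dL !eqxx (subv_trans AL) // -HK capvSl.
Qed.

End Counting.

(** * Flags with prescribed intersections with a kernel *)

Lemma forall_ord_recr k (P : pred 'I_k.+1) :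
  [forall i, P i] = [forall i : 'I_k, P (widen_ord (leqnSn k) i)] && P ord_max.
Proof.
apply/forallP/andP => [h|[/forallP h hk] i]; first by split; first apply/forallP.
have := ltn_ord i; rewrite ltnS leq_eqVlt => /predU1P[ik|ik].
  by rewrite (_ : i = ord_max) //; apply: val_inj.
by rewrite (_ : i = widen_ord (leqnSn k) (Ordinal ik)) //; apply: val_inj.
Qed.

(* This is [admissible] below, in terms of [n i = d i - t i]. *)
Definition nadm k (d n : nat -> nat) : bool := [forall i : 'I_k, (n i <= d i)%N &&
  (\sum_(j < i.+1) d j <= \sum_(j < i.+1) n j + \sum_(j < i) n j)%N].

Lemma nadmS k d n : nadm k.+1 d n = [&& nadm k d n, (n k <= d k)%N &
  (\sum_(j < k.+1) d j <= \sum_(j < k.+1) n j + \sum_(j < k) n j)%N].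
Proof. by rewrite /nadm forall_ord_recr. Qed.

Lemma nadm0 d n : nadm 0 d n.
Proof. by apply/forallP => -[]. Qed.

Lemma nadm_sum k d n : nadm k d n -> (\sum_(j < k) n j <= \sum_(j < k) d j)%N.
Proof. by move=> /forallP h; apply: leq_sum => i _; have /andP[] := h i. Qed.

(* The count of [card_flags]: the last proper step of a flag of [V] contains
   [t @: V] and meets [lker t :&: V] in a prescribed dimension. *)
Fixpoint flag_poly k (d n : nat -> nat) : {poly int} :=
  if k is l.+1 then
    let v := (\sum_(j < k) d j)%N in let h := (\sum_(j < l) d j)%N in
    let z := (\sum_(j < k) n j)%N in let c := (\sum_(j < l) n j)%N in
    if (v - z <= c <= h)%N then
      gauss (z - (v - z)) (c - (v - z)) * ('X^((h - c) * (z - c)) * gauss (v - z) (h - c))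
      * flag_poly l d n
    else 0
  else 1.

(** The inequalities of [nadm] are what the guard of [flag_poly] and the ranges of its Gaussian
    factors require. Positivity at one [Q] already shows that the polynomial is not zero. *)
Lemma flag_poly_gt0 k d n (Q : nat) : (0 < Q)%N -> nadm k d n -> 0 < (flag_poly k d n).[Q%:Z].
Proof.
move=> Q0; elim: k => [|k IH]; first by rewrite hornerC.
rewrite nadmS => /and3P[hk nd hs].
have := nadm_sum hk; rewrite /= !big_ord_recr /= in hs *.
move: (\sum_(j < k) n j)%N (\sum_(j < k) d j)%N hs => c h hs ch.
rewrite ifT; last by lia.
rewrite hornerM pmulr_lgt0; last exact: IH.
rewrite !hornerM hornerXn !mulr_gt0 ?exprn_gt0 ?gauss_gt0 //; lia.
Qed.

Section Flags.
Variables (F : finFieldType) (d : nat) (t : 'End('rV[F]_d)) (dd n : nat -> nat).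
Local Notation vT := 'rV[F]_d.
Local Notation Q := #|F|.
Implicit Types (H V : {vspace vT}).

Definition flag_step H V i := [&& (H <= V)%VS, \dim V == (\dim H + dd i)%N,
  (t @: V <= H)%VS & \dim (lker t :&: V) == (\dim (lker t :&: H) + n i)%N].

(** The top [V] is a parameter because the recursion removes the last step of the flag; the points
    of the variety use [V = fullv]. *)
Definition flags k V : {set vflag F k d} := [set D : vflag F k d |
  [&& D ord0 == 0%VS, D ord_max == V & [forall i : 'I_k, flag_step (vflo D i) (vfhi D i) i]]].

Definition flag_rest k (D : vflag F k.+1 d) : vflag F k d :=
  [ffun j => D (widen_ord (leqnSn k.+1) j)].
Definition flag_ext k V (D : vflag F k d) : vflag F k.+1 d :=
  [ffun i : 'I_k.+2 => if unlift ord_max i is Some j then D j else V].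

Lemma flag_ext_max k V (D : vflag F k d) : flag_ext V D ord_max = V.
Proof. by rewrite ffunE unlift_none. Qed.

Lemma flag_extK k V (D : vflag F k d) : flag_rest (flag_ext V D) = D.
Proof.
apply/ffunP => j; rewrite !ffunE.
have -> : widen_ord (leqnSn k.+1) j = lift ord_max j by apply/val_inj; rewrite /= /bump leqNgt ltn_ord.
by rewrite liftK.
Qed.

Lemma flag_restK k V (D : vflag F k.+1 d) : D ord_max = V -> flag_ext V (flag_rest D) = D.
Proof.
move=> DV; apply/ffunP => i; rewrite ffunE; case: unliftP => [j|] ->; last by rewrite DV.
by rewrite ffunE; congr (D _); apply/val_inj; rewrite /= /bump leqNgt ltn_ord.
Qed.

Lemma mem_flagsS k V (D : vflag F k.+1 d) : (D \in flags k.+1 V) =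
  [&& flag_rest D \in flags k (flag_rest D ord_max), D ord_max == V
    & flag_step (flag_rest D ord_max) V k].
Proof.
rewrite !inE forall_ord_recr eqxx /= ffunE.
have -> : widen_ord (leqnSn k.+1) ord0 = ord0 by apply/val_inj.
have -> : [forall i : 'I_k, flag_step (vflo D (widen_ord (leqnSn k) i))
    (vfhi D (widen_ord (leqnSn k) i)) (widen_ord (leqnSn k) i)] =
  [forall i : 'I_k, flag_step (vflo (flag_rest D) i) (vfhi (flag_rest D) i) i].
  apply: eq_forallb => i; rewrite /vflo /vfhi !ffunE; congr (flag_step (D _) (D _) _).
  exact/val_inj.
have -> : vfhi D ord_max = D ord_max by rewrite /vfhi; congr (D _); apply/val_inj.
rewrite /vflo ffunE; case: (D ord0 == 0%VS) => //=.
by case: eqP => [->|]; rewrite ?andbF //= andbA.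
Qed.

Lemma card_flagsS k V : #|flags k.+1 V| =
  (\sum_(H : {vspace vT} | flag_step H V k) #|flags k H|)%N.
Proof.
rewrite -sum1_card (partition_big (fun D => flag_rest D ord_max) (fun H => flag_step H V k)).
  apply: eq_bigr => H HV; rewrite (reindex_onto (flag_ext V) (@flag_rest k)) /=.
    rewrite -sum1_card; apply: eq_bigl => D.
    rewrite mem_flagsS flag_ext_max flag_extK !eqxx andbT.
    by case: (eqVneq (D ord_max) H) => [->|DH]; rewrite ?HV ?andbT ?andbF // inE (negPf DH) andbF.
  by move=> D /andP[]; rewrite mem_flagsS => /and3P[_ /eqP DV _] _; exact: flag_restK.
by move=> D; rewrite mem_flagsS => /and3P[].
Qed.

Lemma card_flags0 V : \dim V = 0%N -> #|flags 0 V| = 1%N.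
Proof.
move=> /eqP; rewrite dimv_eq0 => /eqP ->;
suff -> : flags 0 0%VS = [set [ffun _ => 0%VS]] by rewrite cards1.
apply/setP => D; rewrite !inE; apply/and3P/eqP => [[/eqP D0 _ _]|->].
  by apply/ffunP => i; rewrite ffunE -D0; congr (D _); apply/val_inj; case: i => -[].
by rewrite !ffunE !eqxx; split=> //; apply/forallP => -[].
Qed.

(** The space [t @: V] lies in [lker t], so the last proper step [H] is counted by
    [card_subspaces_meet] with [A = t @: V] and [K = lker t :&: V]. The flags below [H] are counted
    by induction, with a result independent of [H]. *)
Lemma card_flags k V : (t @: V <= V)%VS -> (t @: V <= lker t)%VS ->
  \dim V = (\sum_(j < k) dd j)%N -> \dim (lker t :&: V) = (\sum_(j < k) n j)%N ->
  #|flags k V|%:Z = (flag_poly k dd n).[Q%:Z].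
Proof.
elim: k V => [|k IH] V tV tk dV dK.
  by rewrite card_flags0 ?dV ?big_ord0 // hornerC.
have dA : \dim (t @: V) = (\sum_(j < k.+1) dd j - \sum_(j < k.+1) n j)%N.
  by rewrite -dV -dK -(limg_ker_dim t V) capvC addKn.
rewrite card_flagsS -[LHS]natz natr_sum.
have dimH H : flag_step H V k -> \dim H = (\sum_(j < k) dd j)%N /\
    \dim (lker t :&: H) = (\sum_(j < k) n j)%N.
  case/and4P => HV /eqP h1 tH /eqP h2; move: dV dK; rewrite !big_ord_recr /= h1 h2.
  by move=> /addIn -> /addIn ->.
rewrite (eq_bigr (fun=> (flag_poly k dd n).[Q%:Z])) => [|H st]; last first.
  have [d1 d2] := dimH H st; case/and4P: st => HV _ tH _; rewrite natz IH //.
    by apply: subv_trans tH; apply: limgS.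
  by apply: subv_trans tk; apply: limgS.
rewrite sumr_const /= -mulr_natl natz /=.
have stE H : flag_step H V k = [&& (t @: V <= H)%VS, (H <= V)%VS,
    \dim (H :&: (lker t :&: V)) == (\sum_(j < k) n j)%N & \dim H == (\sum_(j < k) dd j)%N].
  rewrite /flag_step; apply/and4P/and4P => [[HV h1 tH h2]|[tH HV h1 h2]].
    have [|-> d2] := dimH H; first exact/and4P.
    by rewrite [(lker t :&: V)%VS]capvC capvA (capv_idPl HV) capvC d2.
  split=> //; first by rewrite dV (eqP h2) big_ord_recr.
  rewrite dK big_ord_recr /= -(eqP h1) [(lker t :&: V)%VS]capvC capvA (capv_idPl HV).
  by rewrite [(lker t :&: H)%VS]capvC.
set N := #|_|; have -> : N = #|[set H : {vspace vT} | [&& (t @: V <= H)%VS, (H <= V)%VS,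
    \dim (H :&: (lker t :&: V)) == (\sum_(j < k) n j)%N & \dim H == (\sum_(j < k) dd j)%N]]|.
  by apply: eq_card => H; rewrite [RHS]inE -stE.
have AK : (t @: V <= lker t :&: V)%VS by rewrite subv_cap tk.
(* Outside the guard there is no [H]: its intersection with the kernel contains [t @: V], of
   dimension [v - z], and lies in [H]. *)
case: ifP => cond; last first.
  rewrite horner0 (_ : [set H | _] = finset.set0) ?cards0 ?mul0r //.
  apply/setP => H; rewrite [LHS]inE [RHS]inE; apply/negP.
  case/and4P => AH HV /eqP h1 /eqP h2; move/negP: cond; apply.
  by rewrite -dA -h1 -h2 !dimvS ?capvSl // subv_cap AH.
case/andP: cond => c1 c2; rewrite hornerM; congr (_ * _).
rewrite -dA in c1 *; rewrite card_subspaces_meet ?capvSr // dA -dV -dK.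
by [].
Qed.

Lemma flags_dim k V (D : vflag F k d) : D \in flags k V ->
  \dim V = (\sum_(j < k) dd j)%N /\ \dim (lker t :&: V) = (\sum_(j < k) n j)%N.
Proof.
elim: k V D => [|k IH] V D.
  rewrite inE !big_ord0 => /and3P[/eqP D0 /eqP <- _].
  by rewrite (_ : ord_max = ord0) ?D0 ?capv0 ?dimv0 //; apply/val_inj.
rewrite mem_flagsS => /and3P[/IH[h1 h2] _ /and4P[_ /eqP -> _ /eqP ->]].
by rewrite !big_ord_recr /= h1 h2.
Qed.

(** For a last step [H], the inclusion of [t @: V] in [lker t :&: H] gives the inequality on sums by
    rank and nullity, and the inclusion of [lker t :&: V + H] in [V] gives [n k <= d k]. *)
Lemma flags_nadm k V : (t @: V <= lker t)%VS ->
  (0 < #|flags k V|)%N -> nadm k dd n.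
Proof.
elim: k V => [|k IH] V tk; first by rewrite nadm0.
rewrite card_flagsS lt0n sum_nat_eq0 negb_forall => /existsP[H]; rewrite negb_imply -lt0n.
case/andP=> st hH; have [HV dV tH dK] := and4P st.
have hk : nadm k dd n by apply: IH hH; exact: subv_trans (limgS _ HV) tk.
have [D DH] : exists D, D \in flags k H by apply/set0Pn; rewrite -card_gt0.
have [sH sK] := flags_dim DH; rewrite nadmS hk /= !big_ord_recr /= -sH -sK.
have h1 := limg_ker_dim t V; rewrite capvC (eqP dV) (eqP dK) in h1.
have AH : (t @: V <= lker t :&: H)%VS by rewrite subv_cap tk.
have h2 := dimvS AH.
have h3 := dimv_sum_cap (lker t :&: V) H.
rewrite -capvA (capv_idPr HV) (eqP dK) in h3.
have KHV : (lker t :&: V + H <= V)%VS by rewrite subv_add HV capvSr.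
have h4 := dimvS KHV; rewrite (eqP dV) in h4.
clear - h1 h2 h3 h4; move: h1 h2 h3 h4.
move: (\dim (lker t :&: H)) (\dim H) (\dim (t @: V)) (\dim (lker t :&: V + H)) => a b c e; lia.
Qed.

End Flags.

(** * Quantum Clebsch-Gordan decomposition *)

Section Strings.
Variables (K : fieldType) (q : K).
Hypotheses (q0 : q != 0) (q1 : q - q^-1 != 0).
Hypothesis q_nroot : forall n, (0 < n)%N -> q ^+ n != 1.

(** Quantum integers at negative arguments are needed to exclude highest weight vectors of negative
    weight in [fstr_out]. *)
Definition qintz (z : int) : K := (q ^ z - q ^ (- z)) / (q - q^-1).

Lemma qintz_nat (n : nat) : qintz n%:Z = qint q n.
Proof. by rewrite /qintz /qint -invr_expz -exprnP. Qed.

Lemma expqz_inj : injective (fun z : int => q ^ z).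
Proof.
suff H (z z' : int) : z <= z' -> q ^ z = q ^ z' -> z = z'.
  move=> z z' h; case/orP: (le_total z z') => hz; first exact: H.
  by apply/esym/H.
move=> zz' h; case En : (z' - z) => [n|n]; last first.
  by move: zz'; rewrite -subr_ge0 En.
have e : q ^ (z' - z) = 1 by rewrite expfzDr // -h -expfzDr // subrr expr0z.
case: n => [|n] in En e; first by apply/esym/eqP; rewrite -subr_eq0 En.
by move: e; rewrite En -exprnP => /eqP; rewrite (negPf (q_nroot _)).
Qed.

Lemma qintz_eq0 z : (qintz z == 0) = (z == 0).
Proof.
rewrite /qintz mulf_eq0 invr_eq0 (negPf q1) orbF subr_eq0 (inj_eq expqz_inj).
by rewrite -subr_eq0 opprK -mulr2n mulrn_eq0.
Qed.

Lemma qint_eq0 n : (qint q n == 0) = (n == 0)%N.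
Proof. by rewrite -qintz_nat qintz_eq0. Qed.

Section FString.
Variable A : Uq_rep q.
Implicit Types u : 'cV[K]_(udim A).

(** The divided power [F^j u / [j]!], the normalization under which [E] and [F] act as on the basis
    vectors of [V_n]. *)
Fixpoint fstr u (j : nat) : 'cV[K]_(udim A) :=
  if j is i.+1 then (qint q j)^-1 *: (uF A *m fstr u i) else u.

Lemma fstr_F u j : uF A *m fstr u j = qint q j.+1 *: fstr u j.+1.
Proof. by rewrite /= scalerA mulfV ?scale1r // qint_eq0. Qed.

Lemma fstr_K u (z : int) j : uK A *m u = q ^ z *: u ->
  uK A *m fstr u j = q ^ (z - j%:Z *+ 2) *: fstr u j.
Proof.
move=> Ku; elim: j => [|j IH] /=; first by rewrite mul0rn subr0.
rewrite -scalemxAr mulmxA uKF -scalemxAl -mulmxA IH -scalemxAr !scalerA.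
congr (_ *: _); rewrite -mulrA mulrC; congr (_ / _).
rewrite -[q ^- 2]/(q ^ (- 2%:Z)) -expfzDr //; congr (q ^ _); lia.
Qed.

Lemma uEF_comm (v : 'cV[K]_(udim A)) (z : int) : uK A *m v = q ^ z *: v ->
  uE A *m (uF A *m v) = uF A *m (uE A *m v) + qintz z *: v.
Proof.
move=> Kv; have KVv : uKV A *m v = q ^ (- z) *: v.
  rewrite -[v in RHS]mul1mx -(uKVK A) -mulmxA Kv -scalemxAr scalerA -expfzDr //.
  by rewrite addNr expr0z scale1r.
rewrite !mulmxA; apply/eqP; rewrite addrC -subr_eq -mulmxBl uEF -scalemxAl mulmxBl.
by rewrite Kv KVv -scalerBl scalerA /qintz mulrC.
Qed.

(** Moving [E] past [F] reduces the induction step to the identity [[j+1][z-j] + [z-2(j+1)] =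
    [j+2][z-j-1]]. *)
Lemma fstr_E u (z : int) j : uK A *m u = q ^ z *: u -> uE A *m u = 0 ->
  uE A *m fstr u j.+1 = qintz (z - j%:Z) *: fstr u j.
Proof.
move=> Ku Eu; elim: j => [|j IH]; rewrite [fstr u _.+1]/= -scalemxAr.
  rewrite (uEF_comm Ku) Eu mulmx0 add0r subr0 scalerA -qintz_nat.
  by rewrite /qintz -invr_expz expr1z mulfV // invr1 mul1r.
rewrite (uEF_comm (fstr_K j.+1 Ku)) IH -scalemxAr fstr_F scalerA -scalerDl scalerA.
congr (_ *: _); have nz : qint q j.+2 != 0 by rewrite qint_eq0.
apply: (mulfI nz); rewrite mulrA mulfV // mul1r -!qintz_nat /qintz.
have E1 : q ^ (j.+2%:Z) = q * q ^ (j.+1%:Z) by rewrite -!exprnP exprS.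
have E2 : q ^ (z - j%:Z) = q ^ (z - j.+1%:Z) * q.
  by rewrite -{3}[q]expr1z -expfzDr //; congr (q ^ _); lia.
have E3 : q ^ (z - j.+1%:Z *+ 2) = q ^ (z - j.+1%:Z) / q ^ (j.+1%:Z).
  by rewrite invr_expz -expfzDr //; congr (q ^ _); lia.
rewrite -!invr_expz E1 E2 E3.
have : q ^ (z - j.+1%:Z) != 0 by rewrite expfz_neq0.
have : q ^ (j.+1%:Z) != 0 by rewrite expfz_neq0.
have q2 : q ^+ 2 - 1 != 0 by rewrite subr_eq0 q_nroot.
move: (q ^ j.+1%:Z) (q ^ (z - j.+1%:Z)) => x y x0 y0.
by field; rewrite x0 y0 q0 -expr2 q2.
Qed.

(* Otherwise the next vector of the string would be a highest weight vector of
   negative weight, whose own string never vanishes; but [K] has finitely many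
   eigenvalues. *)
Lemma fstr_out u (m : nat) : uK A *m u = q ^ m%:Z *: u -> uE A *m u = 0 ->
  fstr u m.+1 = 0.
Proof.
move=> Ku Eu; apply/eqP; apply: contraT => w0; set w := fstr u m.+1 in w0.
have Kw := fstr_K m.+1 Ku; have Ew : uE A *m w = 0.
  by rewrite (fstr_E _ Ku Eu) subrr /qintz oppr0 subrr mul0r scale0r.
rewrite -/w in Kw; set z := m%:Z - _ in Kw.
have nz j : fstr w j != 0.
  elim: j => // j; apply: contra => /eqP h.
  have := fstr_E j Kw Ew; rewrite h mulmx0 => /esym/eqP.
  rewrite scaler_eq0 qintz_eq0 => /orP[/eqP|//]; rewrite /z; lia.
pose P := char_poly (uK A)^T.
have P0 : P != 0 by rewrite monic_neq0 ?char_poly_monic.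
pose rs := [seq q ^ (z - j%:Z *+ 2) | j <- iota 0 (udim A).+1].
have uniq_rs : uniq rs.
  rewrite map_inj_uniq ?iota_uniq // => i j /expqz_inj; lia.
have root_rs : all (root P) rs.
  apply/allP => _ /mapP[j _ ->]; rewrite /P -eigenvalue_root_char.
  apply/eigenvalueP; exists (fstr w j)^T; last by rewrite trmx_eq0.
  by rewrite -trmx_mul (fstr_K j Kw) linearZ.
have := max_poly_roots P0 root_rs uniq_rs.
by rewrite size_map size_iota size_char_poly ltnn.
Qed.

End FString.
End Strings.

(** The vectors are the columns of a square matrix, injective by freeness and hence invertible; the
    rows of the inverse are the coordinate functionals. *)
Lemma dual_family (K : fieldType) (D : nat) (T : eqType) (P : seq T) (h : T -> 'cV[K]_D) :
  uniq P -> size P = D ->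
  (forall c : T -> K, \sum_(p <- P) c p *: h p = 0 -> forall p, p \in P -> c p = 0) ->
  exists g : T -> 'rV[K]_D,
    (forall p p', p \in P -> p' \in P -> g p *m h p' = (p == p')%:R%:M) /\
    (forall v, v = \sum_(p <- P) (g p *m v) 0 0 *: h p).
Proof.
(* An empty [P] means [D = 0] and is treated apart, since it offers no default element for [nth]. *)
move=> uP; have [->|[p0 _]] : P = [::] \/ exists p0 : T, p0 \in P.
- by case: (P) => [|p0 P']; [left|right; exists p0; rewrite inE eqxx].
- move=> D0 _; exists (fun=> 0); split=> // v; apply/colP => i.
  by move: (leq_ltn_trans (leq0n i) (ltn_ord i)); rewrite -[X in (_ < X)%N]D0.
move=> sP free; pose M : 'M[K]_D := \matrix_(i, j) h (nth p0 P j) i 0.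
have sumP (F : T -> 'cV[K]_D) : \sum_(p <- P) F p = \sum_(j < D) F (nth p0 P j).
  by rewrite (big_nth p0) sP big_mkord.
have Mv (v : 'cV_D) : M *m v = \sum_(j < D) v j 0 *: h (nth p0 P j).
  by apply/colP => i; rewrite mxE summxE; apply: eq_bigr => j _; rewrite !mxE mulrC.
have injM (v : 'cV_D) : M *m v = 0 -> v = 0.
  pose c p := if insub (index p P) is Some j then v j 0 else 0.
  have cE (j : 'I_D) : c (nth p0 P j) = v j 0.
    by rewrite /c index_uniq ?sP // valK.
  move=> h0; have /free c0 : \sum_(p <- P) c p *: h p = 0.
    by rewrite sumP -[RHS]h0 Mv; apply: eq_bigr => j _; rewrite cE.
  by apply/colP => j; rewrite -cE c0 ?mxE // mem_nth ?sP.
have uM : M \in unitmx.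
  rewrite -unitmx_tr -row_free_unit -kermx_eq0; apply/rowV0P => u /sub_kermxP hu.
  by apply: trmx_inj; rewrite trmx0; apply: injM; rewrite -[M]trmxK -trmx_mul hu trmx0.
pose g p : 'rV[K]_D := if insub (index p P) is Some j then row j (invmx M) else 0.
have gE (j : 'I_D) : g (nth p0 P j) = row j (invmx M).
  by rewrite /g index_uniq ?sP // valK.
exists g; split=> [p p' pP p'P|v].
  have ip : (index p P < D)%N by rewrite -sP index_mem.
  have ip' : (index p' P < D)%N by rewrite -sP index_mem.
  rewrite -(nth_index p0 pP) (gE (Ordinal ip)).
  have -> : h p' = col (Ordinal ip') M by apply/colP => i; rewrite !mxE /= nth_index.
  rewrite colE -row_mul mulmxA mulVmx // mul1mx.
  apply/matrixP => i j; rewrite !ord1 !mxE -val_eqE /= eqxx andbT mulr1n.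
  rewrite nth_index //; congr (nat_of_bool _)%:R; apply/eqP/eqP => [e|->//].
  by rewrite -[LHS](nth_index p0 pP) e nth_index.
rewrite sumP -[LHS]mul1mx -(mulmxV uM) -mulmxA Mv; apply: eq_bigr => j _.
by rewrite gE -row_mul [row _ _ _ _]mxE.
Qed.

Section StringBasis.
Variables (K : fieldType) (q : K).
Hypotheses (q0 : q != 0) (q1 : q - q^-1 != 0).
Hypothesis q_nroot : forall n, (0 < n)%N -> q ^+ n != 1.

(** The image of the basis of [V_m] under some intertwiner. The vectors may all be zero, so strings
    are stable under homomorphisms ([string_hom]). *)
Record is_string (A : Uq_rep q) (m : nat) (h : nat -> 'cV[K]_(udim A)) : Prop := {
  str_E0 : uE A *m h 0%N = 0;
  str_E : forall j, uE A *m h j.+1 = qint q (m - j) *: h j;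
  str_F : forall j, uF A *m h j = qint q j.+1 *: h j.+1;
  str_K : forall j, uK A *m h j = q ^ (m%:Z - j%:Z *+ 2) *: h j;
  str_out : forall j, (m < j)%N -> h j = 0 }.

Lemma str_KV A m (h : nat -> 'cV[K]_(udim A)) j : is_string m h ->
  uKV A *m h j = q ^ (- (m%:Z - j%:Z *+ 2)) *: h j.
Proof.
move=> hs; rewrite -[h j in RHS]mul1mx -(uKVK A) -mulmxA (str_K hs) -scalemxAr.
by rewrite scalerA -expfzDr // addNr expr0z scale1r.
Qed.

Lemma fstr_string A m (u : 'cV[K]_(udim A)) :
  uK A *m u = q ^ m%:Z *: u -> uE A *m u = 0 -> is_string m (fstr u).
Proof.
move=> Ku Eu; have out j : (m < j)%N -> fstr u j = 0.
  elim: j => // j IH; rewrite ltnS leq_eqVlt => /predU1P[<-|/IH h].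
    exact: (fstr_out q0 q1 q_nroot Ku Eu).
  by rewrite /= h mulmx0 scaler0.
split=> // j.
- rewrite (fstr_E q0 q1 q_nroot _ Ku Eu); case: (leqP j m) => jm.
    by rewrite subzn // qintz_nat.
  by rewrite out // !scaler0.
- exact: fstr_F.
- exact: fstr_K.
Qed.

Section Free.
Variables (A : Uq_rep q) (S : eqType) (s : seq S) (m : S -> nat).
Variable (h : S -> nat -> 'cV[K]_(udim A)).

Definition Epow L : 'M[K]_(udim A) := iter L (mulmx^~ (uE A)) 1%:M.

Lemma Epow_string M (g : nat -> 'cV[K]_(udim A)) L j : is_string M g ->
  (j <= L)%N -> Epow L *m g j =
    if j == L then (\prod_(i < L) qint q (M - i)) *: g 0%N else 0.
Proof.
move=> hg; elim: L j => [|L IH] [|j] //= jL.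
- by rewrite mul1mx big_ord0 scale1r.
- by rewrite -mulmxA (str_E0 hg) mulmx0.
rewrite -mulmxA (str_E hg) -scalemxAr IH // eqSS; case: eqP => [->|]; last by rewrite scaler0.
by rewrite scalerA big_ord_recr /= mulrC.
Qed.

Hypothesis hs : forall t, t \in s -> is_string (m t) (h t).
Hypothesis hw_free : forall a : S -> K,
  \sum_(t <- s) a t *: h t 0%N = 0 -> forall t, t \in s -> a t = 0.

(* Applying the highest power of E that does not kill the combination turns it
   into a combination of the highest weight vectors. *)
Lemma string_free (c : S -> nat -> K) :
  \sum_(t <- s) \sum_(j < (m t).+1) c t j *: h t j = 0 ->
  forall t j, t \in s -> (j <= m t)%N -> c t j = 0.
Proof.
move=> c0; pose B := (\sum_(t <- s) (m t).+1)%N.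
have mB t : t \in s -> (m t < B)%N.
  by move=> ts; rewrite /B (big_rem t) //= leq_addr.
suff H k t j : t \in s -> (j <= m t)%N -> (B <= k + j)%N -> c t j = 0.
  by move=> t j ts jm; apply: (H B) => //; exact: leq_addr.
elim: k t j => [|k IH] t j ts jm; first by have := mB t ts; lia.
rewrite leq_eqVlt => /predU1P[Bk|]; last by rewrite addSn ltnS; exact: IH.
pose d t := \prod_(i < j) qint q (m t - i).
pose a t := if (j <= m t)%N then c t j * d t else 0.
have /hw_free a0 : \sum_(t <- s) a t *: h t 0%N = 0.
  rewrite -[RHS](mulmx0 _ (Epow j)) -[in RHS]c0 mulmx_sumr big_seq [RHS]big_seq.
  apply: eq_bigr => x xs; rewrite mulmx_sumr /a; case: ifP => jx.
    rewrite (bigD1 (Ordinal (jx : j < (m x).+1)%N)) //= -scalemxAr.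
    rewrite (Epow_string (hs xs)) // eqxx scalerA [X in _ + X]big1 ?addr0 // => i ij.
    rewrite -scalemxAr; case: (ltngtP i j) => hij.
    - by rewrite (Epow_string (hs xs) (ltnW hij)) (ltn_eqF hij) scaler0.
    - by rewrite IH ?scale0r //; [rewrite -ltnS | lia].
    - by rewrite -val_eqE /= hij eqxx in ij.
  rewrite scale0r big1 // => i _; rewrite -scalemxAr (Epow_string (hs xs)).
    by case: eqP => [e|]; rewrite ?scaler0 //; have := ltn_ord i; lia.
  by have := ltn_ord i; lia.
have := a0 t ts; rewrite /a jm => /eqP; rewrite mulf_eq0 => /orP[/eqP//|].
rewrite prodf_seq_eq0 => /hasP[i _]; rewrite (qint_eq0 q0 q1 q_nroot) /=.
by have := ltn_ord i; lia.
Qed.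

Definition str_index := [seq (t, j) | t <- s, j <- iota 0 (m t).+1].

Lemma sum_str_index (V : nmodType) (F : S * nat -> V) :
  \sum_(p <- str_index) F p = \sum_(t <- s) \sum_(j < (m t).+1) F (t, val j).
Proof.
rewrite big_allpairs_dep; apply: eq_bigr => t _.
by rewrite -[iota _ _]/(index_iota 0 (m t).+1) big_mkord.
Qed.

Lemma mem_str_index p : (p \in str_index) = (p.1 \in s) && (p.2 <= m p.1)%N.
Proof.
apply/allpairsPdep/andP => [[t [j [ts jm ->]]]|].
  by split=> //=; have : j \in iota 0 (m t).+1 := jm; rewrite mem_iota ltnS.
case: p => t j /= [ts jm]; exists t, j; split=> //.
by change (j \in iota 0 (m t).+1); rewrite mem_iota ltnS.
Qed.

(** The dual functionals [g] are part of the notion, so that coefficients can be read off and linear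
    maps defined on the basis. *)
Definition string_basis := [/\ uniq s, forall t, t \in s -> is_string (m t) (h t),
   (\sum_(t <- s) (m t).+1)%N = udim A
 & exists g : S * nat -> 'rV[K]_(udim A),
    (forall p p', p \in str_index -> p' \in str_index ->
       g p *m h p'.1 p'.2 = (p == p')%:R%:M) /\
    (forall v, v = \sum_(p <- str_index) (g p *m v) 0 0 *: h p.1 p.2)].

(** Independence is needed only for the highest weight vectors: [string_free] extends it to whole
    strings, and the dimension count then yields a basis. *)
Lemma hw_string_basis : uniq s -> (\sum_(t <- s) (m t).+1)%N = udim A -> string_basis.
Proof.
move=> us ss; split=> //; apply: (@dual_family _ _ _ _ (fun p => h p.1 p.2)).
- apply: allpairs_uniq_dep => // [t _|]; first exact: iota_uniq.
  by move=> [t j] [t' j'] /= _ _ [-> ->].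
- rewrite size_allpairs_dep sumnE big_map -ss.
  by apply: eq_bigr => t _; rewrite size_iota.
- move=> c; rewrite sum_str_index => /(string_free (c := fun t j => c (t, j))) H [t j].
  by rewrite mem_str_index => /andP[ts jm]; exact: H.
Qed.

End Free.


Section Standard.
Variable n : nat.
Local Notation Vn := (Vrep q0 q1 n).

Definition stdv (j : nat) : 'cV[K]_n.+1 := \col_i (i == j :> nat)%:R.

Lemma stdv_out j : (n < j)%N -> stdv j = 0.
Proof.
by move=> nj; apply/colP => i; rewrite !mxE; case: eqP => // e; have := ltn_ord i; lia.
Qed.

Lemma mul_stdv (M : 'M[K]_n.+1) (i j : 'I_n.+1) : (M *m stdv j) i 0 = M i j.
Proof.
rewrite mxE (bigD1 j) //= mxE eqxx mulr1 big1 ?addr0 // => l lj.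
by rewrite mxE val_eqE (negPf lj) mulr0.
Qed.

Lemma std_string : is_string (A := Vn) n stdv.
Proof.
have stdP (F : 'cV[K]_n.+1 -> nat -> 'cV[K]_n.+1) j : F 0 j = 0 ->
   ((j <= n)%N -> F (stdv j) j = 0) -> F (stdv j) j = 0.
  by move=> F0 F1; case: (leqP j n) => [/F1//|/stdv_out ->].
split.
- apply/colP => i; rewrite (mul_stdv _ i ord0) !mxE; by case: eqP.
- move=> j; apply/colP => i; case: (ltnP j n) => jn; last first.
    rewrite stdv_out // mulmx0 !mxE (_ : (n - j)%N = 0%N) ?qint0 ?mul0r //; lia.
  rewrite (mul_stdv _ i (Ordinal (jn : j.+1 < n.+1)%N)) !mxE /= eqSS subnSK //.
  by case: eqP => _; rewrite ?mulr1 ?mulr0.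
- move=> j; apply/colP => i; case: (leqP j n) => jn; last first.
    by rewrite !stdv_out // ?mulmx0 ?scaler0 //; lia.
  rewrite (mul_stdv _ i (Ordinal (jn : j < n.+1)%N)) !mxE /=.
  by case: eqP => _; rewrite ?mulr1 ?mulr0.
- move=> j; apply/colP => i; rewrite mul_diag_mx !mxE.
  by case: eqP => [->|_]; rewrite ?mulr0.
- exact: stdv_out.
Qed.

End Standard.
End StringBasis.
Arguments string_basis {K q} A {S} s m h.

Section TensorVectors.
Variable K : fieldType.

(** [u *t v] has [1 * 1] columns; the ascription converts it to a column vector. *)
Definition tensv D D' (u : 'cV[K]_D) (v : 'cV[K]_D') : 'cV[K]_(D * D') := u *t v.

Lemma mul_tensv D D' (M : 'M[K]_D) (N : 'M[K]_D') u v :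
  (M *t N) *m tensv u v = tensv (M *m u) (N *m v).
Proof. exact: (@tensmx_mul K D D D' D' 1 1). Qed.

Lemma tensvZl D D' a (u : 'cV[K]_D) (v : 'cV[K]_D') : tensv (a *: u) v = a *: tensv u v.
Proof. exact: (tensZl a u v). Qed.

Lemma tensvZr D D' a (u : 'cV[K]_D) (v : 'cV[K]_D') : tensv u (a *: v) = a *: tensv u v.
Proof. exact: (tensZr a u v). Qed.

Lemma tensv0l D D' (v : 'cV[K]_D') : tensv (0 : 'cV[K]_D) v = 0.
Proof. by rewrite -[0 in LHS](scale0r 0) tensvZl scale0r. Qed.

Lemma tensv0r D D' (u : 'cV[K]_D) : tensv u (0 : 'cV[K]_D') = 0.
Proof. by rewrite -[0 in LHS](scale0r 0) tensvZr scale0r. Qed.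

Definition tensrv D D' (g : 'rV[K]_D) (e : 'rV[K]_D') : 'rV[K]_(D * D') := g *t e.

Lemma mul_tensrv D D' (g : 'rV[K]_D) (e : 'rV[K]_D') u v :
  (tensrv g e *m tensv u v) 0 0 = (g *m u) 0 0 * (e *m v) 0 0.
Proof.
have -> : tensrv g e *m tensv u v = (g *m u) *t (e *m v) by exact: (@tensmx_mul K 1 D 1 D' 1 1).
by rewrite mxE !ord1.
Qed.

End TensorVectors.

Section ClebschGordan.
Variables (K : fieldType) (q : K).
Hypotheses (q0 : q != 0) (q1 : q - q^-1 != 0).
Hypothesis q_nroot : forall n, (0 < n)%N -> q ^+ n != 1.
Variables (A : Uq_rep q) (n : nat).
Local Notation AV := (Uq_tens q0 A (Vrep q0 q1 n)).

(** Clebsch-Gordan coefficients, scaled to start with 1. In [E] applied to [cgv], the vector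
    [h j (x) v_(x-1-j)] gets the coefficient [cg (j+1) [M-j] + cg j q^(M-2j) [n-(x-1-j)]], and the
    recursion makes it vanish. *)
Fixpoint cg (M x i : nat) : K :=
  if i is j.+1 then
    - (cg M x j * q ^ (M%:Z - j%:Z *+ 2) * qint q (n - (x.-1 - j))) / qint q (M - j)
  else 1.

Definition cgv (M : nat) (h : nat -> 'cV[K]_(udim A)) (x : nat) : 'cV[K]_(udim AV) :=
  \sum_(i < x.+1) cg M x i *: tensv (h i) (stdv K n (x - i)).

Lemma cgv_E M h x : is_string M h -> (x <= M)%N -> uE AV *m cgv M h x = 0.
Proof.
move=> hs xM; rewrite /cgv mulmx_sumr.
have E u v : uE AV *m tensv u v = tensv (uE A *m u) v + tensv (uK A *m u) (VE q n *m v).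
  by rewrite /= /tE mulmxDl !mul_tensv mul1mx.
have std0 : VE q n *m stdv K n 0 = 0 := str_E0 (std_string q0 q1 n).
have stdE j : VE q n *m stdv K n j.+1 = qint q (n - j) *: stdv K n j :=
  str_E (std_string q0 q1 n) j.
under eq_bigr => i _ do rewrite -scalemxAr E scalerDr.
rewrite big_split /=; case: x xM => [|x] xM.
  by rewrite !big_ord1 (str_E0 hs) (std0) tensv0l tensv0r !scaler0 addr0.
(* [E (x) 1] kills the first term and [K (x) E] the last; after this shift the two sums cancel term
   by term. *)
rewrite big_ord_recl (str_E0 hs) tensv0l scaler0 add0r.
rewrite [X in _ + X]big_ord_recr /= (subnn x.+1) std0 tensv0r scaler0 addr0.
rewrite -big_split big1 // => i _.
have ix := ltn_ord i; rewrite /bump leq0n add1n !add0n subSS (str_E hs) (str_K hs) subSn -1?ltnS //.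
rewrite stdE !tensvZl tensvZr !scalerA /= -scalerDl.
rewrite mulfVK; last by rewrite (qint_eq0 q0 q1 q_nroot); lia.
by rewrite -mulrA addNr scale0r.
Qed.

Lemma cgv_K M h x : is_string M h -> (x <= minn M n)%N ->
  uK AV *m cgv M h x = q ^ (M + n - x.*2)%N%:Z *: cgv M h x.
Proof.
move=> hs xM; rewrite /cgv mulmx_sumr scaler_sumr; apply: eq_bigr => i _.
have ix := ltn_ord i; rewrite -scalemxAr [RHS]scalerA mulrC -scalerA; congr (_ *: _).
rewrite /= /tK mul_tensv (str_K hs) (str_K (std_string q0 q1 n)) tensvZl tensvZr scalerA.
rewrite -expfzDr //; congr (q ^ _ *: _); lia.
Qed.

Variables (s : seq (seq nat)) (m : seq nat -> nat).
Variable (h : seq nat -> nat -> 'cV[K]_(udim A)).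
Hypothesis sb : string_basis A s m h.

(** [rcons r x] names the highest weight vector at depth [x] in the product of string [r] with
    [V_n]. Over the tensor factors, entry [i] thus becomes the number of right endpoints in box
    [i]. *)
Definition cg_index := [seq rcons r x | r <- s, x <- iota 0 (minn (m r) n).+1].
Definition cg_weight (t : seq nat) := (m (take (size t).-1 t) + n - (last 0 t).*2)%N.
Definition cg_vect (t : seq nat) : nat -> 'cV[K]_(udim AV) :=
  fstr (A := AV) (cgv (m (take (size t).-1 t)) (h (take (size t).-1 t)) (last 0%N t)).

Lemma take_rcons (r : seq nat) x : take (size (rcons r x)).-1 (rcons r x) = r.
Proof. by rewrite size_rcons -cats1 take_size_cat. Qed.

Lemma cg_indexP t : reflect (exists r x, [/\ r \in s, (x <= minn (m r) n)%N & t = rcons r x])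
  (t \in cg_index).
Proof.
apply: (iffP allpairsPdep) => -[r [x [rs xm ->]]]; exists r, x; split=> //.
  by have : x \in iota 0 (minn (m r) n).+1 := xm; rewrite mem_iota ltnS.
by change (x \in iota 0 (minn (m r) n).+1); rewrite mem_iota ltnS.
Qed.

Lemma sum_cg (M : nat) : (\sum_(x < (minn M n).+1) (M + n - x.*2).+1 = M.+1 * n.+1)%N.
Proof.
(* The partial sums are [y (M + n + 2 - y)], symmetric in [M.+1] and [n.+1]: either value of [y]
   gives the product of the two. *)
have H y : (y <= (minn M n).+1)%N ->
    (\sum_(x < y) (M + n - x.*2).+1 + y * y = y * (M + n + 2))%N.
  elim: y => [|y IH] yM; first by rewrite big_ord0.
  rewrite big_ord_recr /=; have := IH (ltnW yM).
  have : (y <= M)%N by lia. have : (y <= n)%N by lia.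
  set S := (\sum_(i < y) _)%N; rewrite -!mul2n; nia.
have := H _ (leqnn _); set S := (\sum_(i < _) _)%N; rewrite /minn; case: ltnP => _; nia.
Qed.

(** The highest weight vectors are independent because of their leading terms: the functional dual
    to [h r 0 (x) v_x] is 1 on the vector named [rcons r x] and 0 on the others, as only the term
    [i = 0] of each [cgv] involves the top of a string. *)
Lemma cg_string_basis : string_basis AV cg_index cg_weight cg_vect.
Proof.
case: sb => us hs sz [g [gh _]].
apply: hw_string_basis => //.
- move=> t /cg_indexP[r [x [rs xm ->]]]; rewrite /cg_vect /cg_weight take_rcons last_rcons.
  apply: fstr_string => //; first exact: cgv_K (hs _ rs) xm.
  by apply: cgv_E (hs _ rs) _; lia.
- move=> a a0 t /cg_indexP[r [x [rs xm tE]]].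
  pose e : 'rV[K]_n.+1 := \row_j (j == x :> nat)%:R.
  have ee j : (j <= n)%N -> (e *m stdv K n j) 0 0 = (j == x)%:R.
    move=> jn; rewrite mxE (bigD1 (Ordinal (jn : (j < n.+1)%N))) //= !mxE eqxx mulr1.
    rewrite big1 ?addr0 // => l; rewrite -val_eqE !mxE /= => /negPf ->; exact: mulr0.
  have val t' : t' \in cg_index ->
      (tensrv (g (r, 0%N)) e *m cg_vect t' 0) 0 0 = (t' == t)%:R.
    move=> /cg_indexP[r' [x' [r's x'm ->]]].
    rewrite /cg_vect /= take_rcons last_rcons /cgv mulmx_sumr summxE big_ord_recl /=.
    rewrite scale1r mul_tensrv subn0 ee; last by lia.
    rewrite (gh (r, 0%N) (r', 0%N)) ?mem_str_index ?rs ?r's //.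
    rewrite big1 ?addr0 => [|i _].
      rewrite !mxE !eqxx mulr1n -natrM mulnb; congr (nat_of_bool _)%:R.
      by rewrite tE eqseq_rcons xpair_eqE eqxx andbT eq_sym; congr (_ && _).
    rewrite -scalemxAr mxE mul_tensrv /bump leq0n add1n (gh (r, 0%N) (r', i.+1)) ?mem_str_index ?rs ?r's //=.
      by rewrite xpair_eqE andbF !mxE mul0rn mul0r mulr0.
    by have := ltn_ord i; lia.
  have := congr1 (fun v => (tensrv (g (r, 0%N)) e *m v) 0 0) a0.
  have tI : t \in cg_index by apply/cg_indexP; exists r, x.
  rewrite /= mulmx0 [in RHS]mxE mulmx_sumr summxE big_seq.
  under eq_bigr => t' t'I do rewrite -scalemxAr mxE val //.
  rewrite -big_seq (big_rem t) //= eqxx mulr1 big1_seq ?addr0 // => t' /andP[_].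
  rewrite mem_rem_uniq ?inE => [/andP[/negPf -> _]|]; first by rewrite mulr0.
  apply: allpairs_uniq_dep => // [r1 _|]; first exact: iota_uniq.
  by move=> [r1 x1] [r' x'] /= _ _ /rcons_inj [-> ->].
- apply: allpairs_uniq_dep => // [r _|]; first exact: iota_uniq.
  by move=> [r x] [r' x'] /= _ _ /rcons_inj [-> ->].
- rewrite big_allpairs_dep -[RHS]/(udim A * n.+1)%N -sz big_distrl /=.
  apply: eq_bigr => r _; rewrite -sum_cg -(big_mkord xpredT (fun x => (m r + n - x.*2).+1)).
  by rewrite /index_iota subn0; apply: eq_bigr => x _; rewrite /cg_weight take_rcons last_rcons.
Qed.

End ClebschGordan.

(* [t i] is the number of right endpoints in box [i]: the boxes before [i] must
   contain enough vertices that are not right endpoints. *)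
Definition admissible (k : nat) (d t : nat -> nat) : bool :=
  [forall i : 'I_k, (t i <= d i)%N &&
    (\sum_(j < i.+1) t j + \sum_(j < i) t j <= \sum_(j < i) d j)%N].

Lemma admissibleS k d t : admissible k.+1 d t =
  [&& admissible k d t, t k <= d k &
    \sum_(j < k.+1) t j + \sum_(j < k) t j <= \sum_(j < k) d j]%N.
Proof.
apply/forallP/andP => [h|[/forallP h hk] i].
  split; last exact: (h ord_max).
  by apply/forallP => i; exact: (h (widen_ord (leqnSn k) i)).
have := ltn_ord i; rewrite ltnS leq_eqVlt => /predU1P[->//|ik].
exact: (h (Ordinal ik)).
Qed.

Lemma admissible0 d t : admissible 0 d t.
Proof. by apply/forallP => -[]. Qed.

Lemma eq_admissible k d d' t t' : (forall i, (i < k)%N -> d i = d' i) ->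
  (forall i, (i < k)%N -> t i = t' i) -> admissible k d t = admissible k d' t'.
Proof.
move=> hd ht; apply: eq_forallb => i; have ik := ltn_ord i.
rewrite hd // ht //; congr (_ && (_ + _ <= _)%N); apply: eq_bigr => j _.
- by rewrite ht //; exact: leq_trans (ltn_ord j) ik.
- by rewrite ht //; exact: ltn_trans (ltn_ord j) ik.
- by rewrite hd //; exact: ltn_trans (ltn_ord j) ik.
Qed.

Lemma sumn_nth (s : seq nat) : sumn s = (\sum_(j < size s) nth 0 s j)%N.
Proof. by rewrite sumnE (big_nth 0%N) big_mkord. Qed.

Definition adm_seq (d t : seq nat) :=
  (size t == size d) && admissible (size d) (nth 0%N d) (nth 0%N t).

Lemma adm_seq_rcons d n t x : adm_seq (rcons d n) (rcons t x) =
  [&& adm_seq d t, x <= n & sumn t + x + sumn t <= sumn d]%N.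
Proof.
rewrite /adm_seq !size_rcons eqSS; case: eqP => //= st.
rewrite admissibleS !nth_rcons st ltnn eqxx; congr [&& _, _ & _].
  by apply: eq_admissible => i ik; rewrite nth_rcons ?st ik.
rewrite big_ord_recr /= nth_rcons st ltnn eqxx !sumn_nth -st.
by congr (_ + _ + _ <= _)%N; apply: eq_bigr => j _; rewrite nth_rcons -?st ltn_ord.
Qed.

Section TensorPower.
Variables (K : fieldType) (q : K).
Hypotheses (q0 : q != 0) (q1 : q - q^-1 != 0).
Hypothesis q_nroot : forall n, (0 < n)%N -> q ^+ n != 1.
Local Notation V := (Vrep q0 q1).

Lemma Vrep_string_basis n :
  string_basis (V n) [:: [:: 0%N]] (fun=> n) (fun _ => stdv K n).
Proof.
apply: hw_string_basis => //; [move=> t _; exact: std_string | | by rewrite big_seq1].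
move=> a; rewrite big_seq1 => h t; rewrite inE => /eqP ->.
by have := congr1 (fun v : 'cV_n.+1 => v 0 0) h; rewrite !mxE /= mulr1.
Qed.

(** As [m r] is [sumn (x :: l)] minus twice [sumn r], the Clebsch-Gordan range [y <= minn (m r) n]
    is exactly the condition that admissibility adds for a new box. *)
Lemma tensor_string_basis x l :
  exists s m h, [/\ string_basis (foldl (Uq_tens q0) (V x) [seq V n | n <- l]) s m h,
    forall t, (t \in s) = adm_seq (x :: l) t
  & forall t, t \in s -> (m t + (sumn t).*2 = sumn (x :: l))%N].
Proof.
elim/last_ind: l => [|l n [s [m [h [sb sE mE]]]]].
  exists [:: [:: 0%N]], (fun=> x), (fun _ => stdv K x); split.
  - exact: Vrep_string_basis.
  - move=> t; rewrite inE; case/lastP: t => // t y.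
    rewrite -[[:: x]]/(rcons [::] x) adm_seq_rcons; case: t => [|z t]; last first.
      by rewrite /adm_seq /= eqseq_cons; case: t => [|? ?]; rewrite /= andbF.
    by rewrite /adm_seq admissible0 eqseq_cons /= addn0 add0n leqn0 andbT; case: eqP => [->|]; rewrite ?andbF ?leq0n.
  - by move=> t; rewrite inE => /eqP ->.
rewrite map_rcons foldl_rcons; exists (cg_index n s m), (cg_weight n m), (cg_vect q0 q1 (A := _) n m h).
split.
- exact: cg_string_basis.
- move=> t; apply/cg_indexP/idP => [[r [y [rs ym ->]]]|].
    rewrite -rcons_cons adm_seq_rcons -sE rs; have := mE r rs; lia.
  case/lastP: t => [|r y]; first by [].
  rewrite -rcons_cons adm_seq_rcons -sE => /and3P[rs yn h2].
  by exists r, y; split=> //; have := mE r rs; lia.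
- move=> t /cg_indexP[r [y [rs ym ->]]]; rewrite /cg_weight take_rcons last_rcons.
  rewrite -rcons_cons !sumn_rcons; have := mE r rs; lia.
Qed.

Lemma string_hom (A B : Uq_rep q) (g : 'M[K]_(udim B, udim A)) m h :
  Uq_Hom A B g -> is_string m h -> is_string (A := B) m (fun j => g *m h j).
Proof.
case=> gE gF gK _ hs; split.
- by rewrite mulmxA -gE -mulmxA (str_E0 hs) mulmx0.
- by move=> j; rewrite mulmxA -gE -mulmxA (str_E hs) -scalemxAr.
- by move=> j; rewrite mulmxA -gF -mulmxA (str_F hs) -scalemxAr.
- by move=> j; rewrite mulmxA -gK -mulmxA (str_K hs) -scalemxAr.
- by move=> j /(str_out hs) ->; rewrite mulmx0.
Qed.

(** Schur's lemma for strings: [E] kills only multiples of the top vector of [V_n], the weight of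
    that vector forces [m = n] unless it is zero, and [F] carries the scalar down the string. *)
Lemma string_Vrep n m (w : nat -> 'cV[K]_n.+1) : is_string (A := V n) m w ->
  exists c, (m != n -> c = 0) /\ forall j, w j = c *: stdv K n j.
Proof.
move=> ws; exists (w 0%N 0 0).
have w0 : w 0%N = w 0%N 0 0 *: stdv K n 0.
  apply/colP => i; rewrite !mxE; case: (unliftP ord0 i) => [i'|] ->; last by rewrite mulr1.
  rewrite lift0 mulr0; have := congr1 (fun v : 'cV_n.+1 => v (widen_ord (leqnSn n) i') 0) (str_E0 ws).
  rewrite /= !mxE (bigD1 (lift ord0 i')) //= big1 ?addr0.
    rewrite !mxE /= eqxx mulr1n => /eqP; rewrite mulf_eq0 (qint_eq0 q0 q1 q_nroot) /=.
    by move/eqP.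
  by move=> l; rewrite -val_eqE /= eq_sym !mxE /bump leq0n add1n => /negPf ->; rewrite mul0r.
split=> [mn|j].
  have := congr1 (fun v : 'cV_n.+1 => v 0 0) (str_K ws 0).
  rewrite /= mul_diag_mx !mxE !mul0rn !subr0 => /eqP; rewrite -subr_eq0 -mulrBl mulf_eq0.
  case/orP=> [|/eqP//]; rewrite subr_eq0 (inj_eq (expqz_inj q0 q_nroot)) => /eqP[h].
  by rewrite h eqxx in mn.
elim: j => [//|j IH]; have := str_F ws j.
rewrite IH -scalemxAr (str_F (std_string q0 q1 n)) scalerA mulrC -scalerA => h.
by apply: (scalerI _ (esym h)); rewrite (qint_eq0 q0 q1 q_nroot).
Qed.

End TensorPower.

(** * Points of a given type *)

Section CoordinateSubspaces.
Variables (F : finFieldType) (d : nat) (T : finType) (rk : T -> 'I_d).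
Hypothesis rk_bij : bijective rk.
Local Notation vT := 'rV[F]_d.
Implicit Types (S : {set T}) (x : vT).

Let rk_inj : injective rk := bij_inj rk_bij.

Definition coord_vec (v : T) : vT := delta_mx 0 (rk v).
(** Coordinates are indexed by a finite type through [rk], so that vertices of boxes can label them
    and subspaces become sets of vertices. *)
Definition coord_vs S : {vspace vT} := <<[seq coord_vec v | v <- enum S]>>%VS.

Lemma sum_coord x : x = \sum_v x 0 (rk v) *: coord_vec v.
Proof.
rewrite {1}(row_sum_delta x) (reindex rk) //; exact: onW_bij.
Qed.

Lemma mem_coord_vs S x : reflect (forall v, v \notin S -> x 0 (rk v) = 0) (x \in coord_vs S).
Proof.
apply: (iffP idP) => [xS v vS|h]; last first.
  rewrite (sum_coord x); apply: memv_suml => v _.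
  case: (boolP (v \in S)) => [vS|/h ->]; last by rewrite scale0r mem0v.
  by apply/memvZ/memv_span/mapP; exists v; rewrite ?mem_enum.
pose f : 'Hom(vT, 'rV[F]_1) := linfun (mulmxr (delta_mx (rk v) 0 : 'cV[F]_d)).
have fE (y : vT) : f y = y *m (delta_mx (rk v) 0) by rewrite lfunE.
have : x \in lker f.
  apply: subvP xS; apply/span_subvP => _ /mapP[u uS ->].
  rewrite memv_ker fE /coord_vec mul_delta_mx_cond; case: (rk u =P rk v) => [/rk_inj uv|]; rewrite ?mulr0n //.
  by rewrite -uv -mem_enum uS in vS.
by rewrite memv_ker fE -colE => /eqP/matrixP/(_ 0 0); rewrite !mxE.
Qed.

Lemma free_coord : free [seq coord_vec v | v <- enum T].
Proof.
set X := [seq _ | v <- _]; suff : basis_of fullv X by rewrite basisEfree => /and3P[].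
rewrite basisEdim size_map -cardE dimvf dim_matrix mul1r.
rewrite (bij_eq_card rk_bij) card_ord leqnn andbT; apply/subvP => x _.
rewrite (sum_coord x); apply: memv_suml => v _; apply/memvZ/memv_span/mapP.
by exists v; rewrite ?mem_enum.
Qed.

Lemma dim_coord_vs S : \dim (coord_vs S) = #|S|.
Proof.
rewrite cardE -(size_map coord_vec); apply/eqP.
apply: (@catl_free _ _ [seq coord_vec v | v <- enum (~: S)]).
rewrite -map_cat -(perm_free (perm_map _ (_ : perm_eq (enum T) _))) ?free_coord //.
rewrite -(perm_filterC (mem S)) !enumT perm_cat //=.
by rewrite /enum_mem; apply/permP => p; congr (count _ _); apply: eq_filter => v; rewrite /= inE.
Qed.

Lemma coord_vs_sub S S' : S \subset S' -> (coord_vs S <= coord_vs S')%VS.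
Proof.
move=> /subsetP SS'; apply/subvP => x /mem_coord_vs h; apply/mem_coord_vs => v vS'.
by apply: h; apply: contra vS'; exact: SS'.
Qed.

Lemma coord_vs_cap S S' : (coord_vs S :&: coord_vs S')%VS = coord_vs (S :&: S').
Proof.
apply/vspaceP => x; rewrite memv_cap; apply/andP/mem_coord_vs => [[/mem_coord_vs h1 /mem_coord_vs h2] v|h].
  by rewrite inE negb_and => /orP[/h1|/h2].
by split; apply/mem_coord_vs => v vS; apply: h; rewrite inE negb_and vS ?orbT.
Qed.

Lemma coord_vs0 : coord_vs finset.set0 = 0%VS.
Proof. by rewrite /coord_vs enum_set0 span_nil. Qed.

Lemma coord_vsT : coord_vs [set: T] = fullv.
Proof. by apply/vspaceP => x; rewrite memvf; apply/mem_coord_vs => v; rewrite inE. Qed.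

Variables (N : {set T}) (s : T -> T).
Hypothesis s_inj : {in ~: N &, injective s}.

(** A partial permutation of the coordinate vectors, zero on those of [N]; injectivity of [s] off
    [N] makes the kernel no larger than [coord_vs N]. *)
Definition coord_end : 'End(vT) := linfun (mulmxr
  (\matrix_(i, j) ([exists v, [&& v \notin N, rk v == i & rk (s v) == j]]%:R : F))).

Lemma coord_endE x : coord_end x = \sum_(v | v \notin N) x 0 (rk v) *: coord_vec (s v).
Proof.
rewrite lfunE /= {1}(sum_coord x) mulmx_suml [RHS]big_mkcond; apply: eq_bigr => v _.
rewrite -scalemxAl -rowE; case: ifPn => vN.
  congr (_ *: _); apply/rowP => j; rewrite !mxE eqxx /= eq_sym; congr (nat_of_bool _)%:R.
  apply/existsP/eqP => [[u /and3P[_ /eqP/rk_inj -> /eqP ->]]//|e].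
  by exists v; rewrite vN e !eqxx.
rewrite (_ : row _ _ = 0) ?scaler0 //; apply/rowP => j; rewrite !mxE.
case: existsP => // -[u /and3P[uN /eqP/rk_inj e _]]; by rewrite -e uN in vN.
Qed.

Lemma coord_end_coord x v : v \notin N -> (coord_end x) 0 (rk (s v)) = x 0 (rk v).
Proof.
move=> vN; rewrite coord_endE summxE (bigD1 v) //= !mxE !eqxx mulr1 big1 ?addr0 // => u /andP[uN uv].
rewrite !mxE eqxx /= (inj_eq rk_inj) (inj_in_eq s_inj) ?inE // eq_sym (negPf uv); exact: mulr0.
Qed.

Lemma lker_coord_end : lker coord_end = coord_vs N.
Proof.
apply/vspaceP => x; rewrite memv_ker; apply/eqP/mem_coord_vs => [h v vN|h].
  by rewrite -coord_end_coord // h mxE.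
by rewrite coord_endE big1 // => v /h ->; rewrite scale0r.
Qed.

Lemma coord_end_img S S' : (forall v, v \in S -> v \notin N -> s v \in S') ->
  (coord_end @: coord_vs S <= coord_vs S')%VS.
Proof.
move=> h; apply/subvP => _ /memv_imgP[x /mem_coord_vs xS ->].
rewrite coord_endE; apply: memv_suml => v vN; case: (boolP (v \in S)) => vS.
  by apply/memvZ/memv_span/mapP; exists (s v) => //; rewrite mem_enum h.
by rewrite xS // scale0r mem0v.
Qed.

Lemma limg_coord_end : limg coord_end = coord_vs (s @: ~: N).
Proof.
apply/eqP; rewrite eqEdim -{1}coord_vsT coord_end_img => [|v _ vN]; last first.
  by apply/imsetP; exists v; rewrite ?inE.
rewrite dim_coord_vs card_in_imset // -(leq_add2l #|N|) cardsC.
have := limg_ker_dim coord_end fullv; rewrite capfv lker_coord_end dim_coord_vs => ->.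
by rewrite dimvf dim_matrix mul1r (bij_eq_card rk_bij) card_ord leqnn.
Qed.

End CoordinateSubspaces.

Lemma exists_Mpt (F : finFieldType) d r w : (r <= w)%N -> (r + w <= d)%N ->
  exists x : Mpt F d, \dim (MW x) = w /\ \dim (limg (Mt x)) = r.
Proof.
move=> rw rwd; have idb : bijective (@id 'I_d) by exists id.
(* The last [r] coordinates are shifted onto the first [r] and the others are killed; [W] is spanned
   by the first [w], with [r <= w <= d - r]. *)
pose N := [set i : 'I_d | (i < d - r)%N]; pose W := [set i : 'I_d | (i < w)%N].
pose s (i : 'I_d) := insubd i (i - (d - r))%N.
have sE i : s i = (i - (d - r))%N :> nat.
  by rewrite val_insubd; case: ifP => //; have := ltn_ord i; lia.
have sinj : {in ~: N &, injective s}.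
  move=> i j; rewrite !inE -!leqNgt => iN jN /(congr1 val) /=; rewrite !sE => h.
  apply/val_inj => /=; lia.
pose t := coord_end F id N s.
have rt : limg t = coord_vs F id (s @: ~: N) by apply: limg_coord_end.
have kt : lker t = coord_vs F id N by apply: lker_coord_end.
have xM : inM (coord_vs F id W, t).
  rewrite /inM /= rt kt !coord_vs_sub //; apply/subsetP => i; rewrite !inE; first lia.
  move=> /imsetP[j + ->]; rewrite !inE sE -leqNgt; have := ltn_ord j.
  by move: (nat_of_ord j) => {}j; clear -rw rwd; lia.
exists (Sub _ xM); rewrite /MW /Mt !SubK /=; split.
  by rewrite dim_coord_vs // card_ord_lt //; lia.
rewrite rt dim_coord_vs // card_in_imset //.
have := cardsC N; rewrite card_ord_lt ?card_ord; lia.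
Qed.

Section FlagAlpha.
Variables (F : finFieldType) (k d : nat) (D : vflag F k d).
Implicit Types X Y : {vspace 'rV[F]_d}.
Hypotheses (D0 : D ord0 = 0%VS) (Dmon : forall i, (vflo D i <= vfhi D i)%VS).

Lemma tnth_alpha X i : tnth (alpha X D) i = (\dim (X :&: vfhi D i) - \dim (X :&: vflo D i))%N.
Proof. by rewrite tnth_mktuple. Qed.

Lemma sum_alpha X (i : 'I_k.+1) :
  (\sum_(j < k | (j < i)%N) tnth (alpha X D) j)%N = \dim (X :&: D i).
Proof.
case: i => m mk /=; elim: m mk => [|m IH] mk.
  have -> : Ordinal mk = ord0 by exact: val_inj.
  by rewrite big_pred0 // D0 capv0 dimv0.
have mk' : (m < k)%N by rewrite -ltnS.
rewrite (bigD1 (Ordinal mk')) //= (eq_bigl (fun j : 'I_k => (j < m)%N)) => [|j].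
  rewrite (IH (ltnW mk)) tnth_alpha.
  have -> : vflo D (Ordinal mk') = D (Ordinal (ltnW mk)) by congr (D _); apply/val_inj.
  have -> : D (Ordinal mk) = vfhi D (Ordinal mk') by congr (D _); apply/val_inj.
  rewrite subnK // dimvS // capvS //.
  have -> : D (Ordinal (ltnW mk)) = vflo D (Ordinal mk') by congr (D _); apply/val_inj.
  exact: Dmon.
by rewrite -val_eqE /= ltnS; lia.
Qed.

(** [X :&: vfhi D i] meets [Y :&: vflo D i] exactly in [X :&: vflo D i], so the graded piece of [X]
    embeds in that of [Y]. *)
Lemma leq_alpha X Y i : (X <= Y)%VS -> (tnth (alpha X D) i <= tnth (alpha Y D) i)%N.
Proof.
move=> XY; rewrite !tnth_alpha.
have h := dimv_sum_cap (X :&: vfhi D i) (Y :&: vflo D i).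
have E : (X :&: vfhi D i :&: (Y :&: vflo D i) = X :&: vflo D i)%VS.
  apply/vspaceP => x; rewrite !memv_cap; apply/idP/idP => [/and3P[/andP[-> _] _ ->]//|/andP[xX xl]].
  by rewrite xX xl (subvP XY) // (subvP (Dmon i)).
have S : (X :&: vfhi D i + Y :&: vflo D i <= Y :&: vfhi D i)%VS.
  by rewrite subv_add !capvS.
rewrite E in h; have := dimvS S; lia.
Qed.

Lemma sumn_alpha X : D ord_max = fullv -> sumn (alpha X D) = \dim X.
Proof.
move=> Dm; rewrite -[in RHS](capvf X) -Dm -sum_alpha sumnE big_tuple.
by apply: eq_bigl => j; rewrite ltn_ord.
Qed.

End FlagAlpha.

Section TagMatching.
Variables (k : nat) (dd : k.-tuple nat).
Local Notation V := (vert dd).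

Definition vtag (v : V) : nat := tag v.

Lemma sorted_vtag (P : pred V) : sorted leq [seq vtag v | v <- verts dd & P v].
Proof.
apply: pairwise_sorted; rewrite pairwise_map.
apply: (@sub_pairwise _ (@vlt k dd)) => [u v|].
  by rewrite /vlt /= => /orP[/ltnW//|/andP[/eqP h _]]; rewrite /vtag h.
exact: subseq_pairwise (filter_subseq _ _) (pairwise_verts dd).
Qed.

Lemma count_verts (P : pred V) : count P (verts dd) = #|[set v | P v]|.
Proof.
have /permP -> : perm_eq (verts dd) (enum {: V}).
  by apply: uniq_perm; rewrite ?uniq_verts ?enum_uniq // => v; rewrite mem_verts mem_enum.
by rewrite -sum1_count big_enum_cond /= sum1dep_card.
Qed.

(* Match the elements of [A] with those of [B] in increasing order. *)
Lemma tag_matching (A B : {set V}) : #|A| = #|B| ->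
  (forall i : 'I_k, #|[set v in A | (tag v <= i)%N]| <= #|[set v in B | (tag v < i)%N]|)%N ->
  exists s : V -> V, [/\ {in A &, injective s}, s @: A = B &
    forall v, v \in A -> (tag (s v) < tag v)%N].
Proof.
move=> AB le; pose LA := [seq v <- verts dd | v \in A]; pose LB := [seq v <- verts dd | v \in B].
have memA v : (v \in LA) = (v \in A) by rewrite mem_filter mem_verts andbT.
have memB v : (v \in LB) = (v \in B) by rewrite mem_filter mem_verts andbT.
have sizeE (S : {set V}) : size [seq v <- verts dd | v \in S] = #|S|.
  by rewrite size_filter count_verts; apply: eq_card => v; rewrite inE.
have idx v : v \in A -> (index v LA < size LB)%N.
  by move=> vA; rewrite sizeE -AB -sizeE index_mem memA.
pose s v := nth v LB (index v LA).
have sB v : v \in A -> s v \in B by move=> vA; rewrite -memB mem_nth ?idx.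
have s_inj : {in A &, injective s}.
  move=> u v uA vA; rewrite /s (set_nth_default v) ?idx // => /eqP.
  rewrite nth_uniq ?idx ?filter_uniq ?uniq_verts // => /eqP e.
  by rewrite -(nth_index u (_ : u \in LA)) ?memA // e nth_index ?memA.
exists s; split=> //.
  apply/eqP; rewrite eqEcard card_in_imset // AB leqnn andbT.
  by apply/subsetP => _ /imsetP[v vA ->]; exact: sB.
move=> v vA; have vL : (index v LA < size LA)%N by rewrite index_mem memA.
rewrite -[nat_of_ord (tag (s v))]/(vtag (s v)) /s -(nth_map _ 0%N vtag) ?idx //.
have cntE (S : {set V}) (P : pred nat) :
    count P [seq vtag u | u <- verts dd & u \in S] = #|[set u in S | P (vtag u)]|.
  rewrite count_map count_filter count_verts; apply: eq_card => u.
  by rewrite !inE /= andbC.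
(* In a list sorted by box, the position of [v] is below the number of entries with box at most that
   of [v]. The hypothesis bounds this by the number of elements of [B] in earlier boxes, so the
   partner of [v] is one of these. *)
have h1 : (index v LA < count (fun x => x <= vtag v)%N [seq vtag u | u <- LA])%N.
  rewrite ltnNge; apply/negP => h.
  have := @nth_count_gt _ nat (vtag v) 0%N _ (index v LA) (sorted_vtag _).
  move=> /(_ (fun v => v \in A)); rewrite size_map h vL => /(_ isT).
  by rewrite (nth_map v) // nth_index ?memA // ltxx.
apply: (@nth_count_lt _ nat (vtag v) 0%N _ (index v LA) (sorted_vtag (fun v => v \in B))).
by apply: leq_trans h1 _; rewrite !cntE; exact: le.
Qed.

End TagMatching.

Section PointTypes.
Variables (k : nat) (dd : k.-tuple nat).
Local Notation V := (vert dd).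

Lemma card_vert_total : #|{: V}| = sumn dd.
Proof.
rewrite -cardsT (_ : setT = [set v : V | predT (tag v) && predT (tagged v)]).
  rewrite (card_vert predT (fun _ => predT)) sumnE big_tuple; apply: eq_bigr => i _.
  by rewrite -[RHS]card_ord -cardsT; apply: eq_card => x; rewrite !inE.
by apply/setP => v; rewrite !inE.
Qed.

Definition vrank (v : V) : 'I_(sumn dd) := cast_ord card_vert_total (enum_rank v).

Lemma vrank_bij : bijective vrank.
Proof.
exists (fun i => enum_val (cast_ord (esym card_vert_total) i)) => [v|i].
  by rewrite cast_ordK enum_rankK.
by rewrite /vrank enum_valK cast_ordKV.
Qed.

Section TypeOf.
Variables (F : finFieldType) (y : Tpt F dd).
Local Notation D := (Tflag y).
Local Notation t := (Mt (Tproj y)).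
Local Notation W := (MW (Tproj y)).

Lemma Tpt0 : D ord0 = 0%VS.
Proof. by have /and3P[/eqP] := valP y. Qed.
Lemma Tpt_max : D ord_max = fullv.
Proof. by have /and3P[_ /eqP] := valP y. Qed.
Lemma Tpt_mon i : (vflo D i <= vfhi D i)%VS.
Proof. by have /and3P[_ _ /forallP/(_ i)/and3P[]] := valP y. Qed.
Lemma Tpt_dim i : \dim (vfhi D i) = (\dim (vflo D i) + tnth dd i)%N.
Proof. by have /and3P[_ _ /forallP/(_ i)/and3P[_ /eqP]] := valP y. Qed.
Lemma Tpt_img i : (t @: vfhi D i <= vflo D i)%VS.
Proof. by have /and3P[_ _ /forallP/(_ i)/and3P[]] := valP y. Qed.
Lemma Mpt_im d (x : Mpt F d) : (limg (Mt x) <= MW x)%VS.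
Proof. by have /andP[] := valP x. Qed.
Lemma Mpt_ker d (x : Mpt F d) : (MW x <= lker (Mt x))%VS.
Proof. by have /andP[] := valP x. Qed.

Local Notation al X := (alpha X D).

Lemma alpha_full i : tnth (al fullv) i = tnth dd i.
Proof. by rewrite tnth_alpha !capfv Tpt_dim addKn. Qed.

Lemma alpha_sum_lo (X : {vspace 'rV[F]_(sumn dd)}) (i : 'I_k) :
  (\sum_(j < k | j < i) tnth (al X) j)%N = \dim (X :&: vflo D i).
Proof. exact: (sum_alpha Tpt0 Tpt_mon X (widen_ord (leqnSn k) i)). Qed.

Lemma alpha_sum_hi (X : {vspace 'rV[F]_(sumn dd)}) (i : 'I_k) :
  (\sum_(j < k | j <= i) tnth (al X) j)%N = \dim (X :&: vfhi D i).
Proof. exact: (sum_alpha Tpt0 Tpt_mon X (lift ord0 i)). Qed.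

(** The left side is the dimension of [t @: vfhi D i], a subspace of [limg t :&: vflo D i]. In
    [exists_Tpt] this is the condition under which the matching exists. *)
Lemma alpha_ker_im (i : 'I_k) : (\sum_(j < k | j <= i) (tnth dd j - tnth (al (lker t)) j) <=
  \sum_(j < k | j < i) tnth (al (limg t)) j)%N.
Proof.
rewrite sumnB => [|j _]; last by rewrite -alpha_full leq_alpha ?subvf //; exact: Tpt_mon.
rewrite -(eq_bigr _ (fun j _ => alpha_full j)).
rewrite !alpha_sum_hi alpha_sum_lo capfv capvC.
rewrite -(limg_ker_dim t (vfhi D i)) addKn.
by apply: dimvS; rewrite subv_cap Tpt_img limgS ?subvf.
Qed.

Lemma sum_alpha_ker_im : (\sum_j (tnth dd j - tnth (al (lker t)) j) =
  \sum_j tnth (al (limg t)) j)%N.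
Proof.
rewrite sumnB => [|j _]; last by rewrite -alpha_full leq_alpha ?subvf //; exact: Tpt_mon.
have sumE (a : k.-tuple nat) : (\sum_j tnth a j)%N = sumn a by rewrite sumnE big_tuple.
rewrite !sumE !(sumn_alpha Tpt0 Tpt_mon _ Tpt_max).
have := limg_ker_dim t fullv; rewrite capfv dimvf dim_matrix mul1r => h.
by rewrite -[X in (X - _)%N]h addKn.
Qed.

End TypeOf.

(** A model over [F']: vertices index coordinates, the flag is filled box by box, and [W], image and
    kernel are spanned by the first [w_i], [r_i] and [n_i] vertices of each box. The map sends the
    vertices outside the kernel to those of the image, each into an earlier box, by
    [tag_matching]. *)
Lemma exists_Tpt (F F' : finFieldType) (y : Tpt F dd) : exists y' : Tpt F' dd,
  [/\ alpha (MW (Tproj y')) (Tflag y') = alpha (MW (Tproj y)) (Tflag y),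
      alpha (limg (Mt (Tproj y'))) (Tflag y') = alpha (limg (Mt (Tproj y))) (Tflag y)
    & alpha (lker (Mt (Tproj y'))) (Tflag y') = alpha (lker (Mt (Tproj y))) (Tflag y)].
Proof.
set w := alpha (MW _) _; set r := alpha (limg _) _; set n := alpha (lker _) _.
pose first (a : k.-tuple nat) := [set v : V | (tagged v < tnth a (tag v))%N].
have nd i : (tnth n i <= tnth dd i)%N.
  by rewrite -(alpha_full y) leq_alpha ?subvf //; exact: Tpt_mon.
have rw i : (tnth r i <= tnth w i)%N by rewrite leq_alpha ?Mpt_im //; exact: Tpt_mon.
have wn i : (tnth w i <= tnth n i)%N by rewrite leq_alpha ?Mpt_ker //; exact: Tpt_mon.
have card_first (a : k.-tuple nat) (P : pred nat) : (forall i, tnth a i <= tnth dd i)%N ->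
    #|[set v in first a | P (tag v)]| = (\sum_(i < k | P i) tnth a i)%N.
  move=> ad; rewrite (eq_bigr (fun i : 'I_k => #|[set x : 'I_(tnth dd i) | (x < tnth a i)%N]|)) => [|i _].
    rewrite -(card_vert (fun i : 'I_k => P i) (fun i x => (x < tnth a i)%N)).
    by apply: eq_card => v; rewrite !inE andbC.
  by rewrite card_ord_lt.
have card_compl (P : pred nat) :
    #|[set v in ~: first n | P (tag v)]| = (\sum_(i < k | P i) (tnth dd i - tnth n i))%N.
  rewrite (eq_bigr (fun i : 'I_k => #|[set x : 'I_(tnth dd i) | (tnth n i <= x)%N]|)) => [|i _].
    rewrite -(card_vert (fun i : 'I_k => P i) (fun i x => (tnth n i <= x)%N)).
    by apply: eq_card => v; rewrite !inE -leqNgt andbC.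
  by rewrite card_ord_geq.
have rd i : (tnth r i <= tnth dd i)%N by exact: leq_trans (rw i) (leq_trans (wn i) (nd i)).
have wd i : (tnth w i <= tnth dd i)%N by exact: leq_trans (wn i) (nd i).
have [||s [sinj sI stag]] := @tag_matching _ _ (~: first n) (first r).
- have := card_first r predT rd; have := card_compl predT.
  have setE (A : {set V}) : [set v in A | predT (tag v)] = A by apply/setP => v; rewrite !inE andbT.
  by rewrite !setE => -> ->; exact: sum_alpha_ker_im.
- move=> i; rewrite (card_compl (fun j => j <= i)%N) (card_first r (fun j => j < i)%N rd).
  exact: alpha_ker_im.
pose t' := coord_end F' vrank (first n) s.
have kt : lker t' = coord_vs F' vrank (first n) by apply: lker_coord_end => //; exact: vrank_bij.
have rt : limg t' = coord_vs F' vrank (first r).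
  by rewrite -sI; apply: limg_coord_end => //; exact: vrank_bij.
have firstS (a b : k.-tuple nat) : (forall i, tnth a i <= tnth b i)%N -> first a \subset first b.
  by move=> ab; apply/subsetP => v; rewrite !inE => h; exact: leq_trans h (ab _).
have sub := coord_vs_sub F' vrank_bij.
have xM : inM (coord_vs F' vrank (first w), t') by rewrite /inM /= rt kt !sub ?firstS.
pose box m := [set v : V | (tag v < m)%N].
pose D' : vflag F' k (sumn dd) := [ffun i : 'I_k.+1 => coord_vs F' vrank (box i)].
have cbox m : #|box m| = (\sum_(j < k | j < m) tnth dd j)%N.
  rewrite -(card_first dd (fun j => j < m)%N) //.
  by apply: eq_card => v; rewrite !inE ltn_ord.
have hiE i : vfhi D' i = coord_vs F' vrank (box i.+1) by rewrite /vfhi ffunE lift0.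
have loE i : vflo D' i = coord_vs F' vrank (box i) by rewrite /vflo ffunE.
have alE (a : k.-tuple nat) : (forall i, tnth a i <= tnth dd i)%N ->
    alpha (coord_vs F' vrank (first a)) D' = a.
  move=> ad; apply: eq_from_tnth => i; rewrite tnth_alpha hiE loE !(coord_vs_cap F' vrank_bij).
  rewrite !(dim_coord_vs F' vrank_bij).
  have E m : #|first a :&: box m| = (\sum_(j < k | j < m) tnth a j)%N.
    by rewrite -(card_first a (fun j => j < m)%N ad); apply: eq_card => v; rewrite !inE.
  rewrite !E (bigD1 i) //= (eq_bigl (fun j : 'I_k => j < i)%N) ?addnK // => j.
  by rewrite -val_eqE /= ltnS; lia.
have xT : @inT F' k dd (D', Sub _ xM : Mpt F' (sumn dd)).
  apply/and3P; split=> /=.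
  - rewrite ffunE (_ : box _ = finset.set0) ?coord_vs0 ?eqxx //.
  - rewrite ffunE (_ : box _ = setT) ?(coord_vsT _ vrank_bij) ?eqxx //.
    by apply/setP => v; rewrite !inE /= ltn_ord.
  apply/forallP => i; rewrite hiE loE; apply/and3P; split.
  - by apply: sub; apply/subsetP => v; rewrite !inE; exact: ltnW.
  - rewrite !(dim_coord_vs F' vrank_bij) !cbox (bigD1 i) //= addnC; apply/eqP; congr (_ + _)%N.
    by apply: eq_bigl => j; rewrite -val_eqE /= ltnS; lia.
  - rewrite /Mt SubK /=; apply: coord_end_img => //; first exact: vrank_bij.
    move=> v; rewrite !inE ltnS => vi vN; apply: leq_trans vi; apply: stag.
    by rewrite inE inE.
exists (Sub _ xT); rewrite /Tproj /Tflag /MW /Mt !SubK /= kt rt !alE //.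
Qed.

End PointTypes.

From mathcomp Require Import boolp classical_sets functions reals.

(** * Evaluation of generic counts *)

Section Generic.
Variable R : realType.
Local Notation K := (Cq R).

Lemma Cq_natr_inj : injective (fun n : nat => n%:R : K).
Proof.
suff H (m n : nat) : (m <= n)%N -> m%:R = n%:R :> K -> m = n.
  by move=> m n h; case/orP: (leq_total m n) => mn; [exact: H | apply/esym/H].
move=> mn /eqP; rewrite eq_sym -subr_eq0 -natrB // => h.
have : (tofrac ((n - m)%:R : {poly R[i]})) == 0 by rewrite rmorph_nat.
rewrite tofrac_eq0 -polyC_natr polyC_eq0 pnatr_eq0; lia.
Qed.

Lemma qv_nroot n : (0 < n)%N -> qv R ^+ n != 1.
Proof.
move=> n0; apply/negP => h; have : (tofrac ('X^n : {poly R[i]})) == tofrac 1.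
  by rewrite rmorphXn rmorph1.
rewrite tofrac_eq => /eqP/(congr1 (fun p : {poly R[i]} => size p)).
by rewrite size_polyXn size_poly1 => -[]; lia.
Qed.

(** The value is the polynomial [P1 \Po 'X^2] in the variable [q] itself, and composing with a
    nonconstant polynomial loses nothing. *)
Lemma horner_qv_neq0 (P : {poly int}) : P != 0 ->
  (map_poly (intr : int -> K) P).[qv R ^+ 2] != 0.
Proof.
move=> P0.
pose C := R[i]; pose P1 : {poly C} := map_poly intr P.
have -> : (map_poly (intr : int -> K) P).[qv R ^+ 2] = tofrac (P1 \Po 'X^2).
  have -> : map_poly (intr : int -> K) P = map_poly (@tofrac {poly C}) (map_poly polyC P1).
    rewrite -!map_poly_comp; apply: eq_map_poly => z /=.
    by rewrite !rmorph_int.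
  have -> : qv R ^+ 2 = tofrac ('X^2 : {poly C}) by rewrite rmorphXn.
  by rewrite horner_map.
rewrite tofrac_eq0 comp_poly_eq0 ?size_polyXn //.
rewrite map_poly_eq0_id0 // intr_eq0 lead_coef_eq0 //.
Qed.

(** The polynomial chosen by [xget] agrees with [P] at unboundedly many cardinalities, hence equals
    it. *)
Lemma generic_eq (X I : Type) (card : X -> nat) (type : X -> I) (s : X -> K) (x : X)
    (P : {poly K}) :
  (forall y, type y = type x -> s y = P.[(card y)%:R]) ->
  (forall N, exists y, type y = type x /\ (N < card y)%N) ->
  generic card type s x = P.[qv R ^+ 2].
Proof.
move=> sP unb; rewrite /generic; set A := (X in xget _ X).
have AP : A P by [].
have := xgetPex 0 (ex_intro _ P AP); set P' := xget _ _ => AP'.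
suff -> : P' = P by [].
apply/eqP; rewrite -subr_eq0; apply: contraT => D0; set D := P' - P in D0.
have rootD y : type y = type x -> root D (card y)%:R.
  by move=> ty; rewrite /root hornerD hornerN -sP // -AP' // subrr.
(* Taking each new cardinality beyond all earlier ones produces as many distinct roots as [size D],
   one more than a nonzero [D] can have. *)
have [rs [/andP[urs rrs] srs]] : exists rs : seq nat,
    uniq rs && all (fun m => root D m%:R) rs /\ size rs = size D.
  elim: (size D) => [|n [rs [/andP[urs rrs] srs]]]; first by exists [::].
  have [y [ty yN]] := unb (\max_(m <- rs) m).
  exists (card y :: rs); rewrite /= urs rrs srs (rootD _ ty) !andbT; split=> //.
  apply/negP => yrs; move: yN; rewrite ltnNge => /negP; apply.
  by rewrite (big_rem _ yrs) /= leq_maxl.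
have := max_poly_roots D0 (_ : all (root D) [seq m%:R | m <- rs]).
rewrite all_map rrs (map_inj_uniq Cq_natr_inj) urs size_map srs ltnn.
by move=> /(_ isT isT).
Qed.

Definition FF2 (n : nat) : fforder := @FFOrder 2 n.+1 isT isT.

Lemma card_GF s : #|GF s| = (ffchar s ^ ffdeg s)%N.
Proof. exact: (s2valP' (PrimePowerField (ffchar_prime s) (ffdeg_gt0 s))). Qed.

Lemma card_FF2 n : (n < #|GF (FF2 n)|)%N.
Proof. by rewrite card_GF /=; exact: leq_trans (ltn_expl n _) (leq_pexp2l _ _). Qed.

End Generic.

Section PointCounts.
Variable F : finFieldType.

(** Over a fixed [t] a point is just its [W]. The predicate stays abstract to serve both [E] and
    [F]. *)
Lemma card_Mpt_above d (x : Mpt F d) (P : pred {vspace 'rV[F]_d}) :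
  #|[set y : Mpt F d | (Mt y == Mt x) && P (MW y)]| =
  #|[set U : {vspace 'rV[F]_d} | [&& (limg (Mt x) <= U)%VS, (U <= lker (Mt x))%VS & P U]]|.
Proof.
rewrite -(@card_in_imset _ _ (@MW F d)); last first.
  move=> y z; rewrite !inE => /andP[/eqP hy _] /andP[/eqP hz _] h.
  apply/val_inj; move: hy hz h; rewrite /Mt /MW.
  by case: (val y) (val z) => [? ?] [? ?] /= -> -> ->.
apply: eq_card => U; rewrite [RHS]inE; apply/imsetP/and3P => [[y + ->]|[h1 h2 PU]].
  by rewrite inE => /andP[/eqP h ->]; rewrite -h Mpt_im Mpt_ker.
have UM : inM (U, Mt x) by rewrite /inM h1 h2.
by exists (Sub _ UM); rewrite ?inE /MW /Mt SubK //= eqxx.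
Qed.

Lemma card_Tpt_above k (dd : k.-tuple nat) (x : Tpt F dd) (P : pred {vspace 'rV[F]_(sumn dd)}) :
  #|[set y : Tpt F dd | [&& Tflag y == Tflag x, Mt (Tproj y) == Mt (Tproj x) & P (MW (Tproj y))]]| =
  #|[set U : {vspace 'rV[F]_(sumn dd)} |
     [&& (limg (Mt (Tproj x)) <= U)%VS, (U <= lker (Mt (Tproj x)))%VS & P U]]|.
Proof.
rewrite -card_Mpt_above -(@card_in_imset _ _ (@Tproj F k dd)); last first.
  move=> y z; rewrite !inE => /and3P[/eqP hy _ _] /and3P[/eqP hz _ _] h.
  apply/val_inj; move: hy hz h; rewrite /Tproj /Tflag.
  by case: (val y) (val z) => [? ?] [? ?] /= -> -> ->.
apply: eq_card => u; rewrite [RHS]inE; apply/imsetP/andP => [[y + ->]|[/eqP h PU]].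
  by rewrite inE => /and3P[].
have uT : @inT F k dd (Tflag x, u) by have := valP x; rewrite /inT /= h.
by exists (Sub _ uT); rewrite ?inE /Tflag /Tproj SubK //= h !eqxx.
Qed.

Section Steps.
Variables (d : nat) (x : Mpt F d).
Local Notation W := (MW x).

Definition above : pred {vspace 'rV[F]_d} :=
  fun U => (W <= U)%VS && (\dim U == (\dim W).+1).
Definition below : pred {vspace 'rV[F]_d} :=
  fun U => (U <= W)%VS && ((\dim U).+1 == \dim W).

Lemma card_above :
  #|[set U : {vspace 'rV[F]_d} | [&& (limg (Mt x) <= U)%VS, (U <= lker (Mt x))%VS & above U]]|%:Z
  = (\sum_(i < \dim (lker (Mt x)) - \dim W) 'X^i : {poly int}).[#|F|%:Z].
Proof.
rewrite -(card_subspaces_above (Mpt_ker x)); congr _%:Z; apply: eq_card => U.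
rewrite !inE /above; case: (boolP (W <= U)%VS) => WU; last by rewrite !andbF.
by rewrite (subv_trans (Mpt_im x) WU).
Qed.

Lemma card_below :
  #|[set U : {vspace 'rV[F]_d} | [&& (limg (Mt x) <= U)%VS, (U <= lker (Mt x))%VS & below U]]|%:Z
  = (\sum_(i < \dim W - \dim (limg (Mt x))) 'X^i : {poly int}).[#|F|%:Z].
Proof.
rewrite -(card_subspaces_below (Mpt_im x)); congr _%:Z; apply: eq_card => U.
rewrite !inE /below; case: (boolP (U <= W)%VS) => UW; last by rewrite !andbF.
by rewrite (subv_trans UW (Mpt_ker x)).
Qed.

End Steps.

Lemma card_Tpt_fiber k (dd : k.-tuple nat) (x : Mpt F (sumn dd)) (n : k.-tuple nat) :
  #|[set y : Tpt F dd | (Tproj y == x) && (alpha (lker (Mt x)) (Tflag y) == n)]| =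
  #|flags (Mt x) (nth 0%N dd) (nth 0%N n) k fullv|.
Proof.
rewrite -(@card_in_imset _ _ (@Tflag F k dd)); last first.
  move=> y z; rewrite !inE => /andP[/eqP hy _] /andP[/eqP hz _] h.
  apply/val_inj; move: hy hz h; rewrite /Tproj /Tflag.
  by case: (val y) (val z) => [? ?] [? ?] /= -> -> ->.
apply: eq_card => D; rewrite [RHS]inE; apply/imsetP/and3P => [[y + ->]|[D0 Dm /forallP st]].
  rewrite inE => /andP[/eqP h /eqP an]; rewrite Tpt0 Tpt_max !eqxx; split=> //.
  apply/forallP => i; rewrite /flag_step Tpt_mon Tpt_dim -h Tpt_img -tnth_nth eqxx /=.
  rewrite -(tnth_nth _ n) -an tnth_alpha h subnKC // dimvS // capvS // Tpt_mon //.
have DT : @inT F k dd (D, x).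
  apply/and3P; split=> //; apply/forallP => i; have /and4P[h1 h2 h3 _] := st i.
  by rewrite h1 h3 (tnth_nth 0%N) h2.
exists (Sub _ DT); rewrite ?inE /Tflag /Tproj SubK //= eqxx /=; apply/eqP/eq_from_tnth => i.
have /and4P[_ _ _ /eqP h] := st i.
by rewrite tnth_alpha h addKn (tnth_nth 0%N).
Qed.

End PointCounts.

Lemma qint_frac (K : fieldType) (q y : K) : q != 0 -> q - q^-1 != 0 -> y != 0 ->
  q / y * (y * y - 1) = (y - y^-1) / (q - q^-1) * (q ^+ 2 - 1).
Proof.
move=> q0 q1 y0; have -> : q ^+ 2 - 1 = (q - q^-1) * q by rewrite mulrBl mulVf // expr2.
by rewrite mulrA divfK //; field.
Qed.

Section Formulas.
Variable R : realType.
Local Notation K := (Cq R).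
Local Notation q := (qv R).

Definition qcount (P : {poly int}) : K := (map_poly intr P).[q ^+ 2].

Lemma generic_count (X I : Type) (card : X -> nat) (type : X -> I) (s : X -> K) (x : X)
    (P : {poly int}) (a : K) :
  (forall y, type y = type x -> s y = a * (P.[(card y)%:Z])%:~R) ->
  (forall N, exists y, type y = type x /\ (N < card y)%N) ->
  generic card type s x = a * qcount P.
Proof.
move=> sP unb; rewrite (@generic_eq _ _ _ _ _ _ _ (a *: map_poly intr P)) ?hornerZ // => y ty.
by rewrite hornerZ sP // -[(card y)%:R]/((card y)%:Z%:~R : K) horner_map.
Qed.

(** The powers of [q] in front of the sums defining [E] and [F] are there to centre
    [1 + q^2 + .. + q^(2(m-1))] into the quantum integer [[m]]. *)
Lemma qcount_geom m : q ^ (- (m%:Z - 1)) * qcount (\sum_(i < m) 'X^i) = qint q m.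
Proof.
have q0 := qv_neq0 R.
have qm : q ^+ m != 0 by rewrite expf_neq0.
have q2 : q ^+ 2 - 1 != 0 by rewrite subr_eq0 qv_nroot.
have E : qcount (\sum_(i < m) 'X^i) * (q ^+ 2 - 1) = q ^+ m * q ^+ m - 1.
  rewrite /qcount rmorph_sum horner_sum /=.
  under eq_bigr => i _ do rewrite map_polyXn hornerXn.
  by rewrite mulrC -subrX1 -exprM mul2n -addnn exprD.
have -> : q ^ (- (m%:Z - 1)) = q / q ^+ m.
  by rewrite opprB expfzDr // expr1z -invr_expz.
apply: (mulIf q2); rewrite -mulrA E /qint.
exact: (@qint_frac K q (q ^+ m) q0 (qv_sub_neq0 R) qm).
Qed.

Section OnM.
Variable d : nat.
Implicit Types (x y : Mvar d) (f : Mvar d -> K^o).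

Lemma Mker_rank x : (Mker x + Mrank x)%N = d.
Proof.
by have := limg_ker_dim (Mt (tagged x)) fullv; rewrite capfv dimvf dim_matrix mul1r.
Qed.

Lemma MrankW x : (Mrank x <= MdimW x)%N.
Proof. exact/dimvS/Mpt_im. Qed.

Lemma MWker x : (MdimW x <= Mker x)%N.
Proof. exact/dimvS/Mpt_ker. Qed.

Lemma exists_Mvar s r w : (r <= w)%N -> (r + w <= d)%N ->
  exists x : Mvar d, [/\ tag x = s, Mrank x = r & MdimW x = w].
Proof.
move=> rw rwd; have [x [hw hr]] := exists_Mpt (GF s) rw rwd.
by exists (Tagged (fun s => Mpt (GF s) d) x).
Qed.

Lemma Mtype_unbounded x N : exists y, Mtype y = Mtype x /\ (N < Mcard y)%N.
Proof.
have h : (Mrank x + MdimW x <= d)%N by have := Mker_rank x; have := MWker x; lia.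
have [y [ty hr hw]] := exists_Mvar (FF2 N) (MrankW x) h.
by exists y; rewrite /Mtype hr hw /Mcard ty card_FF2.
Qed.

Lemma MtypeP x y : Mtype y = Mtype x -> [/\ Mrank y = Mrank x, MdimW y = MdimW x & Mker y = Mker x].
Proof.
by case=> hw hr; split=> //; have := Mker_rank x; have := Mker_rank y; rewrite hr; lia.
Qed.

Lemma ME_formula (G : nat -> nat -> K) f : (forall x, f x = G (Mrank x) (MdimW x)) ->
  forall x, ME f x = qint q (Mker x - MdimW x) * G (Mrank x) (MdimW x).+1.
Proof.
move=> fG x; rewrite /ME (@generic_count _ _ _ _ _ _
  (\sum_(i < Mker x - MdimW x) 'X^i) (G (Mrank x) (MdimW x).+1)); first 1 last.
- move=> y /MtypeP[hr hw hk]; rewrite /ME_sum.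
  rewrite (eq_bigr (fun=> G (Mrank x) (MdimW x).+1)) => [|z /and3P[/eqP tz _ /eqP dz]].
    rewrite sumr_const mulrzr -hk -hw -card_above -card_Mpt_above -pmulrn.
    by congr (_ *+ _); apply: eq_card => z; rewrite [RHS]inE.
  by rewrite fG -hr -hw; congr (G _ _); [rewrite /Mrank /= tz | exact: dz].
- exact: Mtype_unbounded.
by rewrite mulrCA mulrC -qcount_geom subzn // MWker.
Qed.

(** All summands are equal, so the sum is a count of hyperplanes. The truncated [.-1] at dimension 0
    is harmless: its factor is then [qint q 0 = 0]. *)
Lemma MF_formula (G : nat -> nat -> K) f : (forall x, f x = G (Mrank x) (MdimW x)) ->
  forall x, MF f x = qint q (MdimW x - Mrank x) * G (Mrank x) (MdimW x).-1.
Proof.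
move=> fG x; rewrite /MF (@generic_count _ _ _ _ _ _
  (\sum_(i < MdimW x - Mrank x) 'X^i) (G (Mrank x) (MdimW x).-1)); first 1 last.
- move=> y /MtypeP[hr hw hk]; rewrite /MF_sum.
  rewrite (eq_bigr (fun=> G (Mrank x) (MdimW x).-1)) => [|z /and3P[/eqP tz _ /eqP dz]].
    rewrite sumr_const mulrzr -hr -hw -card_below -card_Mpt_above -pmulrn.
    by congr (_ *+ _); apply: eq_card => z; rewrite [RHS]inE.
  by rewrite fG -hr -hw -dz; congr (G _ _); rewrite /Mrank /= tz.
- exact: Mtype_unbounded.
by rewrite mulrCA mulrC -qcount_geom subzn // MrankW.
Qed.

End OnM.

Section OnT.
Variables (k : nat) (dd : k.-tuple nat).
Implicit Types (x y : Tvar dd) (f : Tvar dd -> K^o).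

Lemma sumn_alphaW x : sumn (alphaW x) = MdimW (pvar x).
Proof. by apply: sumn_alpha; [exact: Tpt0 | exact: Tpt_mon | exact: Tpt_max]. Qed.

Lemma sumn_alpha_im x : sumn (alpha_im x) = Mrank (pvar x).
Proof. by apply: sumn_alpha; [exact: Tpt0 | exact: Tpt_mon | exact: Tpt_max]. Qed.

Lemma sumn_alpha_ker x : sumn (alpha_ker x) = Mker (pvar x).
Proof. by apply: sumn_alpha; [exact: Tpt0 | exact: Tpt_mon | exact: Tpt_max]. Qed.

Lemma Ttype_unbounded x N : exists y, Ttype y = Ttype x /\ (N < Tcard y)%N.
Proof.
have [y [h1 h2 h3]] := exists_Tpt (GF (FF2 N)) (tagged x).
exists (Tagged (fun s => Tpt (GF s) dd) y); split; last exact: card_FF2.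
by rewrite /Ttype /alphaW /alpha_im /alpha_ker /= h1 h2 h3.
Qed.

Lemma TtypeP x y : Ttype y = Ttype x -> [/\ alpha_ker y = alpha_ker x,
  Mrank (pvar y) = Mrank (pvar x), MdimW (pvar y) = MdimW (pvar x) & Mker (pvar y) = Mker (pvar x)].
Proof.
move=> h; have h1 : alphaW y = alphaW x := congr1 (fun p => p.1.1) h.
have h2 : alpha_im y = alpha_im x := congr1 (fun p => p.1.2) h.
have h3 : alpha_ker y = alpha_ker x := congr1 snd h.
by rewrite -!sumn_alpha_ker -!sumn_alphaW -!sumn_alpha_im h1 h2 h3.
Qed.

Lemma TE_formula (G : k.-tuple nat -> nat -> K) f :
  (forall x, f x = G (alpha_ker x) (MdimW (pvar x))) ->
  forall x, TE f x =
    qint q (Mker (pvar x) - MdimW (pvar x)) * G (alpha_ker x) (MdimW (pvar x)).+1.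
Proof.
move=> fG x; rewrite /TE (@generic_count _ _ _ _ _ _
  (\sum_(i < Mker (pvar x) - MdimW (pvar x)) 'X^i) (G (alpha_ker x) (MdimW (pvar x)).+1)); first 1 last.
- move=> y /TtypeP[hn hr hw hk]; rewrite /TE_sum.
  rewrite (eq_bigr (fun=> G (alpha_ker x) (MdimW (pvar x)).+1)) => [|z /and4P[/eqP Dz /eqP tz _ /eqP dz]].
    rewrite sumr_const mulrzr -hk -hw -card_above -card_Tpt_above -pmulrn.
    by congr (_ *+ _); apply: eq_card => z; rewrite [RHS]inE.
  by rewrite fG -hn -hw; congr (G _ _); [rewrite /alpha_ker /= tz Dz | exact: dz].
- exact: Ttype_unbounded.
by rewrite mulrCA mulrC -qcount_geom subzn // MWker.
Qed.

Lemma TF_formula (G : k.-tuple nat -> nat -> K) f :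
  (forall x, f x = G (alpha_ker x) (MdimW (pvar x))) ->
  forall x, TF f x =
    qint q (MdimW (pvar x) - Mrank (pvar x)) * G (alpha_ker x) (MdimW (pvar x)).-1.
Proof.
move=> fG x; rewrite /TF (@generic_count _ _ _ _ _ _
  (\sum_(i < MdimW (pvar x) - Mrank (pvar x)) 'X^i) (G (alpha_ker x) (MdimW (pvar x)).-1)); first 1 last.
- move=> y /TtypeP[hn hr hw hk]; rewrite /TF_sum.
  rewrite (eq_bigr (fun=> G (alpha_ker x) (MdimW (pvar x)).-1)) => [|z /and4P[/eqP Dz /eqP tz _ /eqP dz]].
    rewrite sumr_const mulrzr -hr -hw -card_below -card_Tpt_above -pmulrn.
    by congr (_ *+ _); apply: eq_card => z; rewrite [RHS]inE.
  by rewrite fG -hn -hw -dz; congr (G _ _); rewrite /alpha_ker /= tz Dz.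
- exact: Ttype_unbounded.
by rewrite mulrCA mulrC -qcount_geom subzn // MrankW.
Qed.

Definition flag_count (n : k.-tuple nat) : K :=
  qcount (flag_poly k (nth 0%N dd) (nth 0%N n)).

Lemma sumn_tuple (n : k.-tuple nat) : sumn n = (\sum_(j < k) nth 0 n j)%N.
Proof. by rewrite sumnE big_tuple; apply: eq_bigr => j _; rewrite (tnth_nth 0%N). Qed.

Lemma flag_count_neq0 (n : k.-tuple nat) : nadm k (nth 0%N dd) (nth 0%N n) -> flag_count n != 0.
Proof.
move=> nd; apply: horner_qv_neq0; apply/eqP => h.
by have := flag_poly_gt0 (isT : (0 < 1)%N) nd; rewrite h horner0 ltxx.
Qed.

(** The flag of [x] witnesses that the set of flags over its own [(W, t)] is not empty, which is
    what [flags_nadm] asks for. *)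
Lemma alpha_ker_nadm x : nadm k (nth 0%N dd) (nth 0%N (alpha_ker x)).
Proof.
have tk : (limg (Mt (Tproj (tagged x))) <= lker (Mt (Tproj (tagged x))))%VS.
  exact: subv_trans (Mpt_im _) (Mpt_ker _).
apply: (flags_nadm (V := fullv) tk).
rewrite -card_Tpt_fiber card_gt0; apply/set0Pn; exists (tagged x).
by rewrite inE !eqxx.
Qed.

(** Along a fibre of [p] only the flag varies, so the summands are constant on the flags with kernel
    vector [n], whose number is [flag_poly]. There are none when [|n|] differs from the dimension of
    the kernel. *)
Lemma T_formula (n : k.-tuple nat) (G : k.-tuple nat -> nat -> K) f :
  (forall x, f x = G (alpha_ker x) (MdimW (pvar x))) ->
  forall x : Mvar (sumn dd), T_ (fun y => alpha_ker y == n) f x =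
    if Mker x == sumn n then flag_count n * G n (MdimW x) else 0.
Proof.
move=> fG x; rewrite /T_ /p_push.
rewrite (@generic_count _ _ _ _ _ _ (flag_poly k (nth 0%N dd) (nth 0%N n))
  (if Mker x == sumn n then G n (MdimW x) else 0)); first 1 last.
- move=> y /MtypeP[hr hw hk].
  rewrite (bigID (fun z => alpha (lker (Mt (tagged y))) (Tflag z) == n)) /=.
  rewrite [X in _ + X]big1 ?addr0 => [|z /andP[/eqP hz hn]]; last first.
    by rewrite /ind /alpha_ker /= hz (negPf hn) mul0r.
  rewrite (eq_bigr (fun=> G n (MdimW x))) => [|z /andP[/eqP hz /eqP hn]]; last first.
    by rewrite /ind fG /alpha_ker /= hz hn eqxx mul1r -hw /MdimW /pvar /= hz.
  rewrite sumr_const; have -> : #|[pred z | (Tproj z == tagged y) &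
      alpha (lker (Mt (tagged y))) (Tflag z) == n]| =
    #|flags (Mt (tagged y)) (nth 0%N dd) (nth 0%N n) k fullv|.
    by rewrite -card_Tpt_fiber; apply: eq_card => z; rewrite [RHS]inE.
  rewrite -hk; case: eqP => [e|ne]; last first.
    rewrite mul0r eq_card0 ?mulr0n // => D; apply/negP => /flags_dim[_].
    by rewrite capvf -sumn_tuple.
  rewrite mulrzr -(@card_flags _ _ (Mt (tagged y)) _ _ _ fullv) ?subvf // -?pmulrn //.
  - exact: subv_trans (Mpt_im _) (Mpt_ker _).
  - by rewrite dimvf dim_matrix mul1r sumn_tuple.
  - by rewrite capvf -sumn_tuple.
- exact: Mtype_unbounded.
by case: ifP => _; rewrite ?mul0r // mulrC.
Qed.

End OnT.
End Formulas.

(** * Intertwiners *)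

Section Linspan.
Variables (K : fieldType) (V : lmodType K) (S : set V).

Lemma linspan_gen v : S v -> linspan S v.
Proof.
by move=> Sv; exists 1%N, (fun=> 1), (fun=> v); rewrite big_ord1 scale1r.
Qed.

Lemma linspanP a u v : linspan S u -> linspan S v -> linspan S (a *: u + v).
Proof.
move=> [n [c [x [Sx ->]]]] [m [e [y [Sy ->]]]].
exists (n + m)%N, (fun i => match fintype.split i with inl j => a * c j | inr j => e j end),
  (fun i => match fintype.split i with inl j => x j | inr j => y j end); split.
  by move=> i; case: (fintype.split i).
rewrite big_split_ord /= scaler_sumr; congr (_ + _); apply: eq_bigr => i _.
  by rewrite -[lshift m i]/(unsplit (inl i)) unsplitK scalerA.
by rewrite -[rshift n i]/(unsplit (inr i)) unsplitK.
Qed.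

Lemma linspan0 : linspan S 0.
Proof. by exists 0%N, (fun=> 0), (fun=> 0); rewrite big_ord0; split=> // -[]. Qed.

Lemma linspan_sum (I : Type) (r : seq I) (P : pred I) (F : I -> V) :
  (forall i, P i -> linspan S (F i)) -> linspan S (\sum_(i <- r | P i) F i).
Proof.
move=> h; apply: big_ind => //; first exact: linspan0.
by move=> u v Su Sv; rewrite -[u]scale1r; exact: linspanP.
Qed.

Lemma linspanZ a v : linspan S v -> linspan S (a *: v).
Proof. by move=> Sv; rewrite -[_ *: v]addr0; apply: linspanP => //; exact: linspan0. Qed.

Lemma linspan_sub (P : V -> Prop) : P 0 -> (forall a u v, P u -> P v -> P (a *: u + v)) ->
  (forall v, S v -> P v) -> forall v, linspan S v -> P v.
Proof.
move=> P0 PD SP _ [n [c [u [Su ->]]]].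
elim: n c u Su => [|n IH] c u Su; first by rewrite big_ord0.
by rewrite big_ord_recl; apply: PD; [exact: SP | apply: (IH (fun i => c (lift ord0 i)) (fun i => u (lift ord0 i)))].
Qed.

End Linspan.

Lemma sum_ord_widen k m (F : nat -> nat) : (m <= k)%N ->
  (\sum_(j < k | j < m) F j = \sum_(j < m) F j)%N.
Proof. by move=> mk; rewrite (big_ord_widen k F mk). Qed.

Lemma nadm_admissible k d n t : (forall i, (i < k)%N -> (t i <= d i)%N /\ n i = (d i - t i)%N) ->
  nadm k d n = admissible k d t.
Proof.
move=> h; apply: eq_forallb => i; have ik := ltn_ord i.
have S m : (m <= k)%N -> (\sum_(j < m) d j = \sum_(j < m) n j + \sum_(j < m) t j)%N.
  move=> mk; rewrite -big_split; apply: eq_bigr => j _.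
  by have [h1 ->] := h j (leq_trans (ltn_ord j) mk); rewrite /= subnK.
have [h1 h2] := h _ ik; rewrite h1 h2 leq_subr /= !S //; last exact: ltnW.
by rewrite leq_add2l leq_add2r.
Qed.

Section Conversions.
Variables (k : nat) (dd : k.-tuple nat).
Local Notation d := (sumn dd).

Lemma nadmP (n : k.-tuple nat) : reflect
  ((forall i, tnth n i <= tnth dd i)%N /\
   (forall i : 'I_k, \sum_(j < k | j <= i) (tnth dd j - tnth n j) <=
     \sum_(j < k | j < i) tnth n j)%N)
  (nadm k (nth 0%N dd) (nth 0%N n)).
Proof.
have E (i : 'I_k) : (forall i, tnth n i <= tnth dd i)%N ->
   ((\sum_(j < i.+1) nth 0 dd j <= \sum_(j < i.+1) nth 0 n j + \sum_(j < i) nth 0 n j) =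
   (\sum_(j < k | j <= i) (tnth dd j - tnth n j) <= \sum_(j < k | j < i) tnth n j))%N.
  move=> h; rewrite -!(@sum_ord_widen k) //; last exact: ltnW.
  have W (a : k.-tuple nat) (P : pred 'I_k) :
      (\sum_(j < k | P j) nth 0 a j = \sum_(j < k | P j) tnth a j)%N.
    by apply: eq_bigr => j _; rewrite (tnth_nth 0%N).
  rewrite !W; have -> : (\sum_(j < k | j < i.+1) tnth dd j =
      \sum_(j < k | j < i.+1) tnth n j + \sum_(j < k | j <= i) (tnth dd j - tnth n j))%N.
    by rewrite -big_split /=; apply: eq_bigr => j _; rewrite subnKC.
  by rewrite leq_add2l.
apply: (iffP forallP) => [h|[h1 h2] i].
  have h1 i : (tnth n i <= tnth dd i)%N by have /andP[] := h i; rewrite !(tnth_nth 0%N).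
  by split=> // i; rewrite -E //; have /andP[] := h i.
by rewrite E // h2 andbT -!tnth_nth.
Qed.

(** The kernel vector belonging to right endpoint counts [t]. It links the names of strings to types
    of points and, through [nvec], to matches. *)
Definition kvec (t : seq nat) : k.-tuple nat := [tuple (tnth dd i - nth 0 t i)%N | i < k].

Lemma adm_seqP t : adm_seq dd t -> [/\ size t = k, forall i, (nth 0 t i <= nth 0 dd i)%N
  & nadm k (nth 0%N dd) (nth 0%N (kvec t))].
Proof.
case/andP => /eqP st; rewrite size_tuple in st *; move=> ad.
have td i : (nth 0 t i <= nth 0 dd i)%N.
  case: (ltnP i k) => ik; last by rewrite nth_default ?st.
  by have /forallP/(_ (Ordinal ik))/andP[] := ad.
split=> //; rewrite (@nadm_admissible _ _ _ (nth 0%N t)) // => i ik; split=> //.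
by rewrite (nth_mktuple _ _ (Ordinal ik)) (tnth_nth 0%N).
Qed.

Lemma kvec_surj (n : k.-tuple nat) : nadm k (nth 0%N dd) (nth 0%N n) ->
  exists2 t, adm_seq dd t & kvec t = n.
Proof.
move=> nd; pose t := mkseq (fun i => nth 0 dd i - nth 0 n i)%N k; exists t.
  rewrite /adm_seq size_mkseq size_tuple eqxx -(@nadm_admissible _ _ (nth 0%N n)) // => i ik.
  rewrite nth_mkseq // leq_subr subKn //.
  by have /forallP/(_ (Ordinal ik))/andP[] := nd.
apply: eq_from_tnth => i; rewrite tnth_mktuple nth_mkseq // !(tnth_nth 0%N) subKn //.
by have /forallP/(_ i)/andP[] := nd.
Qed.

Lemma kvec_inj t t' : adm_seq dd t -> adm_seq dd t' -> kvec t = kvec t' -> t = t'.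
Proof.
move=> /adm_seqP[st td _] /adm_seqP[st' td' _] h; apply: (@eq_from_nth _ 0%N) => [|i]; first by rewrite st.
rewrite st => ik; have := congr1 (fun a => tnth a (Ordinal ik)) h; rewrite !tnth_mktuple (tnth_nth 0%N) /=.
by have := td i; have := td' i; lia.
Qed.

Lemma sumn_kvec t : adm_seq dd t -> (sumn (kvec t) + sumn t)%N = d.
Proof.
move=> /adm_seqP[st td _]; rewrite !sumn_nth st !size_tuple -big_split /=.
by apply: eq_bigr => i _; rewrite nth_mktuple (tnth_nth 0%N) subnK.
Qed.

Lemma nvec_nadm (b : {set vert dd * vert dd}) : lower_match b -> nadm k (nth 0%N dd) (nth 0%N (nvec b)).
Proof.
move=> lm; apply/nadmP; split=> [i|i]; first by rewrite tnth_nvec leq_subr.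
under eq_bigr => j _ do rewrite tnth_nvec subKn ?rho_le //.
under [leqRHS]eq_bigr => j _ do rewrite tnth_nvec.
exact: lower_match_valid.
Qed.

Lemma sumn_nvec (b : {set vert dd * vert dd}) : lower_match b -> (sumn (@nvec k dd b) + #|b|)%N = d.
Proof.
move=> lm; rewrite card_lower_match !sumnE !big_tuple -big_split /=.
by apply: eq_bigr => i _; rewrite tnth_nvec subnK // rho_le.
Qed.

(** Over the field with two elements a pair [(W, t)] of the right dimensions exists, and the flag
    polynomial, positive at 2, provides a flag above it. *)
Lemma exists_Tvar (n : k.-tuple nat) w : nadm k (nth 0%N dd) (nth 0%N n) ->
  (d - sumn n <= w <= sumn n)%N ->
  exists x : Tvar dd, alpha_ker x = n /\ MdimW (pvar x) = w.
Proof.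
move=> nd /andP[rw wn]; have nle : (sumn n <= d)%N.
  by rewrite (sumn_tuple n) (sumn_tuple dd); exact: nadm_sum.
have [x [hr hw]] := exists_Mpt (GF (FF2 0)) rw (ltac:(lia) : (d - sumn n + w <= d)%N).
have kx : \dim (lker (Mt x)) = sumn n.
  by have := limg_ker_dim (Mt x) fullv; rewrite capfv dimvf dim_matrix mul1r; lia.
have : (0 < #|flags (Mt x) (nth 0%N dd) (nth 0%N n) k fullv|)%N.
  rewrite -ltz_nat card_flags ?subvf //.
  - by rewrite flag_poly_gt0 // (leq_ltn_trans _ (card_FF2 0)).
  - exact: subv_trans (Mpt_im _) (Mpt_ker _).
  - by rewrite dimvf dim_matrix mul1r sumn_tuple.
  - by rewrite capvf kx sumn_tuple.
rewrite -card_Tpt_fiber card_gt0 => /set0Pn[y]; rewrite inE => /andP[/eqP hy /eqP hn].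
exists (Tagged (fun s => Tpt (GF s) dd) y); rewrite /alpha_ker /MdimW /pvar /= hy.
by [].
Qed.

End Conversions.

Section Coefficients.
Variables (K : fieldType) (n : nat).
Implicit Types u : 'cV[K]_n.+1.

Definition coef_cV u (j : nat) : K := if insub j is Some i then u i 0 else 0.

Lemma coef_cVE u (i : 'I_n.+1) : coef_cV u i = u i 0.
Proof. by rewrite /coef_cV valK. Qed.

Lemma coef_cV_out u j : (n < j)%N -> coef_cV u j = 0.
Proof. by move=> nj; rewrite /coef_cV insubF // ltnNge nj. Qed.

Lemma coef_cV_col (f : nat -> K) j : (j <= n)%N -> coef_cV (\col_i f i) j = f j.
Proof. by move=> jn; rewrite -[j]/(val (Ordinal (jn : (j < n.+1)%N))) coef_cVE mxE. Qed.

Lemma coef_VE (q : K) u j : (j <= n)%N ->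
  coef_cV (VE q n *m u) j = qint q (n - j) * coef_cV u j.+1.
Proof.
move=> jn; pose i := Ordinal (jn : (j < n.+1)%N).
rewrite -[LHS]/(coef_cV _ i) coef_cVE mxE; case: (ltnP j n) => h.
  rewrite (bigD1 (Ordinal (h : (j.+1 < n.+1)%N))) //= big1 ?addr0 => [|l lj].
    by rewrite mxE /= eqxx mulr1n subnSK // -[j.+1 in RHS]/(val (Ordinal (h : (j.+1 < n.+1)%N))) coef_cVE.
  by rewrite mxE eq_sym; move: lj; rewrite -val_eqE /= => /negPf ->; rewrite mul0r.
rewrite (_ : (n - j)%N = 0%N); last by lia.
rewrite qint0 mul0r big1 // => l _; rewrite mxE (_ : (i.+1 == l) = false) ?mul0r //.
by apply/eqP => e; have := ltn_ord l; rewrite -e ltnS ltnNge h.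
Qed.

Lemma coef_VF (q : K) u j : (j <= n)%N ->
  coef_cV (VF q n *m u) j = qint q j * coef_cV u j.-1.
Proof.
move=> jn; pose i := Ordinal (jn : (j < n.+1)%N).
rewrite -[LHS]/(coef_cV _ i) coef_cVE mxE; case: j jn @i => [|j] jn i /=.
  by rewrite qint0 mul0r big1 // => l _; rewrite mxE /= mul0r.
have jn' : (j < n.+1)%N := ltnW jn.
rewrite (bigD1 (Ordinal jn')) //= big1 ?addr0 => [|l lj].
  by rewrite mxE /= eqxx mulr1n -[j in RHS]/(val (Ordinal jn')) coef_cVE.
by rewrite mxE /= eqSS eq_sym; move: lj; rewrite -val_eqE /= => /negPf ->; rewrite mul0r.
Qed.

Lemma coef_VK (q : K) u j : coef_cV (VK q n *m u) j = q ^ (n%:Z - j%:Z *+ 2) * coef_cV u j.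
Proof.
case: (leqP j n) => jn; last by rewrite !coef_cV_out // mulr0.
rewrite -[j]/(val (Ordinal (jn : (j < n.+1)%N))) !coef_cVE.
by rewrite mul_diag_mx !mxE.
Qed.

Lemma coef_VKV (q : K) u j : coef_cV (VKV q n *m u) j = q ^ (- (n%:Z - j%:Z *+ 2)) * coef_cV u j.
Proof.
case: (leqP j n) => jn; last by rewrite !coef_cV_out // mulr0.
rewrite -[j]/(val (Ordinal (jn : (j < n.+1)%N))) !coef_cVE.
by rewrite mul_diag_mx !mxE.
Qed.

End Coefficients.

(** * The function spaces as modules *)

Section CalM.
Variables (R : realType) (d r mu : nat).
Local Notation K := (Cq R).
Local Notation q := (qv R).
Hypothesis dE : (r.*2 + mu = d)%N.
Implicit Types (u : 'cV[K]_mu.+1) (x : Mvar d).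

Lemma MrankP x : Mrank x = r -> (MdimW x - r <= mu)%N /\ (Mker x - MdimW x = mu - (MdimW x - r))%N.
Proof.
by move=> hr; have := Mker_rank x; have := MrankW x; have := MWker x; rewrite hr; lia.
Qed.

Lemma MVE u x : MV R d r mu u x =
  if Mrank x == r then coef_cV u (MdimW x - r) else 0.
Proof.
have -> : MV R d r mu u x = \sum_(j < mu.+1) u j 0 * indM R d r (r + j) x.
  by rewrite /MV fct_sumE.
rewrite /indM /ind; case: eqP => hr; last by rewrite big1 // => j _; rewrite mulr0.
have [h _] := MrankP hr; have := MrankW x; rewrite hr => rw.
rewrite (bigD1 (Ordinal (h : (MdimW x - r < mu.+1)%N))) //= big1 ?addr0 => [|j jh].
  by rewrite subnKC // eqxx mulr1 -coef_cVE.
case: eqP => [e|_]; last exact: mulr0.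
by move: jh; rewrite -val_eqE /= e addKn eqxx.
Qed.

Lemma MV_inj : injective (MV R d r mu).
Proof.
move=> u v uv; apply/colP => j.
have [||x [_ hr hw]] := @exists_Mvar d (FF2 0) r (r + j); [exact: leq_addr | have := ltn_ord j; lia |].
have := congr1 (fun f : Mvar d -> K^o => f x) uv.
by rewrite !MVE hr hw eqxx addKn !coef_cVE.
Qed.

(** For [w] outside the interval from [r] to [r + mu] both sides vanish, as no point of rank [r] has
    such a [W]. *)
Lemma MV_indM w : MV R d r mu (\col_j (r + j == w)%N%:R) = indM R d r w.
Proof.
apply/funext => x; rewrite MVE /indM /ind; case: eqP => //= hr.
have [h _] := MrankP hr; rewrite (coef_cV_col (fun j => (r + j == w)%N%:R)) //.
by rewrite /= subnKC // -hr MrankW.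
Qed.

Lemma range_MV : range (MV R d r mu) = calM R d r.
Proof.
apply/seteqP; split=> [_ [u _ <-]|f].
  exists mu.+1, (fun j => u j 0), (fun j => indM R d r (r + j)); split=> // j.
  by exists (r + j)%N.
apply: linspan_sub => [|a f1 f2 [u _ <-] [v _ <-]|_ [w ->]].
- by exists 0 => //; rewrite linear0.
- by exists (a *: u + v) => //; rewrite linearP.
- by exists (\col_j (r + j == w)%N%:R) => //; rewrite MV_indM.
Qed.

Let GM u : nat -> nat -> K := fun r' w => if r' == r then coef_cV u (w - r) else 0.

Lemma MV_ME u : MV R d r mu (VE q mu *m u) = ME (MV R d r mu u).
Proof.
apply/funext => x; rewrite (@ME_formula R d (GM u)) => [|y]; last by rewrite MVE.
rewrite MVE /GM; case: eqP => hr; last by rewrite mulr0.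
have [h ->] := MrankP hr; rewrite coef_VE // subSn // -hr; exact: MrankW.
Qed.

Lemma MV_MF u : MV R d r mu (VF q mu *m u) = MF (MV R d r mu u).
Proof.
apply/funext => x; rewrite (@MF_formula R d (GM u)) => [|y]; last by rewrite MVE.
rewrite MVE /GM; case: eqP => hr; last by rewrite mulr0.
have [h _] := MrankP hr; rewrite coef_VF // hr; congr (_ * coef_cV u _); lia.
Qed.

Lemma MV_MK u : MV R d r mu (VK q mu *m u) = MK (MV R d r mu u).
Proof.
apply/funext => x; rewrite /MK !MVE; case: eqP => hr; last by rewrite mulr0.
rewrite coef_VK; congr (_ ^ _ * _); have := MrankW x; rewrite hr; lia.
Qed.

Lemma MV_MKV u : MV R d r mu (VKV q mu *m u) = MKV (MV R d r mu u).
Proof.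
apply/funext => x; rewrite /MKV !MVE; case: eqP => hr; last by rewrite mulr0.
rewrite coef_VKV; congr (_ ^ _ * _); have := MrankW x; rewrite hr; lia.
Qed.

Lemma calM_iso : Uq_iso (A := Vn R mu) (Mops R d) (calM R d r) (MV R d r mu).
Proof.
split; [exact: MV_inj | exact: range_MV | |] => v; split.
- exact: MV_ME.
- exact: MV_MF.
- exact: MV_MK.
- exact: MV_MKV.
Qed.

End CalM.

Section CalT.
Variables (R : realType) (k : nat) (dd : k.-tuple nat).
Local Notation K := (Cq R).
Local Notation q := (qv R).
Local Notation d := (sumn dd).
Local Notation fT := (Tvar dd -> K^o).
Implicit Types (f : fT) (x : Tvar dd) (t : seq nat).

Lemma Tvar_range x : (Mrank (pvar x) <= MdimW (pvar x) <= Mker (pvar x))%N /\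
  (Mker (pvar x) + Mrank (pvar x) = d)%N.
Proof. by rewrite MrankW MWker Mker_rank. Qed.

Definition indT (n : k.-tuple nat) (w : nat) : fT :=
  ind R (fun x : Tvar dd => (alpha_ker x == n) && (MdimW (pvar x) == w)).

(** An explicit [G] gives access to the closed formulas for the operators, and through them to
    linearity, which the choice inside [generic] hides. *)
Definition type_fun f (G : k.-tuple nat -> nat -> K) :=
  forall x, f x = G (alpha_ker x) (MdimW (pvar x)).

Lemma type_fun_indT n w : type_fun (indT n w) (fun n' w' => ((n' == n) && (w' == w))%:R).
Proof. by []. Qed.

Lemma type_fun_sum (I : Type) (s : seq I) (c : I -> K) (f : I -> fT) G :
  (forall i, type_fun (f i) (G i)) ->
  type_fun (\sum_(i <- s) c i *: f i) (fun n w => \sum_(i <- s) c i * G i n w).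
Proof.
move=> fG x; rewrite fct_sumE; apply: eq_bigr => i _; rewrite -fG; exact: erefl.
Qed.

Lemma calTs_type_fun f : calTs R dd f -> exists G, type_fun f G.
Proof.
move=> [_ fs]; pose P n w x := alpha_ker x = n /\ MdimW (pvar x) = w.
(* The value at a type is taken at a chosen point of that type; types without points get 0. *)
exists (fun n w => if pselect (exists x, P n w x) is left h then f (projT1 (cid h)) else 0).
move=> x; case: pselect => [h|]; last by case; exists x.
by case: (cid h) => y /= [h1 h2]; apply: fs.
Qed.

(** The dimension of [W] is the sum of [alphaW], so the function is a sum over all possible [alphaW]
    of total [w] and all [alpha_im]. Their entries are at most [d], hence tuples over ['I_d.+1] form
    a finite index set. *)
Lemma calT_indT n w : @calT R k dd (indT n w).
Proof.
pose nt (a : k.-tuple 'I_d.+1) : k.-tuple nat := [tuple nat_of_ord (tnth a i) | i < k].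
have -> : indT n w = \sum_(p : k.-tuple 'I_d.+1 * k.-tuple 'I_d.+1 | sumn (nt p.1) == w)
    ind R (@A_set k dd (nt p.1) (nt p.2) n).
  apply/funext => x; rewrite fct_sumE /indT /ind /A_set.
  have le_d (X : {vspace 'rV[GF (tag x)]_d}) i : (tnth (alpha X (Tflag (tagged x))) i <= d)%N.
    rewrite tnth_alpha; apply: leq_trans (leq_subr _ _) _.
    by apply: leq_trans (dimvS (subvf _)) _; rewrite dimvf dim_matrix mul1r.
  pose o (a : k.-tuple nat) : k.-tuple 'I_d.+1 := [tuple inord (tnth a i) | i < k].
  have ntK (a : k.-tuple nat) : (forall i, tnth a i <= d)%N -> nt (o a) = a.
    by move=> h; apply: eq_from_tnth => i; rewrite !tnth_mktuple inordK // ltnS.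
  have oK a : o (nt a) = a.
    by apply: eq_from_tnth => i; rewrite !tnth_mktuple inord_val.
  have aW : nt (o (alphaW x)) = alphaW x by apply: ntK => i; exact: le_d.
  have aI : nt (o (alpha_im x)) = alpha_im x by apply: ntK => i; exact: le_d.
  rewrite -sumn_alphaW; move: (alphaW x) (alpha_im x) aW aI => aw ai aW aI.
  clearbody nt o; rewrite big_mkcond (bigD1 (o aw, o ai)) //= aW aI !eqxx /=.
  rewrite big1 ?addr0 => [|[a b] /= ab]; last first.
    case: eqP => // _; case: eqP => //= h1; case: eqP => //= h2.
    by move: ab; rewrite h1 h2 !oK eqxx.
  by case: (alpha_ker x == n); case: (sumn _ == w).
apply: linspan_sum => p _; apply: linspan_gen.
by exists (nt p.1), (nt p.2), n.
Qed.

Lemma TE_sum_lin (I : Type) (s : seq I) (c : I -> K) (f : I -> fT) G :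
  (forall i, type_fun (f i) (G i)) ->
  TE (\sum_(i <- s) c i *: f i) = \sum_(i <- s) c i *: TE (f i).
Proof.
move=> fG; apply/funext => x; rewrite (TE_formula (type_fun_sum s c fG)) fct_sumE mulr_sumr.
apply: eq_bigr => i _; rewrite mulrCA -(TE_formula (fG i)); exact: erefl.
Qed.

Lemma TF_sum_lin (I : Type) (s : seq I) (c : I -> K) (f : I -> fT) G :
  (forall i, type_fun (f i) (G i)) ->
  TF (\sum_(i <- s) c i *: f i) = \sum_(i <- s) c i *: TF (f i).
Proof.
move=> fG; apply/funext => x; rewrite (TF_formula (type_fun_sum s c fG)) fct_sumE mulr_sumr.
apply: eq_bigr => i _; rewrite mulrCA -(TF_formula (fG i)); exact: erefl.
Qed.

Lemma TK_sum_lin (I : Type) (s : seq I) (c : I -> K) (f : I -> fT) :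
  TK (\sum_(i <- s) c i *: f i) = \sum_(i <- s) c i *: TK (f i).
Proof.
apply/funext => x; rewrite /TK !fct_sumE mulr_sumr; apply: eq_bigr => i _; exact: mulrCA.
Qed.

Lemma TKV_sum_lin (I : Type) (s : seq I) (c : I -> K) (f : I -> fT) :
  TKV (\sum_(i <- s) c i *: f i) = \sum_(i <- s) c i *: TKV (f i).
Proof.
apply/funext => x; rewrite /TKV !fct_sumE mulr_sumr; apply: eq_bigr => i _; exact: mulrCA.
Qed.

(* The [j]-th weight vector of the copy of [V_(d - 2 |t|)] in [calTs] formed by
   the functions supported on [alpha_ker = kvec t]. *)
Definition strT t j : fT := indT (kvec dd t) (sumn t + j).

Lemma strT_at t x : adm_seq dd t -> alpha_ker x = kvec dd t ->
  Mrank (pvar x) = sumn t /\ Mker (pvar x) = sumn (kvec dd t).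
Proof.
move=> at_ hx; have := sumn_kvec at_; have [_] := Tvar_range x.
by rewrite -sumn_alpha_ker hx; lia.
Qed.

Section OneString.
Variables (t : seq nat) (m : nat).
Hypotheses (at_ : adm_seq dd t) (tm : (m + (sumn t).*2 = d)%N).

Let tk : sumn (kvec dd t) = (sumn t + m)%N.
Proof. by have := sumn_kvec at_; lia. Qed.

Lemma strT_out j : (m < j)%N -> strT t j = 0.
Proof.
move=> mj; apply/funext => x; rewrite /strT /indT /ind; case: eqP => //= hn.
have [hr hk] := strT_at at_ hn; have [] := Tvar_range x; rewrite hr hk tk => h _.
by case: eqP h => //= ->; lia.
Qed.

Lemma TE_strT0 : TE (strT t 0) = 0.
Proof.
apply/funext => x; rewrite (TE_formula (@type_fun_indT _ _)) addn0.
case: eqP => [hn|_]; last by rewrite mulr0.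
have [hr hk] := strT_at at_ hn; have [] := Tvar_range x; rewrite hr => h _.
by rewrite (_ : (_.+1 == _) = false) ?andbF ?mulr0 //; apply/eqP; lia.
Qed.

Lemma TE_strT j : TE (strT t j.+1) = qint q (m - j) *: strT t j.
Proof.
apply/funext => x; rewrite (TE_formula (@type_fun_indT _ _)) addnS eqSS.
transitivity (qint q (m - j) * strT t j x); last exact: erefl.
rewrite /strT /indT /ind; case: eqP => [hn|_]; last by rewrite !mulr0.
have [hr hk] := strT_at at_ hn; case: eqP => [hw|_]; last by rewrite !mulr0.
by rewrite hk hw tk subnDl.
Qed.

Lemma TF_strT j : TF (strT t j) = qint q j.+1 *: strT t j.+1.
Proof.
apply/funext => x; rewrite (TF_formula (@type_fun_indT _ _)).
transitivity (qint q j.+1 * strT t j.+1 x); last exact: erefl.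
rewrite /strT /indT /ind; case: eqP => [hn|_]; last by rewrite !mulr0.
have [hr hk] := strT_at at_ hn; rewrite hr addnS /=; case: (posnP (MdimW (pvar x))) => [->|w0].
  by rewrite sub0n qint0 mul0r mulr0.
rewrite -[X in X == (_).+1](prednK w0) eqSS; case: eqP => [hw|_]; last by rewrite !mulr0.
by congr (qint _ _ * _); lia.
Qed.

Lemma TK_strT j : TK (strT t j) = q ^ (m%:Z - j%:Z *+ 2) *: strT t j.
Proof.
apply/funext => x; transitivity (q ^ (m%:Z - j%:Z *+ 2) * strT t j x); last exact: erefl.
rewrite /TK /strT /indT /ind; case: eqP => [hn|_]; last by rewrite !mulr0.
case: eqP => [hw|_]; last by rewrite !mulr0.
by rewrite hw; congr (_ ^ _ * _); lia.
Qed.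

Lemma TKV_strT j : TKV (strT t j) = q ^ (- (m%:Z - j%:Z *+ 2)) *: strT t j.
Proof.
apply/funext => x; transitivity (q ^ (- (m%:Z - j%:Z *+ 2)) * strT t j x); last exact: erefl.
rewrite /TKV /strT /indT /ind; case: eqP => [hn|_]; last by rewrite !mulr0.
case: eqP => [hw|_]; last by rewrite !mulr0.
by rewrite hw; congr (_ ^ _ * _); lia.
Qed.

End OneString.
End CalT.

Lemma mulmx_cV_ext (K : fieldType) m n (M N : 'M[K]_(m, n)) :
  (forall u : 'cV_n, M *m u = N *m u) -> M = N.
Proof.
move=> h; apply/matrixP => i j.
by have /matrixP/(_ i 0) := h (delta_mx j 0); rewrite -!colE !mxE.
Qed.

Lemma Mker_sub d (x : Mvar d) : (d - Mrank x)%N = Mker x.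
Proof. by have := Mker_rank x; lia. Qed.

Lemma Mrank_sub d (x : Mvar d) : (d - Mker x)%N = Mrank x.
Proof. by have := Mker_rank x; lia. Qed.

Section Intertwining.
Variables (R : realType) (k : nat) (dd : k.-tuple nat) (b : {set vert dd * vert dd}).
Local Notation K := (Cq R).
Local Notation q := (qv R).
Local Notation d := (sumn dd).
Local Notation n := (nvec b).
Local Notation T_b := (@T_ R k dd (Yset_b b)).
Implicit Types (f : Tvar dd -> K^o) (x : Mvar d).
Variables (f : Tvar dd -> K^o) (G : k.-tuple nat -> nat -> K).
Hypothesis fG : type_fun f G.

Lemma T_b_formula x : T_b f x =
  if Mker x == sumn n then flag_count R dd n * G n (MdimW x) else 0.
Proof. exact: (T_formula n fG). Qed.

(** The kernel dimension is rewritten as [d - r], since [ME_formula] and [MF_formula] expect a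
    function of rank and dimension of [W]. *)
Let H (r w : nat) : K := if (d - r)%N == sumn n then flag_count R dd n * G n w else 0.

Let T_bH x : T_b f x = H (Mrank x) (MdimW x).
Proof. by rewrite T_b_formula /H Mker_sub. Qed.

(** Where the values can be nonzero, [Mker x = sumn n]. So the quantum integer read off from
    [alpha_ker] upstairs is the one that [ME] produces downstairs. *)
Lemma T_b_TE : T_b (TE f) = ME (T_b f).
Proof.
apply/funext => x; rewrite (ME_formula T_bH).
rewrite [LHS](@T_formula R k dd n (fun n' w => qint q (sumn n' - w) * G n' w.+1)); last first.
  by move=> y; rewrite (TE_formula fG) sumn_alpha_ker.
rewrite /H Mker_sub; case: eqP => [->|_]; last by rewrite mulr0.
exact: mulrCA.
Qed.

Lemma T_b_TF : T_b (TF f) = MF (T_b f).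
Proof.
apply/funext => x; rewrite (MF_formula T_bH).
rewrite [LHS](@T_formula R k dd n (fun n' w => qint q (w - (d - sumn n')) * G n' w.-1)); last first.
  by move=> y; rewrite (TF_formula fG) sumn_alpha_ker Mrank_sub.
rewrite /H Mker_sub; case: eqP => [<-|_]; last by rewrite mulr0.
by rewrite Mrank_sub; exact: mulrCA.
Qed.

Lemma T_b_TK : T_b (TK f) = MK (T_b f).
Proof.
apply/funext => x; rewrite /MK T_b_formula.
rewrite [LHS](@T_formula R k dd n (fun n' w => q ^ (d%:Z - w%:Z *+ 2) * G n' w)); last first.
  by move=> y; rewrite /TK fG.
by case: eqP => _; [exact: mulrCA | rewrite mulr0].
Qed.

Lemma T_b_TKV : T_b (TKV f) = MKV (T_b f).
Proof.
apply/funext => x; rewrite /MKV T_b_formula.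
rewrite [LHS](@T_formula R k dd n (fun n' w => q ^ (- (d%:Z - w%:Z *+ 2)) * G n' w)); last first.
  by move=> y; rewrite /TKV fG.
by case: eqP => _; [exact: mulrCA | rewrite mulr0].
Qed.

End Intertwining.

Section Iso.
Variables (R : realType) (k : nat) (dd : k.-tuple nat).
Local Notation K := (Cq R).
Local Notation q := (qv R).
Local Notation d := (sumn dd).
Local Notation fT := (Tvar dd -> K^o).
Local Notation bT := (@strT R k dd).
Variables (A : Uq_rep q) (s : seq (seq nat)) (m : seq nat -> nat).
Variable (h : seq nat -> nat -> 'cV[K]_(udim A)).
Hypothesis uniq_s : uniq s.
Hypothesis sE : forall t, (t \in s) = adm_seq dd t.
Hypothesis mE : forall t, t \in s -> (m t + (sumn t).*2 = d)%N.
Local Notation idx := (str_index s m).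

Lemma uniq_str_index : uniq idx.
Proof.
apply: allpairs_uniq_dep => // [t _|]; first exact: iota_uniq.
by move=> [t j] [t' j'] /= _ _ [-> ->].
Qed.

Definition at_index (p : seq nat * nat) (x : Tvar dd) :=
  alpha_ker x = kvec dd p.1 /\ MdimW (pvar x) = (sumn p.1 + p.2)%N.

Lemma at_index_ex p : p \in idx -> exists x, at_index p x.
Proof.
case: p => t j; rewrite mem_str_index /= => /andP[ps pm].
have ad : adm_seq dd t by rewrite -sE.
have [_ _ nd] := adm_seqP ad.
suff : exists x : Tvar dd, alpha_ker x = kvec dd t /\ MdimW (pvar x) = (sumn t + j)%N by [].
apply: exists_Tvar => //.
have := sumn_kvec ad; have := mE ps; lia.
Qed.

Lemma index_at_ex x : exists2 p, p \in idx & at_index p x.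
Proof.
have [t ad ht] := kvec_surj (alpha_ker_nadm x).
have ts : t \in s by rewrite sE.
have [hr hk] := strT_at ad (esym ht); have [] := Tvar_range x; rewrite hr hk => rw _.
exists (t, (MdimW (pvar x) - sumn t)%N).
  rewrite mem_str_index [(_, _).1]/= [(_, _).2]/= ts.
  by have := sumn_kvec ad; have := mE ts; lia.
by split; [exact: esym | rewrite [RHS]subnKC //; case/andP: rw].
Qed.

(** At a point with index [p] the other functions of the family vanish. With [at_index_ex] this
    gives linear independence, with [index_at_ex] spanning. *)
Lemma sum_strT_at (c : seq nat * nat -> K) p x : p \in idx -> at_index p x ->
  (\sum_(p <- idx) c p *: bT p.1 p.2) x = c p.
Proof.
move=> pI [h1 h2]; rewrite fct_sumE (bigD1_seq p) ?uniq_str_index //=.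
rewrite big1_seq ?addr0 => [|p' /andP[pp' p'I]].
  transitivity (c p * bT p.1 p.2 x); first exact: erefl.
  by rewrite /strT /indT /ind h1 h2 !eqxx mulr1.
transitivity (c p' * bT p'.1 p'.2 x); first exact: erefl.
rewrite /strT /indT /ind h1 h2; case: eqP => [e|_]; last exact: mulr0.
case: eqP => [e'|_]; last exact: mulr0.
move: pp' pI p'I; rewrite !mem_str_index => pp' /andP[ps _] /andP[p's _].
have e1 : p.1 = p'.1 by apply: (kvec_inj _ _ e); rewrite -sE.
have e2 : p.2 = p'.2 by move: e'; rewrite e1 => /addnI.
by move: pp'; case: (p) (p') e1 e2 => [? ?] [? ?] /= -> ->; rewrite eqxx.
Qed.

Lemma calTs_sum_strT (c : seq nat * nat -> K) : calTs R dd (\sum_(p <- idx) c p *: bT p.1 p.2).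
Proof.
split.
  by apply: linspan_sum => p _; apply: linspanZ; exact: calT_indT.
move=> x y h1 h2; rewrite !fct_sumE; apply: eq_bigr => p _.
transitivity (c p * bT p.1 p.2 x); first exact: erefl.
by rewrite /strT /indT /ind h1 h2.
Qed.

Lemma calTs_strT t j : calTs R dd (bT t j).
Proof.
split; first exact: calT_indT.
by move=> x y h1 h2; rewrite /strT /indT /ind h1 h2.
Qed.

Lemma calTs_sumP f : calTs R dd f -> exists c, f = \sum_(p <- idx) c p *: bT p.1 p.2.
Proof.
move=> /calTs_type_fun[G fG]; exists (fun p => G (kvec dd p.1) (sumn p.1 + p.2)%N).
apply/funext => x; have [p pI px] := index_at_ex x.
by rewrite (sum_strT_at _ pI px) fG; case: px => -> ->.
Qed.

Let inv_strT (p : seq nat * nat) : type_fun (bT p.1 p.2) _ := @type_fun_indT R k dd _ _.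

Section Construction.
Hypothesis sb : string_basis A s m h.
Variable g : seq nat * nat -> 'rV[K]_(udim A).
Hypothesis gh : forall p p', p \in idx -> p' \in idx -> g p *m h p'.1 p'.2 = (p == p')%:R%:M.
Hypothesis gv : forall v, v = \sum_(p <- idx) (g p *m v) 0 0 *: h p.1 p.2.

(** Both modules have string bases with the same names and lengths; the map matches them vector by
    vector, using the dual functionals [g]. *)
Definition tens_to_calTs (v : 'cV[K]_(udim A)) : fT :=
  \sum_(p <- idx) (g p *m v) 0 0 *: bT p.1 p.2.

Fact tens_to_calTs_linear : linear tens_to_calTs.
Proof.
move=> a u v; rewrite /tens_to_calTs scaler_sumr -big_split /=; apply: eq_bigr => p _.
by rewrite mulmxDr -scalemxAr !mxE scalerDl scalerA.
Qed.

HB.instance Definition _ := GRing.isLinear.Build K 'cV[K]_(udim A) fT _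
  tens_to_calTs tens_to_calTs_linear.

Lemma tens_to_calTs_h t j : t \in s -> tens_to_calTs (h t j) = bT t j.
Proof.
move=> ts; have ad : adm_seq dd t by rewrite -sE.
case: (leqP j (m t)) => jm; last first.
  have [_ /(_ t ts) hs _ _] := sb.
  by rewrite (str_out hs jm) linear0 (strT_out R ad (mE ts)).
have pI : (t, j) \in idx by rewrite mem_str_index ts.
rewrite /tens_to_calTs (bigD1_seq (t, j)) ?uniq_str_index //=.
rewrite (gh (p := (t, j)) (p' := (t, j)) pI pI) eqxx mxE scale1r big1_seq ?addr0 // => p /andP[pn pI'].
by rewrite (gh (p := p) (p' := (t, j)) pI' pI) (negPf pn) mxE mul0rn scale0r.
Qed.

Lemma tens_to_calTs_op (M : 'M[K]_(udim A)) (Op : fT -> fT) :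
  (forall c, Op (\sum_(p <- idx) c p *: bT p.1 p.2) = \sum_(p <- idx) c p *: Op (bT p.1 p.2)) ->
  (forall t j, t \in s -> tens_to_calTs (M *m h t j) = Op (bT t j)) ->
  forall v, tens_to_calTs (M *m v) = Op (tens_to_calTs v).
Proof.
move=> OpS Oph v; rewrite {1}(gv v) mulmx_sumr linear_sum OpS big_seq [RHS]big_seq.
apply: eq_bigr => p; rewrite mem_str_index => /andP[ps _].
by rewrite -scalemxAr linearZ /= Oph.
Qed.

Lemma tens_to_calTs_iso : Uq_iso (Tops R dd) (calTs R dd) tens_to_calTs.
Proof.
have [_ hs _ _] := sb.
have ad t : t \in s -> adm_seq dd t by rewrite sE.
split.
- move=> u v uv; apply/eqP; rewrite -subr_eq0; apply/eqP.
  have : tens_to_calTs (u - v) = 0 by rewrite linearB uv subrr.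
  move: (u - v) => {uv}u u0; rewrite (gv u) big1_seq // => p /andP[_ pI].
  have [x px] := at_index_ex pI.
  have := congr1 (fun f : fT => f x) u0; rewrite /tens_to_calTs (sum_strT_at _ pI px) => ->.
  exact: scale0r.
- apply/seteqP; split=> [_ [v _ <-]|f]; first exact: calTs_sum_strT.
  move=> /calTs_sumP[c ->]; exists (\sum_(p <- idx) c p *: h p.1 p.2) => //.
  rewrite linear_sum big_seq [RHS]big_seq; apply: eq_bigr => p; rewrite mem_str_index => /andP[ps _].
  by rewrite linearZ /= tens_to_calTs_h.
- move=> v; split.
    apply: (@tens_to_calTs_op _ (@TE R k dd)) => [c|t j ts]; first exact: TE_sum_lin inv_strT.
    case: j => [|j]; first by rewrite (str_E0 (hs t ts)) linear0 (TE_strT0 R (ad t ts) (mE ts)).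
    by rewrite (str_E (hs t ts)) linearZ /= tens_to_calTs_h // (TE_strT R (ad t ts) (mE ts)).
  apply: (@tens_to_calTs_op _ (@TF R k dd)) => [c|t j ts]; first exact: TF_sum_lin inv_strT.
  by rewrite (str_F (hs t ts)) linearZ /= tens_to_calTs_h // (TF_strT R (ad t ts) (mE ts)).
- move=> v; split.
    apply: (@tens_to_calTs_op _ (@TK R k dd)) => [c|t j ts]; first exact: TK_sum_lin.
    by rewrite (str_K (hs t ts)) linearZ /= tens_to_calTs_h // (TK_strT R (ad t ts) (mE ts)).
  apply: (@tens_to_calTs_op _ (@TKV R k dd)) => [c|t j ts]; first exact: TKV_sum_lin.
  by rewrite (str_KV (qv_neq0 R) j (hs t ts)) linearZ /= tens_to_calTs_h // (TKV_strT R (ad t ts) (mE ts)).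
Qed.

End Construction.

Lemma exists_calTs_iso : string_basis A s m h -> exists phi : {linear 'cV[K]_(udim A) -> fT},
  Uq_iso (Tops R dd) (calTs R dd) phi.
Proof.
move=> sb; have [_ _ _ [g [gh gv]]] := sb; exists (tens_to_calTs g).
exact: (tens_to_calTs_iso sb gh gv).
Qed.

End Iso.

Lemma rank_nvec k (dd : k.-tuple nat) (b : {set vert dd * vert dd}) (x : Mvar (sumn dd)) :
  lower_match b -> (Mrank x == #|b|) = (Mker x == sumn (nvec b)).
Proof.
move=> /sumn_nvec sn; have := Mker_rank x; move: (Mker x) (Mrank x) (#|b|) (sumn (nvec b)) sn.
by move=> a b' c e; move: (sumn dd) => D h1 h2; apply/eqP/eqP; lia.
Qed.

Lemma nvec_bar_kvec k (dd : k.-tuple nat) t : adm_seq dd t ->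
  nvec (bar dd (kvec dd t)) = kvec dd t.
Proof. by move=> /adm_seqP[_ _ /nadmP[h1 h2]]; exact: nvec_surj. Qed.

(** * Intertwiners relative to an arbitrary identification *)

Section ArbitraryIso.
Variables (R : realType) (k : nat) (dd : k.-tuple nat).
Local Notation K := (Cq R).
Local Notation q := (qv R).
Local Notation d := (sumn dd).
Local Notation fT := (Tvar dd -> K^o).
Local Notation bT := (@strT R k dd).
Local Notation A := (Vtens R dd).
Variables (s : seq (seq nat)) (m : seq nat -> nat).
Hypothesis sE : forall t, (t \in s) = adm_seq dd t.
Hypothesis mE : forall t, t \in s -> (m t + (sumn t).*2 = d)%N.
Hypothesis uniq_s : uniq s.
Local Notation idx := (str_index s m).
Variable phi : {linear 'cV[K]_(udim A) -> fT}.
Hypothesis iso : Uq_iso (Tops R dd) (calTs R dd) phi.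

Let phi_inj : injective phi. Proof. by case: iso. Qed.
Let phi_mem v : calTs R dd (phi v). Proof. by case: iso => _ <- _ _; exists v. Qed.
Let phi_E v : phi (uE A *m v) = TE (phi v). Proof. by case: iso => _ _ /(_ v)[]. Qed.
Let phi_F v : phi (uF A *m v) = TF (phi v). Proof. by case: iso => _ _ /(_ v)[]. Qed.
Let phi_K v : phi (uK A *m v) = TK (phi v). Proof. by case: iso => _ _ _ /(_ v)[]. Qed.
Let phi_KV v : phi (uKV A *m v) = TKV (phi v). Proof. by case: iso => _ _ _ /(_ v)[]. Qed.

Lemma strT_preimage : exists v : seq nat -> nat -> 'cV[K]_(udim A), forall t j, phi (v t j) = bT t j.
Proof.
have ex (p : seq nat * nat) : exists v, phi v = bT p.1 p.2.
  have : (range phi) (bT p.1 p.2) by case: iso => _ -> _ _; exact: calTs_strT.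
  by case=> v _ hv; exists v.
have [w hw] := choice ex; exists (fun t j => w (t, j)) => t j; exact: (hw (t, j)).
Qed.

Section Preimage.
Variable v : seq nat -> nat -> 'cV[K]_(udim A).
Hypothesis vE : forall t j, phi (v t j) = bT t j.

Lemma preimage_string t : t \in s -> is_string (m t) (v t).
Proof.
move=> ts; have ad : adm_seq dd t by rewrite -sE.
split=> [|j|j|j|j mj]; apply: phi_inj.
- by rewrite phi_E vE (TE_strT0 R ad (mE ts)) linear0.
- by rewrite phi_E linearZ /= !vE (TE_strT R ad (mE ts)).
- by rewrite phi_F linearZ /= !vE (TF_strT R ad (mE ts)).
- by rewrite phi_K linearZ /= !vE (TK_strT R ad (mE ts)).
- by rewrite vE (strT_out R ad (mE ts)) // linear0.
Qed.

Lemma preimage_span u : exists c, u = \sum_(p <- idx) c p *: v p.1 p.2.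
Proof.
have [c hc] := calTs_sumP uniq_s sE mE (phi_mem u); exists c; apply: phi_inj.
by rewrite hc linear_sum; apply: eq_bigr => p _; rewrite linearZ /= vE.
Qed.

(** [T_b] sees only functions supported on the kernel vector [nvec b] and multiplies them by the
    flag count: it is a scalar on one string and kills all others. *)
Lemma represents_preimage b mu g t j : lower_match b -> represents phi b (mu := mu) g ->
  t \in s -> g *m v t j = (if kvec dd t == nvec b then flag_count R dd (nvec b) else 0) *: stdv K mu j.
Proof.
move=> lm [dE gE] ts; have ad : adm_seq dd t by rewrite -sE.
apply: (MV_inj dE); rewrite gE vE; apply/funext => x.
rewrite (@T_b_formula R k dd b _ _ (@type_fun_indT R k dd _ _)) linearZ /=.
have sn := sumn_nvec lm; have sk := sumn_kvec ad.
set c := (if kvec dd t == _ then _ else _).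
transitivity (c * MV R d #|b| mu (stdv K mu j) x); last exact: erefl.
rewrite (MVE dE) (rank_nvec _ lm) /c [nvec b == _]eq_sym.
case: eqP => hk; last by case: ifP; rewrite mulr0.
case: eqP => [e|_]; last by rewrite mulr0 mul0r.
have hr : Mrank x = #|b| by apply/eqP; rewrite (rank_nvec _ lm) hk.
have [h _] := MrankP dE hr; rewrite (coef_cV_col (fun i => (i == j)%:R)) //.
congr (_ * (nat_of_bool _)%:R); have := MrankW x; rewrite hr /= => rw.
have -> : sumn t = #|b|.
  by apply/eqP; rewrite -(eqn_add2l (sumn (nvec b))) sn -sk e.
by rewrite -{1}(subnKC rw) eqn_add2l.
Qed.

End Preimage.

(** Row [j] of the matrix evaluates [phi] at a point with kernel vector [nvec b] and
    [\dim W = #|b| + j], times the flag count. Such points exist because [nvec b] satisfies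
    [nadm]. *)
Lemma exists_represents b mu : lower_match b -> (#|b|.*2 + mu = d)%N ->
  exists g, represents phi b (mu := mu) g.
Proof.
move=> lm dE; have sn := sumn_nvec lm.
have ex (j : 'I_mu.+1) : exists x : Tvar dd,
    alpha_ker x = nvec b /\ MdimW (pvar x) = (#|b| + j)%N.
  by apply: exists_Tvar; [exact: nvec_nadm | have := ltn_ord j; clear -sn dE; lia].
have [pt hpt] := boolp.choice ex.
pose g : 'M[K]_(mu.+1, udim A) := \matrix_(j, i) (flag_count R dd (nvec b) * phi (delta_mx i 0) (pt j)).
exists g; split=> // u; apply/funext => x.
have [G fG] := calTs_type_fun (phi_mem u).
rewrite (MVE dE) (T_b_formula b fG) (rank_nvec _ lm); case: eqP => // hk.
have hr : Mrank x = #|b| by apply/eqP; rewrite (rank_nvec _ lm) hk.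
have [h _] := MrankP dE hr; have := MrankW x; rewrite hr => rw.
pose j := Ordinal (h : (MdimW x - #|b| < mu.+1)%N).
have [h1 h2] := hpt j; rewrite /= subnKC // in h2.
rewrite -[LHS]/(coef_cV _ j) coef_cVE -h1 -h2 -fG mxE.
have -> : phi u (pt j) = \sum_i u i 0 * phi (delta_mx i 0) (pt j).
  rewrite {1}[u]matrix_sum_delta linear_sum fct_sumE; apply: eq_bigr => i _.
  rewrite big_ord1 linearZ; exact: erefl.
by rewrite mulr_sumr h1; apply: eq_bigr => i _; rewrite mxE mulrC mulrCA.
Qed.

Lemma represents_hom b mu g : represents phi b (mu := mu) g -> Uq_Hom A (Vn R mu) g.
Proof.
move=> [dE gE]; split; apply: mulmx_cV_ext => u; rewrite -!mulmxA; apply: (MV_inj dE);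
  have [G fG] := calTs_type_fun (phi_mem u); rewrite gE.
- by rewrite phi_E (T_b_TE b fG) -gE -(MV_ME dE).
- by rewrite phi_F (T_b_TF b fG) -gE -(MV_MF dE).
- by rewrite phi_K (T_b_TK b fG) -gE -(MV_MK dE).
- by rewrite phi_KV (T_b_TKV b fG) -gE -(MV_MKV dE).
Qed.

(** An intertwiner is a scalar [c t] on each string and vanishes on those of length other than [mu],
    by [string_Vrep]. The match [bar dd (kvec dd t)] has kernel vector [kvec dd t], so its matrix
    isolates string [t]. *)
Lemma hom_span mu : linspan [set g | exists b : {set vert dd * vert dd},
    lower_match b /\ represents phi b (mu := mu) g] = Uq_Hom A (Vn R mu).
Proof.
apply/seteqP; split=> g.
  apply: linspan_sub => [|a g1 g2 [e1 f1 k1 v1] [e2 f2 k2 v2]|g' [b [_ /represents_hom]]] //.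
    by split; rewrite mul0mx mulmx0.
  by split; rewrite mulmxDl mulmxDr -scalemxAl -scalemxAr ?(e1, f1, k1, v1) ?(e2, f2, k2, v2).
move=> gH; have [v vE] := strT_preimage.
have exc t : exists c : K, t \in s ->
    (m t != mu -> c = 0) /\ forall j, g *m v t j = c *: stdv K mu j.
  case: (boolP (t \in s)) => ts; last by exists 0.
  have [c ct] := string_Vrep (@qv_nroot R) (string_hom gH (preimage_string vE ts)).
  by exists c.
have [c hc] := boolp.choice exc.
have exg t : exists g' : 'M[K]_(udim (Vn R mu), udim A), t \in s -> m t = mu ->
    represents phi (bar dd (kvec dd t)) (mu := mu) g'.
  case: (boolP ((t \in s) && (m t == mu))) => [/andP[ts /eqP mt]|no]; last first.
    by exists 0 => ts mt; rewrite ts mt eqxx in no.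
  have [|g' hg'] := @exists_represents (bar dd (kvec dd t)) mu (bar_lower_match _ _); last by exists g'.
  have ad : adm_seq dd t by rewrite -sE.
  have := sumn_nvec (bar_lower_match dd (kvec dd t)); rewrite nvec_bar_kvec //.
  by have := sumn_kvec ad; have := mE ts; rewrite mt; lia.
have [gb hgb] := boolp.choice exg.
pose fc t := flag_count R dd (kvec dd t).
have fc0 t : t \in s -> fc t != 0.
  by move=> ts; apply: flag_count_neq0; have [] := @adm_seqP _ dd t; rewrite -?sE.
(* Since [gb t] is multiplication by [fc t] on string [t] and 0 on the others, the coefficient has
   to be [c t / fc t]; equality is checked on the spanning vectors [v t j]. *)
have -> : g = \sum_(t <- s | m t == mu) (c t / fc t) *: gb t.
  apply: mulmx_cV_ext => u; have [a ->] := preimage_span vE u.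
  rewrite !mulmx_sumr big_seq [RHS]big_seq; apply: eq_bigr => -[t j].
  rewrite mem_str_index => /andP[/= ts jm]; rewrite -!scalemxAr; congr (_ *: _).
  have [ct ->] := hc t ts; rewrite mulmx_suml big_mkcond (bigD1_seq t) //=.
  have act t' : t' \in s -> m t' = mu -> gb t' *m v t j =
      (if kvec dd t == kvec dd t' then fc t' else 0) *: stdv K mu j.
    move=> t's mt'; have ad : adm_seq dd t' by rewrite -sE.
    by rewrite (represents_preimage vE j (bar_lower_match _ _) (hgb t' t's mt') ts) nvec_bar_kvec.
  rewrite big1_seq ?addr0 => [|t' /andP[tt' t's]]; last first.
    case: eqP => // mt'; rewrite -scalemxAl act //; case: eqP => [e|_]; last by rewrite scale0r scaler0.
    by move: tt'; rewrite (kvec_inj _ _ e) ?eqxx // -sE.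
  case: eqP => [mt|/eqP mt]; last by rewrite ct // scale0r.
  by rewrite -scalemxAl act // eqxx scalerA divfK // fc0.
rewrite big_seq_cond; apply: linspan_sum => t /andP[ts /eqP mt]; apply: linspanZ; apply: linspan_gen.
by exists (bar dd (kvec dd t)); split; [exact: bar_lower_match | exact: hgb].
Qed.

End ArbitraryIso.

Lemma Vtens_string_basis (R : realType) (k : nat) (dd : k.-tuple nat) : (0 < k)%N ->
  exists s m h, [/\ string_basis (Vtens R dd) s m h, forall t, (t \in s) = adm_seq dd t
    & forall t, t \in s -> (m t + (sumn t).*2 = sumn dd)%N].
Proof.
case: dd => [[|x l] /= sz] k0; first by rewrite -(eqP sz) in k0.
exact: (tensor_string_basis (qv_neq0 R) (qv_sub_neq0 R) (@qv_nroot R) x l).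
Qed.

Theorem theorem3p5p1 (R : realType) (k : nat) (dd : k.-tuple nat) (hk : (0 < k)%N) :
  [/\ forall r mu : nat, (r.*2 + mu = sumn dd)%N ->
        Uq_iso (A := Vn R mu) (Mops R (sumn dd)) (calM R (sumn dd) r)
          (MV R (sumn dd) r mu),
      exists phi : {linear 'cV[Cq R]_(udim (Vtens R dd)) -> (Tvar dd -> (Cq R)^o)},
        Uq_iso (Tops R dd) (calTs R dd) phi,
      forall phi : {linear 'cV[Cq R]_(udim (Vtens R dd)) -> (Tvar dd -> (Cq R)^o)},
        Uq_iso (Tops R dd) (calTs R dd) phi ->
        (forall b : {set vert dd * vert dd}, lower_match b ->
           exists mu g, represents phi b (mu := mu) g) /\
        (forall mu : nat,
           linspan [set g | exists b : {set vert dd * vert dd},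
                              lower_match b /\ represents phi b (mu := mu) g]
           = Uq_Hom (Vtens R dd) (Vn R mu))
    & forall b : {set vert dd * vert dd}, lower_match b ->
        exists c : Cq R, c != 0 /\
          forall a : k.-tuple nat, (forall i, tnth a i <= tnth dd i)%N ->
            T_ (Yset_b b) (ind R (Yset_a a)) =
            if bar dd a == b then c *: indM R (sumn dd) #|b| (sumn a) else 0].
Proof.
have [s [m [h [sb sE mE]]]] := Vtens_string_basis R dd hk.
have [us _ _ _] := sb.
split.
- by move=> r mu dE; exact: calM_iso.
- exact: exists_calTs_iso us sE mE sb.
- move=> phi iso; split=> [b lm|mu]; last exact: (hom_span sE mE us iso).
  (* That [2 |b| <= d], so that the subtraction is not truncated, follows from the string [t] with
     [kvec dd t = nvec b]: its highest weight [m t] is a natural number. *)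
  have e : (#|b|.*2 + (sumn dd - #|b|.*2) = sumn dd)%N.
    have [t ad ht] := kvec_surj (nvec_nadm lm).
    have sn := sumn_nvec lm; have sk := sumn_kvec ad.
    have tb : sumn t = #|b| by apply/eqP; rewrite -(eqn_add2l (sumn (nvec b))) sn -sk ht.
    by rewrite subnKC // -tb -(mE t) ?sE // leq_addl.
  by exists (sumn dd - #|b|.*2)%N; exact: (exists_represents iso lm e).
- move=> b lm; exists (flag_count R dd (nvec b)); split.
    exact/flag_count_neq0/nvec_nadm.
  move=> a _; apply/funext => x.
  rewrite (@T_b_formula R k dd b _ _ (@type_fun_indT R k dd (nvec (bar dd a)) (sumn a))).
  case: (eqVneq (bar dd a) b) => [->|ne].
    transitivity (flag_count R dd (nvec b) * indM R (sumn dd) #|b| (sumn a) x); last exact: erefl.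
    rewrite /indM /ind (rank_nvec x lm) eqxx.
    by case: eqP => _; rewrite ?mulr0.
  (* Different matches have different kernel vectors, so [Y_b] and [Y_a] are disjoint. *)
  have -> : (nvec b == nvec (bar dd a)) = false.
    by apply/eqP => e; rewrite (nvec_inj (bar_lower_match dd a) lm (esym e)) eqxx in ne.
  by rewrite mulr0; case: ifP.
Qed.
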